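(* Let $r\ge 2$ be a fixed integer, and let $a(n)$ denote the number of non-isomorphic Abelian groups of order $n$. Let $\Delta_r(x):=\Delta\big((1,\underbrace{2,2,\ldots,2}_{2^r-1});x\big)$ be the remainder term in the asymptotic formula for the summatory function of the generalized divisor function $d\big((1,2,\ldots,2);n\big)=\#\{(d_1,\ldots,d_{2^r}) \in \mathbb{N}^{2^r}: d_1 d_2^2 d_3^2\cdots d_{2^r}^2=n\}$ (with $2^r-1$ exponents equal to $2$). Assume that there are real constants $\alpha_r,\beta_r$ with $1/3<\alpha_r<1/2$ such that $\Delta_r(x)\ll x^{\alpha_r}(\log x)^{\beta_r}$ as $x\to\infty$. Then \[ \sum_{n\le x}(a(n))^r = C_r x + x^{1/2}Q_{2^r-2}(\log x) + R_r(x), \] where \[ C_r:=\prod_p\left(1+\sum_{\nu=2}^{\infty}\frac{(P(\nu))^r-(P(\nu-1))^r}{p^\nu}\right) \] (the product over all primes $p$), $Q_{2^r-2}$ is a polynomial of degree $2^r-2$, and $R_r(x)\ll x^{\alpha_r}(\log x)^{\beta_r}$.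
   Context: $P(\nu)$ denotes the number of unrestricted partitions of the integer $\nu\ge 0$; the function $a$ is multiplicative with $a(p^\nu)=P(\nu)$ for primes $p$ and $\nu\ge1$. For $\mathbf{j}=(j_1,\ldots,j_t)\in\mathbb{N}^t$ with $1\le j_1\le\cdots\le j_t$, the generalized divisor function is $d(\mathbf{j};n):=\sum_{d_1^{j_1}\cdots d_t^{j_t}=n}1$ (sum over $t$-tuples of positive integers), and $\Delta(\mathbf{j};x)$ is defined by $\sum_{n\le x}d(\mathbf{j};n)=H(\mathbf{j};x)+\Delta(\mathbf{j};x)$, where the main term $H(\mathbf{j};x)$ is the sum of the residues of $\zeta(j_1s)\cdots\zeta(j_ts)\,x^s/s$ at its poles $s=1/j_1,\ldots,1/j_t$ (distinct values), $\zeta$ being the Riemann zeta function. *)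

(* Defs.v *)
From HB Require Import structures.
From mathcomp Require Import all_boot all_order all_algebra all_fingroup.
From mathcomp Require Import all_classical all_reals all_analysis.
From mathcomp Require Import complex.
Set Implicit Arguments.
Unset Strict Implicit.
Unset Printing Implicit Defensive.
Import Order.TTheory GRing.Theory Num.Theory numFieldNormedType.Exports.
Local Open Scope classical_set_scope.
Local Open Scope complex_scope.
Local Open Scope ring_scope.

(* Every group of order n is isomorphic to one whose carrier is 'I_n, so the
   isomorphism classes of Abelian groups of order n are the classes of Abelian
   group laws on 'I_n under transport along a permutation. *)
Section AbelianGroups.
Variable n : nat.
Implicit Types m : {ffun 'I_n -> {ffun 'I_n -> 'I_n}}.

Definition abelian_law m : bool :=
  [&& [forall x, forall y, forall z, m x (m y z) == m (m x y) z],
      [forall x, forall y, m x y == m y x]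
    & [exists e, forall x, (m e x == x) && [exists y, m x y == e]]].

Definition isog_law m1 m2 : bool :=
  [exists s : {perm 'I_n}, forall x, forall y, s (m1 x y) == m2 (s x) (s y)].

Definition num_abelian : nat :=
  #|equivalence_partition isog_law [set m | abelian_law m]%SET|.

End AbelianGroups.

(* mu i is the number of parts equal to i.+1. *)
Definition num_partitions (n : nat) : nat :=
  #|[set mu : {ffun 'I_n -> 'I_n.+1} |
      (\sum_(i < n) i.+1 * mu i == n)%N]%SET|.

(* d(j; n).  For n > 0 and positive exponents, the entries of a solution divide
   n, so bounding them by n loses nothing. *)
Definition gen_divisor (j : seq nat) (n : nat) : nat :=
  #|[set d : {ffun 'I_(size j) -> 'I_n.+1} |
      [forall i, (0 < d i)%N] &&
      (\prod_(i < size j) d i ^ nth 0 j i == n)%N]%SET|.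

Section Analysis.
Variable R : realType.
(* R[i] gets its normed topology through the alias (R[i])^o. *)
Local Notation C := ((R[i])^o).
Implicit Types (f : C -> C) (c : nat -> C) (s z rho : C) (x : R).

(* a ^ s = exp (s * ln a), for 0 < a. *)
Definition cpow (a : R) (s : C) : C :=
  (expR (complex.Re s * ln a))%:C *
  (cos (complex.Im s * ln a) +i* sin (complex.Im s * ln a)).

Definition analytic_at f z0 : Prop :=
  exists c, \forall z \near z0,
    series (fun k => c k * (z - z0) ^+ k) @ \oo --> f z.

(* rho is the coefficient of (z - z0)^-1 in a Laurent expansion of f with
   finite principal part, valid in a punctured neighbourhood of z0. *)
Definition is_residue f z0 rho : Prop :=
  exists (N : nat) c,
    (\forall z \near z0^',
       series (fun k => c k * (z - z0) ^+ k / (z - z0) ^+ N.+1) @ \oo --> f z)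
    /\ rho = c N.

Definition residue f z0 : C := xget 0 [set rho | is_residue f z0 rho].

(* The analytic continuation of the Dirichlet series to 0 < Re s, s <> 1.  It is
   unique there; nothing is said about the values elsewhere. *)
Definition is_zeta f : Prop :=
  (forall s, 1 < complex.Re s ->
     series (fun n => cpow n.+1%:R (- s)) @ \oo --> f s) /\
  (forall s, 0 < complex.Re s -> s != 1 -> analytic_at f s).

Definition zeta : C -> C := xget (fun=> 0) [set f | is_zeta f].

(* H(j; x): undup lists the distinct poles once each. *)
Definition main_term (j : seq nat) x : C :=
  \sum_(q <- undup j)
    residue (fun s => (\prod_(i <- j) zeta (i%:R * s)) * cpow x s / s) q%:R^-1.

(* Delta(j; x); its value is real since the residues above are. *)
Definition remainder (j : seq nat) x : C :=
  (\sum_(1 <= n < (Num.truncn x).+1) gen_divisor j n)%N%:R - main_term j x.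

(* f << g as x -> +oo, for eventually nonnegative g. *)
Definition vinogradov (f g : R -> R) : Prop :=
  exists K : R, \forall x \near +oo, `|f x| <= K * g x.

Definition euler_factor_psum (r p : nat) : R ^nat := fun N =>
  \sum_(2 <= v < N)
    ((num_partitions v ^ r)%N%:R - (num_partitions v.-1 ^ r)%N%:R) / p%:R ^+ v.

Definition euler_pprod (r : nat) : R ^nat := fun N =>
  \prod_(p < N | prime p) (1 + limn (euler_factor_psum r p)).

Definition euler_const (r : nat) : R := limn (euler_pprod r).

End Analysis.

(* Main.v *)
(* Write k = 2^r - 1, D(x) for the summatory function of d((1,2,...,2); n), and
   Z = zeta(2).

   If zeta(s) zeta(2s)^k x^s/s has a Laurent expansion at a pole for one x, then
   the expansion for every other x is its product with the power series of
   (x/x0)^s, so the residue at 1/j is x^(1/j) times a polynomial in log x; this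
   uses nothing about zeta.  Hence D(x) = x P1(log x) + x^(1/2) P2(log x) + error.
   On the other hand Z^k x - D(x) is elementarily of exact order
   x^(1/2) (log x)^(k-1), which forces P1 = Z^k and deg P2 = k - 1.

   By the structure theorem a(n)^r is the multiplicative function with local
   coefficients P(v)^r.  Multiplying its local series by (1 - t)(1 - t^2)^k kills
   the coefficients of t and t^2 because P(2)^r - 1 = k, so the quotient f
   satisfies sum |f(m)| m^-s < oo for s > 1/3, and the summatory function of a^r
   is sum_m f(m) D(x/m).  Inserting the asymptotics of D gives the main terms;
   the leading coefficient of Q is that of P2 times sum f(m) m^-(1/2), a
   positive Euler product.  The constant of x is identified with C_r by
   computing the mean value of a^r a second time, dividing by zeta(s) only. *)
Require Import Defs.
From HB Require Import structures.
From mathcomp Require Import all_boot all_order all_algebra all_fingroup all_solvable.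
From mathcomp Require Import all_classical all_reals all_analysis.
From mathcomp Require Import complex zify ring lra.
Import Order.TTheory GRing.Theory Num.Theory numFieldNormedType.Exports.
Local Open Scope classical_set_scope.
Local Open Scope ring_scope.
Set Implicit Arguments.
Unset Strict Implicit.
Unset Printing Implicit Defensive.

(** * Residues *)

(** The definitions fix [zeta] and [residue] by choice, with default values, so P1 and P2 start as
    unknowns: where no Laurent expansion exists the residue is 0, and the form x^(1/j) P(log x)
    still holds with P = 0. The assumed bound on the remainder pins them down: with x = e^s, an
    error below x^(1/2) turns the comparison with Z^k x - D(x) into one between e^(s/2) times a
    polynomial, a polynomial, and a quantity of exact order s^(k-1).

    In sum_m f(m) D(x/m), once extended to all m, the arguments x/m go down to 0, where the assumed
    asymptotics say nothing. The extension makes the main terms exact convergent series. The error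
    at x/m is bounded, uniformly in m, by m^(-sigma) times a function of x, for one sigma with 1/3 <
    sigma < alpha; the gap alpha - sigma absorbs the powers of log m and copes with either sign of
    beta.

    The linear coefficient comes out as Z^k sum f(m)/m. Dividing by zeta(s) alone already leaves a
    series that converges absolutely at s = 1 and whose Euler factors are those of C_r, so
    uniqueness of the mean value matches the two. *)

(* Convergence at twice the point makes the series geometrically dominated. *)
Lemma series_coef_bound (K : numFieldType) (a : nat -> K) (w : K) :
  cvgn (series (fun k => a k * (2 * w) ^+ k) : K^o ^nat) ->
  exists2 M : K, 0 <= M & forall k, `|a k * w ^+ k| <= M / 2 ^+ k.
Proof.
move=> h; have /cvg_series_cvg_0 /cvgP /cvg_seq_bounded := h.
case/pinfty_ex_gt0 => M M0 hM; exists M => [|k]; first exact: ltW.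
have h2 : 0 < 2 ^+ k :> K by rewrite exprn_gt0.
rewrite ler_pdivlMr//.
have := hM k I; rewrite /= exprMn mulrCA [X in X <= _]normrM => {}hM.
have h2' : `|2 ^+ k : K| = 2 ^+ k by rewrite ger0_norm ?ltW.
by rewrite mulrC -{1}h2'.
Qed.

(** This gives n^2 / 2^n <= 512 / n. For n <= 8 the cube is at most 8^3 = 512; beyond that, passing
    from n to n + 1 at most doubles it. *)
Lemma cube_le_exp2 n : (n ^ 3 <= 512 * 2 ^ n)%N.
Proof.
have [h|h] := leqP n 8.
  apply: (@leq_trans 512%N); last by rewrite leq_pmulr// expn_gt0.
  by apply: (@leq_trans (8 ^ 3)%N) => //; rewrite leq_exp2r.
elim: n h => // n IH; rewrite leq_eqVlt => /orP[/eqP [<-]//|h].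
rewrite [(2 ^ _)%N]expnS; apply: (@leq_trans (2 * n ^ 3)%N); last first.
  by rewrite [leqRHS]mulnCA leq_mul2l IH.
by rewrite !expnS expn0; nia.
Qed.

(** The gap consists of the u_i v_j with i, j < n and i + j >= n: at most n^2 terms, each bounded by
    M N / 2^(i+j) <= M N / 2^n. *)
Lemma convolution_gap (K : numFieldType) (u v : nat -> K) (M N : K) (n : nat) :
  (forall k, `|u k| <= M / 2 ^+ k) -> (forall k, `|v k| <= N / 2 ^+ k) ->
  `|(\sum_(0 <= k < n) u k) * (\sum_(0 <= k < n) v k)
    - \sum_(0 <= k < n) \sum_(0 <= i < k.+1) u i * v (k - i)%N|
  <= M * N * (n%:R ^+ 2 / 2 ^+ n).
Proof.
move=> hu hv.
have M0 : 0 <= M by have := hu 0%N; rewrite expr0 divr1; apply: le_trans.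
have N0 : 0 <= N by have := hv 0%N; rewrite expr0 divr1; apply: le_trans.
have D0 : 0 <= M * N / 2 ^+ n by rewrite !mulr_ge0 ?invr_ge0 ?exprn_ge0.
have -> : \sum_(0 <= k < n) \sum_(0 <= i < k.+1) u i * v (k - i)%N
    = \sum_(0 <= i < n) \sum_(0 <= j < n - i) u i * v j.
  elim: n {D0} => [|n IH]; first by rewrite !big_geq.
  rewrite big_nat_recr//= IH [in RHS]big_nat_recr//= subSn// subnn big_nat1.
  rewrite [X in _ + X]big_nat_recr//= addrA subnn; congr (_ + _).
  rewrite -big_split/=; apply: eq_big_nat => i /andP[_ hi].
  by rewrite subSn ?(ltnW hi)// big_nat_recr.
have -> : (\sum_(0 <= k < n) u k) * (\sum_(0 <= k < n) v k)
    - \sum_(0 <= i < n) \sum_(0 <= j < n - i) u i * v j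
    = \sum_(0 <= i < n) \sum_(n - i <= j < n) u i * v j.
  rewrite big_distrlr /= -sumrB; apply: eq_big_nat => i /andP[_ hi].
  rewrite (big_cat_nat (n := n - i)) ?leq_subr//=.
  by rewrite addrAC subrr add0r.
apply: (le_trans (ler_norm_sum _ _ _)).
apply: (@le_trans _ _ (\sum_(0 <= i < n) \sum_(0 <= j < n) M * N / 2 ^+ n)); last first.
  rewrite !sumr_const_nat !subn0 -[leLHS]mulr_natr -[X in X * _ <= _]mulr_natr expr2.
  by rewrite -!mulrA (mulrC _^-1) !mulrA.
apply: ler_sum_nat => i /andP[_ hi].
apply: (le_trans (ler_norm_sum _ _ _)).
apply: (@le_trans _ _ (\sum_(n - i <= j < n) M * N / 2 ^+ n)); last first.
  rewrite !sumr_const_nat -[leLHS]mulr_natr -[leRHS]mulr_natr ler_wpM2l//.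
  by rewrite ler_nat subn0 leq_subr.
apply: ler_sum_nat => j /andP[hj _].
rewrite normrM; apply: (@le_trans _ _ (M / 2 ^+ i * (N / 2 ^+ j))); first by rewrite ler_pM.
rewrite mulrACA -invfM -exprD ler_wpM2l ?mulr_ge0//.
rewrite lef_pV2 ?posrE ?exprn_gt0// ler_weXn2l ?ler1n//.
by rewrite -leq_subLR.
Qed.

(** The limit of n^2 / 2^n is a premise because [K] may be non-archimedean. *)
Lemma cauchy_product (K : numFieldType) (u v : nat -> K^o) (U V M N : K^o) :
  (fun n => n%:R ^+ 2 / 2 ^+ n : K^o) @ \oo --> (0 : K^o) ->
  (forall k, `|u k| <= M / 2 ^+ k) -> (forall k, `|v k| <= N / 2 ^+ k) ->
  series u @ \oo --> U -> series v @ \oo --> V ->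
  series (fun k => \sum_(0 <= i < k.+1) u i * v (k - i)%N) @ \oo --> (U * V : K^o).
Proof.
move=> geo hu hv cu cv.
set w := (fun k => _).
have hd : (fun n => series u n * series v n - series w n) @ \oo --> (0 : K^o).
  apply/cvgrPdist_lt => e e0.
  have : (fun n => M * N * (n%:R ^+ 2 / 2 ^+ n) : K^o) @ \oo --> (M * N * 0 : K^o).
    by apply: cvgM; [exact: cvg_cst|exact: geo].
  rewrite mulr0 => /cvgrPdist_lt /(_ _ e0); apply: filterS => n.
  rewrite !sub0r !normrN; apply: le_lt_trans.
  apply: le_trans (@convolution_gap K u v M N n hu hv) _.
  by apply: real_ler_norm; apply: ger0_real; apply: le_trans (@convolution_gap K u v M N n hu hv).
have : (fun n => series u n * series v n - (series u n * series v n - series w n)) @ \oo --> (U * V - 0 : K^o).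
  by apply: cvgB => //; apply: cvgM.
rewrite subr0; apply: cvg_trans; apply: near_eq_cvg; near=> n.
by rewrite opprB addrC subrK.
Unshelve. all: by end_near. Qed.

Section ComplexSeries.
Variable R : realType.
Local Open Scope complex_scope.
Local Notation C := ((R[i])^o).

Lemma cvg_complex (u : nat -> R) (l : R) :
  u @ \oo --> l -> (fun n => (u n)%:C : C) @ \oo --> (l%:C : C).
Proof.
move=> /cvgrPdist_lt h; apply/cvgrPdist_lt => e e0.
have eE : e = (complex.Re e)%:C by rewrite RRe_real// gtr0_real.
have e0' : 0 < complex.Re e by rewrite -ltcR -eE.
have := h _ e0'; apply: filterS => n hn.
by rewrite eE -raddfB normc_def /= expr0n addr0 sqrtr_sqr ltcR.
Qed.

Lemma cvg_sqr_geom : (fun n => n%:R ^+ 2 / 2 ^+ n : C) @ \oo --> (0 : C).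
Proof.
have -> : (fun n => n%:R ^+ 2 / 2 ^+ n : C) = (fun n => (n%:R ^+ 2 / 2 ^+ n : R)%:C).
  by apply/funext => n; rewrite rmorphM fmorphV !rmorphXn !rmorph_nat.
rewrite -(rmorph0 (real_complex R)); apply: cvg_complex.
have h : (fun n => 512 * n.+1%:R^-1 : R) @ \oo --> (0 : R).
  rewrite -[X in _ --> X](mulr0 512); apply: cvgMr; exact: cvg_harmonic.
rewrite -(cvg_shiftS (fun n => n%:R ^+ 2 / 2 ^+ n : R)).
apply: squeeze_cvgr h; [near=> n|exact: cvg_cst].
rewrite divr_ge0 ?exprn_ge0//= ler_pdivrMr ?exprn_gt0// mulrAC ler_pdivlMr// -exprSr.
have := cube_le_exp2 n.+1; rewrite -(ler_nat R) natrX natrM natrX.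
by [].
Unshelve. all: by end_near. Qed.

End ComplexSeries.

Definition cexp_coeff (K : fieldType) (z : K) (k : nat) : K := z ^+ k / k`!%:R.

Lemma cexp_coeffD (K : numFieldType) (w z : K) (k : nat) :
  \sum_(0 <= i < k.+1) cexp_coeff w i * cexp_coeff z (k - i) = cexp_coeff (z + w) k.
Proof.
rewrite /cexp_coeff exprDn mulr_suml big_mkord; apply: eq_bigr => i _.
have ik : (i <= k)%N by rewrite -ltnS ltn_ord.
have h0 j : (j`!%:R : K) != 0 by rewrite pnatr_eq0 -lt0n fact_gt0.
have := h0 k; rewrite -(bin_fact ik) -[_ *+ 'C(_, _)]mulr_natr !natrM !mulf_eq0 !negb_or => /andP[c0 /andP[a0 b0]].
by field; rewrite a0 b0.
Qed.

Section ComplexExp.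
Variable R : realType.
Local Open Scope complex_scope.
Local Notation C := ((R[i])^o).

(** Built from [expR], [cos] and [sin] as [cpow] is, so that [cpow x s] unfolds to the exponential
    of s ln x; [cexp_cvg] recovers the power series. *)
Definition cexp (z : C) : C :=
  (expR (complex.Re z))%:C * (cos (complex.Im z) +i* sin (complex.Im z)).

Lemma cexp_series_real (x : R) : series (cexp_coeff (x%:C : R[i]) : C ^nat) @ \oo --> ((expR x)%:C : C).
Proof.
have h := @cvg_complex R _ _ (is_cvg_series_exp_coeff x).
rewrite (_ : series _ = fun n => (series (exp_coeff x) n)%:C); first exact: h.
apply/funext => n.
rewrite /series /= rmorph_sum; apply: eq_bigr => k _.
by rewrite /exp_coeff /cexp_coeff /= rmorphM fmorphV rmorphXn rmorph_nat.
Qed.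

Lemma cexp_series_imag (y : R) : series (cexp_coeff (0 +i* y : R[i]) : C ^nat) @ \oo --> (cos y +i* sin y : C).
Proof.
have hc := @cvg_complex R _ _ (@is_cvg_series_cos_coeff R y).
have hs := @cvg_complex R _ _ (@is_cvg_series_sin_coeff R y).
have -> : cos y +i* sin y = (limn (series (cos_coeff y)))%:C + 'i * (limn (series (sin_coeff y)))%:C.
  by rewrite cos.unlock sin.unlock [LHS]complexE.
have h : (fun n => (series (cos_coeff y) n)%:C + 'i * (series (sin_coeff y) n)%:C : C) @ \oo --> ((limn (series (cos_coeff y)))%:C + 'i * (limn (series (sin_coeff y)))%:C : C).
  by apply: cvgD hc _; apply: cvgM hs; exact: cvg_cst.
rewrite (_ : series _ = fun n => (series (cos_coeff y) n)%:C + 'i * (series (sin_coeff y) n)%:C); first exact: h.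
apply/funext => n.
rewrite /series /= !rmorph_sum mulr_sumr -big_split/=; apply: eq_bigr => k _.
have -> : 0 +i* y = 'i * y%:C :> R[i] by apply/eqP; rewrite eq_complex/=; apply/andP; split; apply/eqP; ring.
rewrite cos_coeffE sin_coeffE /= /cexp_coeff exprMn.
have -> : 'i ^+ k = (if odd k then 'i else 1) * (-1) ^+ k./2 :> R[i].
  rewrite -{1}(odd_double_half k) exprD -muln2 mulnC exprM sqr_i.
  by case: (odd k).
have [ok|ok] := boolP (odd k).
  have -> : k.-1./2 = k./2 by case: k ok => //= k ok; rewrite uphalf_half (negbTE ok).
  rewrite /= ?mulr0n ?mulr1n !mul0r rmorph0 add0r mul1r !rmorphM fmorphV /= !rmorphXn rmorph_nat rmorphN1.
  by rewrite -!mulrA; congr (_ * (_ * _)); rewrite mulrC.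
rewrite /= ?mulr0n ?mulr1n !mul0r rmorph0 mulr0 addr0 !mul1r !rmorphM fmorphV /= !rmorphXn rmorph_nat rmorphN1.
by rewrite -!mulrA; congr (_ * _); rewrite mulrC.
Qed.

End ComplexExp.

(** Strong induction on the index. Once the earlier coefficients vanish, the partial sums at w0 t
    are a_m (w0 t)^m plus a tail of size at most 2 M t^(m+1). They tend to 0, so |a_m w0^m| <= (2 M
    + 1) t for every 0 < t <= 1. *)
Lemma power_series_eq0 (K : numFieldType) (a : nat -> K) (e : K) : 0 < e ->
  (forall w, w != 0 -> `|w| < e ->
     series (fun k => a k * w ^+ k : K^o) @ \oo --> (0 : K^o)) ->
  forall k, a k = 0.
Proof.
move=> e0 h; elim/ltn_ind => m IH.
(* [series_coef_bound] needs convergence at 2 w0, hence the extra factor 2 inside the disc. *)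
pose w0 := e / 4.
have w00 : 0 < w0 by rewrite divr_gt0.
have hw (x : K) : 0 < x -> x < e -> `|x| < e /\ x != 0.
  by move=> x0 xe; rewrite gtr0_norm// gt_eqF.
have [M M0 hM] : exists2 M : K, 0 <= M & forall k, `|a k * w0 ^+ k| <= M / 2 ^+ k.
  apply: series_coef_bound; apply/cvgP; apply: h.
    by rewrite mulf_neq0 ?gt_eqF.
  rewrite gtr0_norm ?mulr_gt0// /w0 mulrCA gtr_pMr//.
  by rewrite ltr_pdivrMr// mul1r ltr_nat.
have key (t : K) : 0 < t -> t <= 1 -> `|a m * w0 ^+ m| <= (2 * M + 1) * t.
  move=> t0 t1.
  have wt : 0 < w0 * t by rewrite mulr_gt0.
  have wte : w0 * t < e.
    apply: (@le_lt_trans _ _ (w0 * 1)); first by rewrite ler_pM2l.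
    by rewrite mulr1 /w0 ltr_pdivrMr// ltr_pMr// ltr1n.
  have [h1 h2] := hw _ wt wte.
  (* The partial sums are brought within t^(m+1) of 0; this is the 1 in 2 M + 1. *)
  have /cvgrPdist_lt /(_ _ (exprn_gt0 m.+1 t0)) [n _ hn] := h _ h2 h1.
  have := hn (n + m.+1)%N (leq_addr _ _); rewrite sub0r normrN /series /=.
  rewrite (big_cat_nat (n := m.+1)) ?leq_addl//= big_nat_recr//= big1_seq ?add0r; last first.
    by move=> i /andP[_]; rewrite mem_index_iota => /andP[_ /IH ->]; rewrite mul0r.
  set T := \sum_(_ <= i < _) _ => hlt.
  have hT : `|T| <= 2 * M * t ^+ m.+1.
    apply: (le_trans (ler_norm_sum _ _ _)).
    apply: (@le_trans _ _ (\sum_(m.+1 <= i < n + m.+1) M * t ^+ m.+1 * 2^-1 ^+ i)).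
      apply: ler_sum_nat => i /andP[hi _].
      rewrite exprMn mulrA normrM [`|t ^+ i|]ger0_norm ?exprn_ge0 ?(ltW t0)//.
      apply: (@le_trans _ _ (M / 2 ^+ i * t ^+ m.+1)); last by rewrite exprVn mulrAC.
      by apply: ler_pM => //; rewrite ?exprn_ge0 ?(ltW t0)// ler_wiXn2l// (ltW t0).
    rewrite -mulr_sumr mulrC -(mulrA 2) ler_wpM2r ?mulr_ge0 ?exprn_ge0 ?(ltW t0)//.
    have hs p : \sum_(0 <= i < p) (2^-1 : K) ^+ i <= 2.
      have : (1 - 2^-1) * \sum_(0 <= i < p) (2^-1 : K) ^+ i = 1 - 2^-1 ^+ p.
        by rewrite big_mkord -opprB mulNr -subrX1 opprB.
      have -> : 1 - 2^-1 = 2^-1 :> K by field.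
      move=> hh; rewrite -(@ler_pM2l _ 2^-1)// hh mulVf// gerBl exprn_ge0//.
    apply: le_trans (hs (n + m.+1)%N); rewrite [leRHS](big_cat_nat (n := m.+1)) ?leq_addl//=.
    by rewrite lerDr sumr_ge0// => i _; rewrite exprn_ge0.
  have hA : `|a m * (w0 * t) ^+ m| <= (2 * M + 1) * t ^+ m.+1.
    have -> : a m * (w0 * t) ^+ m = (a m * (w0 * t) ^+ m + T) - T by rewrite addrK.
    apply: (le_trans (ler_normB _ _)); rewrite mulrDl mul1r addrC lerD//.
    exact: ltW.
  move: hA; rewrite exprMn mulrA normrM [`|t ^+ m|]ger0_norm ?exprn_ge0 ?(ltW t0)//.
  by rewrite exprS mulrA ler_pM2r ?exprn_gt0.
set A := `|a m * w0 ^+ m| in key.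
have : A = 0.
  have A0 : 0 <= A by apply: normr_ge0.
  apply/eqP; rewrite eq_le A0 andbT.
  have B0 : 0 < 2 * M + 1 by rewrite ltr_wpDl// mulr_ge0.
  case: (eqVneq A 0) => [->//|An0].
  have Apos : 0 < A by rewrite lt0r An0.
  have S0 : 0 < 2 * M + 1 + A by rewrite addr_gt0.
  (* For A > 0 this t is at most 1 and turns the bound into A (2 M + 1 + A) <= (2 M + 1) A, which is
     false. *)
  have := key (A / (2 * M + 1 + A)); rewrite divr_gt0// ler_pdivrMr// mul1r.
  rewrite ler_wpDl ?(ltW B0)// => /(_ isT isT).
  rewrite mulrA ler_pdivlMr// mulrDr [A * (2 * _ + 1)]mulrC gerDl.
  by rewrite lt_geF// mulr_gt0.
move/eqP; rewrite /A normr_eq0 mulf_eq0 expf_eq0 (gt_eqF w00) andbF orbF.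
by move/eqP.
Qed.

Lemma series_shift (K : numFieldType) (u : nat -> K^o) (l : K^o) (s : nat) :
  series u @ \oo --> l ->
  series (fun k => if (k < s)%N then 0 else u (k - s)%N) @ \oo --> l.
Proof.
move=> h; rewrite -(cvg_shiftn s).
rewrite (_ : [sequence _]_n = series u); first exact: h.
apply/funext => n; rewrite /series /= addnC.
rewrite (big_cat_nat (n := s)) ?leq_addr//= big1_seq ?add0r; last first.
  by move=> i /andP[_]; rewrite mem_index_iota => /andP[_ ->].
rewrite -[X in index_iota X _]add0n big_addn addKn; apply: eq_bigr => i _.
by rewrite ltnNge leq_addl /= addnK.
Qed.

(** Multiplying both expansions by w^(N + N' + 2) gives two power series with the same sum; at index
    N + N' + 1 one has the coefficient [c N] and the other [c' N']. *)
Lemma laurent_unique (K : numFieldType) (g : K -> K) (N N' : nat) (c c' : nat -> K) (e : K) :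
  0 < e ->
  (forall w, w != 0 -> `|w| < e ->
    series (fun k => c k * w ^+ k / w ^+ N.+1 : K^o) @ \oo --> (g w : K^o)) ->
  (forall w, w != 0 -> `|w| < e ->
    series (fun k => c' k * w ^+ k / w ^+ N'.+1 : K^o) @ \oo --> (g w : K^o)) ->
  c N = c' N'.
Proof.
move=> e0 h h'.
have sh (d : nat -> K) (P P' : nat) (w : K) : w != 0 ->
    series (fun k => d k * w ^+ k / w ^+ P.+1 : K^o) @ \oo --> (g w : K^o) ->
    series (fun k => (if (k < P'.+1)%N then 0 else d (k - P'.+1)%N) * w ^+ k : K^o)
       @ \oo --> (w ^+ (P.+1 + P'.+1) * g w : K^o).
  move=> w0 hd.
  have alg (x : K) : w ^+ (P.+1 + P'.+1) * (x / w ^+ P.+1) = w ^+ P'.+1 * x.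
    by rewrite exprD (mulrC (w ^+ P.+1)) -mulrA [X in _ * X = _]mulrC divfK ?expf_neq0.
  have : (fun n => w ^+ (P.+1 + P'.+1) * series (fun k => d k * w ^+ k / w ^+ P.+1 : K^o) n : K^o) @ \oo --> (w ^+ (P.+1 + P'.+1) * g w : K^o).
    by apply: cvgM hd; exact: cvg_cst.
  rewrite (_ : (fun n => _) = series (fun k => w ^+ P'.+1 * (d k * w ^+ k) : K^o)); last first.
    apply/funext => n; rewrite /series /= mulr_sumr; apply: eq_bigr => k _.
    exact: alg.
  move=> hs; have {}hs := @series_shift K _ _ P'.+1 hs.
  rewrite (_ : series _ = series (fun k : nat => if (k < P'.+1)%N then 0
      else w ^+ P'.+1 * (d (k - P'.+1)%N * w ^+ (k - P'.+1)) : K^o)); first exact: hs.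
  congr series; apply/funext => k; case: ltnP => kP; first by rewrite mul0r.
  by rewrite mulrCA -exprD subnKC.
pose a k := (if (k < N'.+1)%N then 0 else c (k - N'.+1)%N) - (if (k < N.+1)%N then 0 else c' (k - N.+1)%N).
have a0 : forall k, a k = 0.
  apply: (power_series_eq0 e0) => w w0 we.
  have h1 := sh c N N' w w0 (h w w0 we).
  have h2 := sh c' N' N w w0 (h' w w0 we).
  rewrite (_ : series _ = series (fun k => (if (k < N'.+1)%N then 0 else c (k - N'.+1)%N) * w ^+ k : K^o) - series (fun k => (if (k < N.+1)%N then 0 else c' (k - N.+1)%N) * w ^+ k : K^o)); last first.
    apply/funext => n; rewrite /series /= !fctE -sumrB; apply: eq_bigr => k _.
    by rewrite /a mulrBl.
  rewrite (addnC N'.+1) in h2; have := cvgB h1 h2; rewrite subrr; exact.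
have := a0 (N + N'.+1)%N; rewrite /a !ifF; last 2 first.
- by apply/negbTE; rewrite -leqNgt addnS ltnS leq_addr.
- by apply/negbTE; rewrite -leqNgt leq_addl.
by rewrite addnK -addSnnS addKn => /eqP; rewrite subr_eq0 => /eqP.
Qed.

Lemma mulf_div_cancel (K : fieldType) (a x y t : K) : t != 0 ->
  a * x / y = t * (a / (t * y) * x).
Proof. by move=> t0; rewrite invfM; move: (y^-1) => z; field. Qed.

Lemma mulr_rotate (K : comPzRingType) (g a b d : K) : g * (a * (b * d)) = b * (g * a * d).
Proof. by ring. Qed.

Lemma twist_coef (K : fieldType) (c : nat -> K) (w l D : K) (k : nat) :
  \sum_(0 <= i < k.+1) c i * w ^+ i / D * cexp_coeff (w * l) (k - i)
  = (\sum_(0 <= i < k.+1) c i * cexp_coeff l (k - i)) * w ^+ k / D.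
Proof.
rewrite !mulr_suml; apply: eq_big_nat => i /andP[_ hi].
have -> : w ^+ k = w ^+ i * w ^+ (k - i) by rewrite -exprD subnKC.
rewrite /cexp_coeff exprMn; move: (_%:R^-1) (D^-1) (w ^+ i) => f d u; ring.
Qed.

Section Residue.
Variable R : realType.
Local Open Scope complex_scope.
Local Notation C := ((R[i])^o).

Lemma cexp_cvg (z : C) : series (cexp_coeff (z : R[i]) : C ^nat) @ \oo --> (cexp z : C).
Proof.
case: z => a b; rewrite /cexp /=.
have dbl (f : R[i] -> C) (w : R[i]) :
    series (cexp_coeff (2 * w) : C ^nat) @ \oo --> f w ->
    exists M : C, forall k, `|cexp_coeff w k| <= M / 2 ^+ k.
  move=> h; have [|M _ hM] := @series_coef_bound R[i] (fun k => (k`!%:R)^-1) w.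
    apply/cvgP; rewrite (_ : (fun k => _) = cexp_coeff (2 * w)); first exact: h.
    by apply/funext => k; rewrite /cexp_coeff mulrC.
  by exists M => k; rewrite /cexp_coeff mulrC.
have [M hM] : exists M : C, forall k, `|cexp_coeff (a%:C : R[i]) k| <= M / 2 ^+ k.
  apply: (dbl (fun=> (expR (2 * a))%:C)).
  by have := @cexp_series_real R (2 * a); rewrite rmorphM rmorph_nat.
have [N hN] : exists N : C, forall k, `|cexp_coeff (0 +i* b : R[i]) k| <= N / 2 ^+ k.
  apply: (dbl (fun=> (cos (2 * b) +i* sin (2 * b)))).
  have := @cexp_series_imag R (2 * b).
  rewrite (_ : 0 +i* (2 * b) = 2 * (0 +i* b))//.
  by apply/eqP; rewrite eq_complex /=; apply/andP; split; apply/eqP; ring.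
have := @cauchy_product R[i] _ _ _ _ M N (@cvg_sqr_geom R) hM hN (@cexp_series_real R a) (@cexp_series_imag R b).
rewrite (_ : (fun k => _) = cexp_coeff (a +i* b : R[i])); first by [].
apply/funext => k; rewrite cexp_coeffD; congr cexp_coeff.
by apply/eqP; rewrite eq_complex /= add0r addr0 !eqxx.
Qed.

Lemma cexpD (z w : C) : cexp (z + w) = cexp z * cexp w.
Proof.
case: z w => a b [c d]; rewrite /cexp /= expRD cosD sinD.
by apply/eqP; rewrite eq_complex /=; apply/andP; split; apply/eqP; ring.
Qed.

Lemma cpow_cexp (x : R) (s : C) : cpow x s = cexp (s * (ln x)%:C).
Proof.
by case: s => a b; rewrite /cpow /cexp /= !mulr0 subr0 add0r.
Qed.

Lemma punctured_nearP (z0 : C) (P : C -> Prop) :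
  (\forall z \near z0^', P z) <->
  exists2 e : C, 0 < e & forall w : C, w != 0 -> `|w| < e -> P (z0 + w).
Proof.
split=> [|[e e0 h]].
  rewrite /dnbhs /within/= => /nbhs_ballP [e e0 h]; exists e => // w w0 we.
  apply: (h (z0 + w)); last by rewrite -subr_eq0 addrAC subrr add0r.
  by rewrite -ball_normE /ball_ /= opprD addrA subrr add0r normrN.
rewrite /dnbhs /within/=; apply/nbhs_ballP; exists e => //= z.
rewrite -ball_normE /ball_ /= => hz zn.
rewrite (_ : z = z0 + (z - z0)); last by rewrite addrC subrK.
by apply: h; [rewrite subr_eq0|rewrite distrC].
Qed.

(* One Laurent expansion, for x0, yields the expansion for every x: multiply it by
   the power series of exp (s (ln x - ln x0)). *)
Lemma is_residue_twist (g : C -> C) (z0 : C) (x0 x : R) (N : nat) (c : nat -> C) :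
  (\forall z \near z0^', series (fun k => c k * (z - z0) ^+ k / (z - z0) ^+ N.+1) @ \oo
     --> g z * cpow x0 z) ->
  is_residue (fun z => g z * cpow x z) z0
    (cexp (z0 * (ln x - ln x0)%:C) *
     \sum_(0 <= i < N.+1) c i * cexp_coeff ((ln x - ln x0)%:C : R[i]) (N - i)).
Proof.
move=> /punctured_nearP [e e0 h]; set L := (ln x - ln x0)%:C.
exists N, (fun k => cexp (z0 * L) * \sum_(0 <= i < k.+1) c i * cexp_coeff (L : R[i]) (k - i)).
(* Half the radius, so that 2 w stays inside and the terms at w get a geometric bound. *)
split=> //; apply/punctured_nearP; exists (e / 2) => [|w w0 we]; first by rewrite divr_gt0.
rewrite [z0 + w - z0](_ : _ = w); last by rewrite addrAC subrr add0r.
have two0 : (2 : R[i]) != 0 by rewrite pnatr_eq0.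
have hu : series (fun k => c k * w ^+ k / w ^+ N.+1 : C) @ \oo --> (g (z0 + w) * cpow x0 (z0 + w) : C).
  have := h w w0; rewrite [z0 + w - z0](_ : _ = w); last by rewrite addrAC subrr add0r.
  apply; apply: (lt_trans we); rewrite ltr_pdivrMr// ltr_pMr// ltr1n//.
have [M hM] : exists M : C, forall k, `|c k * w ^+ k / w ^+ N.+1| <= M / 2 ^+ k.
  have [|M M0 hM] := @series_coef_bound R[i] (fun k => c k / (2 * w) ^+ N.+1) w.
    have := h (2 * w); rewrite [z0 + _ - z0](_ : _ = 2 * w); last by rewrite addrAC subrr add0r.
    move=> /(_ (mulf_neq0 two0 w0)).
    have -> : `|2 * w| < e by rewrite normrM ger0_norm// mulrC -ltr_pdivlMr.
    move=> /(_ isT) h2; apply/cvgP.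
    rewrite (_ : (fun k => _) = (fun k => c k * (2 * w) ^+ k / (2 * w) ^+ N.+1)); first exact: h2.
    by apply/funext => k; rewrite mulrAC.
  exists (2 ^+ N.+1 * M) => k.
  have -> : c k * w ^+ k / w ^+ N.+1 = 2 ^+ N.+1 * (c k / (2 * w) ^+ N.+1 * w ^+ k).
    by rewrite exprMn; apply: mulf_div_cancel; rewrite ?expf_neq0.
  by rewrite normrM [X in X * _]ger0_norm ?exprn_ge0// -[leRHS]mulrA ler_wpM2l ?exprn_ge0.
have [N' hN] : exists N' : C, forall k, `|cexp_coeff (w * L : R[i]) k| <= N' / 2 ^+ k.
  have [|N' _ hN] := @series_coef_bound R[i] (fun k => (k`!%:R)^-1) (w * L).
    apply/cvgP; rewrite (_ : (fun k => _) = cexp_coeff (2 * (w * L))); first exact: cexp_cvg.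
    by apply/funext => k; rewrite /cexp_coeff mulrC.
  by exists N' => k; rewrite /cexp_coeff mulrC.
have hc := @cauchy_product R[i] _ _ _ _ _ _ (@cvg_sqr_geom R) hM hN hu (@cexp_cvg (w * L)).
have E : g (z0 + w) * cpow x (z0 + w) = cexp (z0 * L) * (g (z0 + w) * cpow x0 (z0 + w) * cexp (w * L)).
  rewrite !cpow_cexp.
  have -> : (z0 + w) * (ln x)%:C = (z0 + w) * (ln x0)%:C + (z0 * L + w * L).
    by rewrite -mulrDl -mulrDr /L rmorphB /= addrCA subrr addr0.
  by rewrite !cexpD; apply: mulr_rotate.
rewrite E.
have hf := cvgM (@cvg_cst C (cexp (z0 * L)) _ \oo _) hc.
rewrite (_ : series _ = (fun n => cexp (z0 * L) * series (fun k => \sum_(0 <= i < k.+1) c i * w ^+ i / w ^+ N.+1 * cexp_coeff (w * L : R[i]) (k - i)) n)); first exact: hf.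
apply/funext => n; rewrite /series /= mulr_sumr; apply: eq_bigr => k _.
by rewrite twist_coef -!mulrA.
Qed.

Lemma is_residue_unique (f : C -> C) (z0 r1 r2 : C) :
  is_residue f z0 r1 -> is_residue f z0 r2 -> r1 = r2.
Proof.
move=> [N [c [/punctured_nearP [e e0 h] ->]]] [N' [c' [/punctured_nearP [e' e0' h'] ->]]].
have sh (w : C) : z0 + w - z0 = w by rewrite addrAC subrr add0r.
have re : (e : R[i]) \is Num.real by apply: gtr0_real.
have re' : (e' : R[i]) \is Num.real by apply: gtr0_real.
(* The radii are complex numbers; their minimum makes sense because positivity forces them to be
   real. *)
have [m m0 [hm hm']] : exists2 m : R[i], 0 < m & m <= e /\ m <= e'.
  have [ee|ee] := real_leP re re'; [exists e|exists e'] => //; split => //; exact: ltW.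
apply: (@laurent_unique R[i] (fun w => f (z0 + w)) N N' c c' m m0) => w w0 wm.
  by have := h w w0 (lt_le_trans wm hm); rewrite sh.
by have := h' w w0 (lt_le_trans wm hm'); rewrite sh.
Qed.

Lemma residueE (f : C -> C) (z0 r : C) : is_residue f z0 r -> residue f z0 = r.
Proof.
by move=> h; rewrite /residue; case: xgetP => [y _ hy|/(_ r)//]; apply: is_residue_unique hy h.
Qed.

(** One polynomial serves all x. Either an expansion exists for some x0 > 0 and [is_residue_twist]
    carries it to every x, or none exists for any x > 0 and [residue] returns its default 0. *)
Lemma residue_form (g : C -> C) (q : R) : exists P : {poly R}, forall x : R, 0 < x ->
  complex.Re (residue (fun s => g s * cpow x s) q%:C) = expR (q * ln x) * P.[ln x].
Proof.
have [[x0 [_ [r [N [c [h _]]]]]]|none] :=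
  pselect (exists x0 : R, 0 < x0 /\ exists r, is_residue (fun s => g s * cpow x0 s) q%:C r); last first.
  exists 0 => x x0; rewrite horner0 mulr0 /residue; case: xgetP => // y _ hy.
  by case: none; exists x; split => //; exists y.
(* The twisted coefficient as a function of ln x. The constant factor undoes the x0^q in exp (q (ln
   x - ln x0)); taking real parts of the [c i] is enough because all other factors are real. *)
exists ((expR (- (q * ln x0)))%:P * \sum_(0 <= i < N.+1)
   (complex.Re (c i) / (N - i)`!%:R)%:P * ('X - (ln x0)%:P) ^+ (N - i)) => x xpos.
rewrite (residueE (is_residue_twist _ h)).
have -> : q%:C * (ln x - ln x0)%:C = (q * (ln x - ln x0))%:C by rewrite rmorphM.
rewrite /cexp /= cos0 sin0 complexr0 mulr1.
have ReM (a : R) (z : R[i]) : complex.Re (a%:C * z) = a * complex.Re z.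
  by case: z => u v /=; rewrite mul0r subr0.
rewrite ReM mulrBr expRD hornerM hornerC -mulrA; congr (_ * (_ * _)).
rewrite horner_sum raddf_sum; apply: eq_bigr => i _.
rewrite mulrC /cexp_coeff.
have -> : (ln x - ln x0)%:C ^+ (N - i) / (N - i)`!%:R = ((ln x - ln x0) ^+ (N - i) / (N - i)`!%:R)%:C :> R[i].
  by rewrite rmorphM fmorphV rmorphXn rmorph_nat.
rewrite [LHS]ReM hornerM hornerC horner_exp hornerXsubC; ring.
Qed.

End Residue.

Lemma undup_nseq_cons (k : nat) : (0 < k)%N -> undup (1%N :: nseq k 2%N) = [:: 1%N; 2%N].
Proof.
case: k => // k _.
have undup_consE (x : nat) s : undup (x :: s) = if x \in s then undup s else x :: undup s by [].
by rewrite undup_consE mem_nseq /=; elim: k.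
Qed.

Lemma main_term_form (R : realType) (k : nat) : (0 < k)%N ->
  exists P1 P2 : {poly R}, forall x : R, 0 < x ->
    complex.Re (main_term (1%N :: nseq k 2%N) x) = x * P1.[ln x] + x `^ 2^-1 * P2.[ln x].
Proof.
move=> k0; pose g (s : (R[i])^o) : (R[i])^o := (\prod_(i <- 1%N :: nseq k 2%N) zeta (i%:R * s)) / s.
have [P1 h1] := residue_form g 1.
have [P2 h2] := residue_form g 2^-1.
exists P1, P2 => x x0.
have e1 : (1%:R^-1 : (R[i])^o) = (1 : R)%:C%C by rewrite invr1.
have e2 : (2%:R^-1 : (R[i])^o) = (2^-1 : R)%:C%C by rewrite fmorphV rmorph_nat.
rewrite /main_term undup_nseq_cons// big_cons big_seq1 e1 e2 raddfD /=.
rewrite (_ : (fun s => _ * cpow x s / s) = (fun s => g s * cpow x s)); last first.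
  by apply/funext => s; rewrite /g mulrAC.
have {}h1 := h1 _ x0; have {}h2 := h2 _ x0.
rewrite mul1r (lnK x0) in h1.
apply: (etrans (congr2 +%R h1 h2)).
by rewrite /powR (gt_eqF x0).
Qed.

(** The modulus dominates the real part, so a bound on the complex remainder becomes one between
    real functions. *)
Lemma remainder_form (R : realType) (k : nat) : (0 < k)%N ->
  exists P1 P2 : {poly R}, forall x : R, 0 < x ->
    `| (\sum_(1 <= n < (Num.truncn x).+1) gen_divisor (1%N :: nseq k 2%N) n)%N%:R
      - (x * P1.[ln x] + x `^ 2^-1 * P2.[ln x]) |
    <= Normc.normc (remainder (1%N :: nseq k 2%N) x).
Proof.
move=> /main_term_form - /(_ R) [P1 [P2 h]]; exists P1, P2 => x x0.
rewrite -(h _ x0) /remainder; set S := (\sum_(_ <= n < _) _)%N; set m := main_term _ _.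
have -> : S%:R - complex.Re m = complex.Re (S%:R - m).
  by rewrite raddfB -(rmorph_nat (real_complex R)).
set z := (_ - m); case: z => a b /=.
by rewrite -[leLHS]sqrtr_sqr ler_wsqrtr// lerDl sqr_ge0.
Qed.

(** * Counting Abelian groups *)

Section DivisibilityChains.
Implicit Types s t : seq nat.

(** The shape of the list of invariant factors of a finite Abelian group. *)
Definition chain s := sorted [rel m n | (n %| m)%N] s && all [pred m | (1 < m)%N] s.

(** Along a chain the exponent of p decreases weakly, so some entry has exponent above i exactly
    when the head does. The counts therefore determine the head, and then the rest. *)
Lemma chain_eq s t : chain s -> chain t ->
  (forall p i, prime p -> count [pred m | (i < logn p m)%N] s = count [pred m | (i < logn p m)%N] t) ->
  s = t.
Proof.
have tr : transitive [rel m n | (n %| m)%N] by move=> a b c /= ab bc; apply: dvdn_trans bc ab.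
have nil_chain u : chain u ->
    (forall p i, prime p -> count [pred m | (i < logn p m)%N] u = 0%N) -> u = [::].
  case: u => // m u /andP[_ /andP[m1 _]] h.
  have := h (pdiv m) 0%N (pdiv_prime m1); rewrite /= logn_gt0 mem_primes pdiv_prime//.
  by rewrite (ltnW m1) pdiv_dvd.
elim: s t => [|m s IH] t cs ct h; first by symmetry; apply: nil_chain => // p i pp; rewrite -h.
case: t ct h => [|m' t] ct h; first by apply: nil_chain => // p i pp; rewrite h.
have head_gt a u p i : chain (a :: u) -> prime p ->
    (0 < count [pred m | (i < logn p m)%N] (a :: u))%N = (i < logn p a)%N.
  move=> /andP[pu /andP[a1 _]] pp; rewrite -has_count /=.
  case: ltnP => //= hia; apply/negbTE/hasPn => x xu; rewrite /= -leqNgt.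
  apply: leq_trans hia; apply: dvdn_leq_log; first exact: ltnW.
  by have /allP := order_path_min tr pu; apply.
have em : m = m'.
  have m0 : (0 < m)%N by case/andP: cs => _ /andP[/ltnW].
  have m0' : (0 < m')%N by case/andP: ct => _ /andP[/ltnW].
  apply: (eqn_from_log m0 m0') => p; case: (boolP (prime p)) => [pp|/negbTE np]; last by rewrite lognE np [RHS]lognE np.
  have e i : (i < logn p m)%N = (i < logn p m')%N.
    by rewrite -(head_gt _ _ _ _ cs pp) -(head_gt _ _ _ _ ct pp) h.
  by apply/eqP; rewrite eqn_leq; apply/andP; split; rewrite leqNgt; [rewrite e|rewrite -e]; rewrite ltnn.
rewrite em; congr (_ :: _); apply: IH.
- by case/andP: cs => /path_sorted h1 /andP[_ h2]; rewrite /chain h1.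
- by case/andP: ct => /path_sorted h1 /andP[_ h2]; rewrite /chain h1.
by move=> p i pp; have := h p i pp; rewrite /= em => /addnI.
Qed.

End DivisibilityChains.

Section AbelianInvariant.
Local Open Scope nat_scope.

(* Indexed like num_partitions: position i counts the parts equal to i.+1 of the
   partition of logn p #|G| attached to G. *)
Definition type_mult (gT : finGroupType) (G : {set gT}) (p i : nat) : nat :=
  count [pred m | logn p m == i.+1] (abelian_type G).

Lemma count_gt_eq (p i : nat) (s : seq nat) :
  count [pred m | (i < logn p m)%N] s =
  (count [pred m | logn p m == i.+1] s + count [pred m | (i.+1 < logn p m)%N] s)%N.
Proof. by elim: s => //= m s ->; case: (ltngtP i.+1 (logn p m)) => h; rewrite ?addnA //=; lia. Qed.

Lemma abelian_type_dvd_card (gT : finGroupType) (G : {group gT}) (m : nat) :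
  abelian G -> m \in abelian_type G -> (m %| #|G|)%N.
Proof.
case/abelian_structure => b defG <- /mapP[x xb ->].
by rewrite -(bigdprod_card defG) (big_rem x xb) /= dvdn_mulr.
Qed.

Lemma count_gt_type_mult (gT : finGroupType) (G : {group gT}) (p i N : nat) :
  abelian G -> (logn p #|G| <= i + N)%N ->
  count [pred m | (i < logn p m)%N] (abelian_type G) = \sum_(i <= j < i + N) type_mult G p j.
Proof.
move=> cG; elim: N i => [|N IH] i hN.
  rewrite addn0 big_geq//; apply/eqP; rewrite -leqn0 leqNgt -has_count; apply/hasPn => m hm /=.
  rewrite -leqNgt; rewrite addn0 in hN; apply: leq_trans hN.
  by apply: dvdn_leq_log; [exact: cardG_gt0|exact: abelian_type_dvd_card].
rewrite count_gt_eq big_ltn ?addnS ?ltnS ?leq_addr// IH; first by rewrite addSn.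
by rewrite addSn -addnS.
Qed.

Lemma abelian_type_chain (gT : finGroupType) (G : {set gT}) : chain (abelian_type G).
Proof. by rewrite /chain abelian_type_dvdn_sorted abelian_type_gt1. Qed.

(** No exponent exceeds [logn p #|G|], so the multiplicities below that index already determine the
    invariant factors. *)
Lemma type_mult_isog (gT hT : finGroupType) (G : {group gT}) (H : {group hT}) :
  abelian G -> abelian H -> #|G| = #|H| ->
  (forall p i, prime p -> (i < logn p #|G|)%N -> type_mult G p i = type_mult H p i) -> G \isog H.
Proof.
move=> cG cH oGH e; rewrite eq_abelian_type_isog//; apply/eqP.
apply: chain_eq; [exact: abelian_type_chain|exact: abelian_type_chain|] => p i pp.
have [hi|hi] := ltnP i (logn p #|G|).
  have hn := subnKC (ltnW hi).
  rewrite (@count_gt_type_mult _ G p i (logn p #|G| - i)) ?hn//.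
  rewrite (@count_gt_type_mult _ H p i (logn p #|G| - i)) -?oGH ?hn//.
  by apply: eq_big_nat => j /andP[_ hj]; apply: e.
rewrite !(@count_gt_type_mult _ _ p i 0) ?addn0 -?oGH//.
by rewrite !big_geq.
Qed.

(** The order is the product of the invariant factors, and the left side groups their exponents of p
    by size. *)
Lemma type_mult_sum (gT : finGroupType) (G : {group gT}) (p N : nat) :
  abelian G -> prime p -> (logn p #|G| <= N)%N ->
  \sum_(i < N) i.+1 * type_mult G p i = logn p #|G|.
Proof.
move=> cG pp hN; have [b defG defb] := abelian_structure cG.
have -> : #|G| = \prod_(m <- abelian_type G) m.
  by rewrite -defb big_map -(bigdprod_card defG).
have hall : all (fun m => logn p m <= N)%N (abelian_type G).
  apply/allP => m hm; apply: leq_trans hN; apply: dvdn_leq_log; first exact: cardG_gt0.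
  exact: abelian_type_dvd_card.
rewrite /type_mult; have := abelian_type_gt1 G.
elim: (abelian_type G) hall => [|m s IH] /= hall.
  by move=> _; rewrite big_nil logn1 big1// => i _; rewrite muln0.
case/andP: hall => hm hs /andP[m1 hs1]; rewrite big_cons lognM; last first.
- by rewrite big_seq_cond prodn_cond_gt0// => i /andP[/(allP hs1)/= /ltnW].
- exact: ltnW.
rewrite -IH//; under eq_bigr do rewrite mulnDr.
rewrite big_split /=; congr (_ + _)%N.
case E : (logn p m) hm => [|l] hl; first by rewrite big1// => i _; rewrite muln0.
rewrite (bigD1 (Ordinal hl)) //= eqxx muln1 big1 ?addn0// => i hi.
by rewrite eqSS; move: hi; rewrite -val_eqE /= eq_sym => /negbTE ->; rewrite muln0.
Qed.

(** Any decomposition into cyclic groups has the same number of factors whose p-exponent exceeds j;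
    differencing in j gives the multiplicities. This lets a group be built from prime-power factors
    instead of invariant factors. *)
Lemma type_mult_basis (gT : finGroupType) (G : {group gT}) (b : seq gT) (p i : nat) :
  abelian G -> \big[dprod/1%g]_(x <- b) <[x]>%g = G ->
  type_mult G p i = count [pred m | logn p m == i.+1] (map order b).
Proof.
move=> cG defG.
have [b' defG' defb'] := abelian_structure cG.
have e j : count [pred m | (j < logn p m)%N] (abelian_type G) = count [pred m | (j < logn p m)%N] (map order b).
  rewrite -defb' !count_map.
  have := count_logn_dprod_cycle p j defG; have := count_logn_dprod_cycle p j defG'.
  by rewrite /preim /= => -> ->.
by apply: (@addIn (count [pred m | (i.+1 < logn p m)%N] (abelian_type G))); rewrite /type_mult -count_gt_eq e e -count_gt_eq.
Qed.
End AbelianInvariant.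

Section AbelianLaws.
Local Open Scope group_scope.

Lemma abelian_group_of_orders (s : seq nat) : all (fun m => 0 < m)%N s ->
  exists (gT : finGroupType) (b : seq gT),
    [/\ abelian [set: gT]%SET, \big[dprod/1]_(x <- b) <[x]> = [set: gT]%SET & map order b = s].
Proof.
elim: s => [_|m s IH /= /andP[m0 /IH [gT [b [cG defG ob]]]]].
  exists ('I_1 : finGroupType), [::]; split => //; first by rewrite Zp_cycle cycle_abelian.
  by rewrite big_nil; apply/setP => x; rewrite !inE [x]ord1 [1]ord1 eqxx.
case: m m0 => // m _; pose zT : finGroupType := 'I_m.+1.
have cZ : abelian [set: zT]%SET by rewrite (Zp_cycle m) cycle_abelian.
exists (zT * gT)%type, (pairg1 gT (Zp1 : zT) :: map (@pair1g zT gT) b); split.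
- apply/centsP => -[x1 x2] _ [y1 y2] _; rewrite /commute.
  have /centsP/(_ x1 (finset.in_setT _) y1 (finset.in_setT _)) e1 := cZ.
  have /centsP/(_ x2 (finset.in_setT _) y2 (finset.in_setT _)) e2 := cG.
  by congr (_, _).
- rewrite big_cons big_map.
  have -> : \big[dprod/1]_(x <- b) <[pair1g zT x]> = finset.setX (1 : {set zT}) [set: gT]%SET.
    rewrite -(morphim_pair1g zT) -(injm_bigdprod (G := [set: gT]%G) (H := fun x => <[x]>%G) _ (injm_pair1g zT gT) defG) ?finset.subsetT//.
    by apply: eq_bigr => x _ /=; rewrite morphim_cycle ?finset.in_setT.
  have -> : <[pairg1 gT (Zp1 : zT)]> = finset.setX [set: zT]%SET (1 : {set gT}).
    rewrite -(morphim_pairg1 gT) -[RHS](congr1 (fun A => pairg1 gT @* A) (esym (Zp_cycle m))).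
    by rewrite morphim_cycle ?finset.in_setT.
  have := setX_dprod [set: zT]%G [set: gT]%G => /= ->.
  by apply/setP => -[x y]; rewrite !inE.
- have o1 : #[pairg1 gT (Zp1 : zT)] = m.+1.
    by rewrite (order_injm (injm_pairg1 zT gT)) ?finset.in_setT// order_Zp1.
  rewrite /= o1 -map_comp -ob; congr (_ :: _); apply: eq_map => x /=.
  by rewrite (order_injm (injm_pair1g zT gT)) ?finset.in_setT.
Qed.

Section Law.
Variables (n : nat) (m : {ffun 'I_n -> {ffun 'I_n -> 'I_n}}).

Lemma abelian_lawP : reflect
  [/\ forall x y z, m x (m y z) = m (m x y) z, forall x y, m x y = m y x
    & exists e, forall x, m e x = x /\ exists y, m x y = e] (abelian_law m).
Proof.
apply: (iffP and3P) => [[/'forall_forallP h1 /'forall_forallP h2 /existsP [e /forallP h3]]|[h1 h2 [e h3]]].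
  split=> [x y z|x y|]; first by have /forallP/(_ z)/eqP := h1 x y.
    exact/eqP/h2.
  exists e => x; have /andP[/eqP h4 /existsP [y /eqP h5]] := h3 x; split => //; by exists y.
split; first by apply/'forall_'forall_'forall_eqP.
  by apply/'forall_'forall_eqP.
apply/existsP; exists e; apply/forallP => x; have [-> [y hy]] := h3 x.
by rewrite eqxx; apply/existsP; exists y; apply/eqP.
Qed.

End Law.

(* 'I_n carrying the group structure given by m; hm is a phantom argument that
   lets the group instance be inferred. *)
Definition law_type n (m : {ffun 'I_n -> {ffun 'I_n -> 'I_n}}) (hm : abelian_law m) : Type := 'I_n.

Section LawGroup.
Variables (n : nat) (m : {ffun 'I_n -> {ffun 'I_n -> 'I_n}}) (hm : abelian_law m).
Local Notation T := (law_type hm).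

HB.instance Definition _ := Finite.on T.

Definition law_mul (x y : T) : T := m x y.

Lemma law_unit_ex : exists e : T, [forall x : T, law_mul e x == x].
Proof.
have /abelian_lawP [_ _ [e he]] := hm.
by exists e; apply/forallP => x; apply/eqP; case: (he x).
Qed.

Definition law_unit : T := xchoose law_unit_ex.

Lemma law_mulA : associative law_mul.
Proof. by have /abelian_lawP [h _ _] := hm; move=> x y z; apply: h. Qed.

Lemma law_mulC : commutative law_mul.
Proof. by have /abelian_lawP [_ h _] := hm; move=> x y; apply: h. Qed.

Lemma law_mul1 : left_id law_unit law_mul.
Proof. by move=> x; apply/eqP; apply: (forallP (xchooseP law_unit_ex)). Qed.

Lemma law_inv_ex (x : T) : exists y : T, law_mul y x == law_unit.
Proof.
have /abelian_lawP [_ _ [e he]] := hm; have [_ [y hy]] := he x.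
exists y; apply/eqP; rewrite law_mulC; apply: etrans hy _.
by rewrite -[LHS]law_mul1 law_mulC; case: (he law_unit).
Qed.

Definition law_inv (x : T) : T := xchoose (law_inv_ex x).

Lemma law_mulV : left_inverse law_unit law_inv law_mul.
Proof. by move=> x; apply/eqP/(xchooseP (law_inv_ex x)). Qed.

HB.instance Definition _ := Finite_isGroup.Build T law_mulA law_mul1 law_mulV.

Lemma law_abelian : abelian [set: T]%SET.
Proof. by apply/centsP => x _ y _; apply: law_mulC. Qed.

Lemma card_law_type : #|[set: T]%SET| = n.
Proof. by rewrite cardsT card_ord. Qed.

End LawGroup.

Lemma isog_lawP n (m1 m2 : {ffun 'I_n -> {ffun 'I_n -> 'I_n}}) (h1 : abelian_law m1) (h2 : abelian_law m2) :
  isog_law m1 m2 = ([set: law_type h1]%SET \isog [set: law_type h2]%SET).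
Proof.
apply/idP/idP => [/existsP [s /'forall_forallP hs]|/isogP [f injf fT]].
  pose f (x : law_type h1) : law_type h2 := s x.
  have fM : {in [set: law_type h1]%SET &, {morph f : x y / x * y}}.
    by move=> x y _ _; apply/eqP; have := hs x y.
  apply/isogP; exists (Morphism fM); first by apply/injmP => x y _ _; apply: perm_inj.
  apply/eqP; rewrite eqEcard finset.subsetT /= card_injm ?card_law_type//.
  by apply/injmP => x y _ _; apply: perm_inj.
have finj : injective (f : 'I_n -> 'I_n) by move=> x y e; apply: (injmP injf) => //; apply: finset.in_setT.
apply/existsP; exists (perm finj); apply/'forall_'forall_eqP => x y; rewrite !permE.
exact: (morphM f (finset.in_setT (x : law_type h1)) (finset.in_setT (y : law_type h1))).
Qed.

Lemma law_of_group (gT : finGroupType) n : abelian [set: gT]%SET -> #|gT| = n ->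
  exists (m : {ffun 'I_n -> {ffun 'I_n -> 'I_n}}) (hm : abelian_law m),
    [set: gT]%SET \isog [set: law_type hm]%SET.
Proof.
move=> cG oG; subst n.
pose m := [ffun i : 'I_#|gT| => [ffun j : 'I_#|gT| => enum_rank (enum_val i * enum_val j : gT)]].
have mE i j : m i j = enum_rank (enum_val i * enum_val j : gT) by rewrite !ffunE.
have hm : abelian_law m.
  apply/abelian_lawP; split=> [x y z|x y|].
  - by rewrite !mE !enum_rankK mulgA.
  - by rewrite !mE; congr enum_rank; apply: (centsP cG); apply: finset.in_setT.
  exists (enum_rank (1 : gT)) => x; rewrite !mE !enum_rankK mul1g enum_valK; split=> //.
  by exists (enum_rank (enum_val x)^-1); rewrite mE enum_rankK mulgV.
exists m, hm.
pose f (x : gT) : law_type hm := enum_rank x.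
have fM : {in [set: gT]%SET &, {morph f : x y / x * y}}.
  by move=> x y _ _; have := mE (enum_rank x) (enum_rank y); rewrite !enum_rankK => /esym.
have fi : 'injm (Morphism fM) by apply/injmP => x y _ _; apply: enum_rank_inj.
apply/isogP; exists (Morphism fM) => //.
by apply/eqP; rewrite eqEcard finset.subsetT /= card_injm// card_law_type cardsT.
Qed.

End AbelianLaws.

Section PartitionBoxes.
Local Open Scope nat_scope.

(** [num_partitions v] is the case N = M = v. The invariants of groups of order n live in the fixed
    box N = M = n, for all primes at once. *)
Definition box_partitions (N M v : nat) : {set {ffun 'I_N -> 'I_M.+1}} :=
  [set mu : {ffun 'I_N -> 'I_M.+1} | \sum_(i < N) i.+1 * mu i == v]%SET.

Definition box_ext N M (mu : {ffun 'I_N -> 'I_M.+1}) (j : nat) : nat :=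
  if insub j is Some i then mu i else 0.

Lemma box_extE N M (mu : {ffun 'I_N -> 'I_M.+1}) (i : 'I_N) : box_ext mu i = mu i.
Proof. by rewrite /box_ext valK. Qed.

Lemma box_ext_bounds N M v (mu : {ffun 'I_N -> 'I_M.+1}) (j : nat) :
  mu \in box_partitions N M v -> j.+1 * box_ext mu j <= v.
Proof.
rewrite inE => /eqP <-; rewrite /box_ext; case: insubP => [i _ <-|_]; last by rewrite muln0.
by rewrite (bigD1 i) //= leq_addr.
Qed.

Lemma box_ext_sum N M v K (mu : {ffun 'I_N -> 'I_M.+1}) :
  mu \in box_partitions N M v -> v <= K -> \sum_(i < K) i.+1 * box_ext mu i = v.
Proof.
move=> hmu vK; have hb j := box_ext_bounds j hmu.
have cut L : v <= L -> \sum_(i < L) i.+1 * box_ext mu i = \sum_(0 <= i < v) i.+1 * box_ext mu i.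
  move=> vL; rewrite -(big_mkord xpredT (fun i => i.+1 * box_ext mu i)) (big_cat_nat (n := v))//=.
  rewrite [X in _ + X]big1_seq ?addn0// => i /andP[_]; rewrite mem_index_iota => /andP[vi _].
  have := hb i; case: (box_ext mu i) => [|e]; rewrite ?muln0//; nia.
rewrite (cut K vK) -(cut (maxn v N)) ?leq_maxl//.
move: (hmu); rewrite inE => /eqP hs; rewrite -[RHS]hs.
under [RHS]eq_bigr => i _ do rewrite -box_extE.
rewrite -(big_mkord xpredT (fun i => i.+1 * box_ext mu i)) (big_cat_nat (n := N)) ?leq_maxr//= big_mkord.
rewrite [X in _ + X]big1_seq ?addn0// => i /andP[_]; rewrite mem_index_iota => /andP[Ni _].
by rewrite /box_ext insubF ?muln0// ltnNge Ni.
Qed.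

(** A partition of v has parts and multiplicities at most v, so cutting its extension by zero down
    to a box of that size loses nothing. Used in both directions, this gives equality of
    cardinals. *)
Lemma leq_card_box N M N' M' v : v <= N' -> v <= M' ->
  #|box_partitions N M v| <= #|box_partitions N' M' v|.
Proof.
move=> vN vM; pose f (mu : {ffun 'I_N -> 'I_M.+1}) : {ffun 'I_N' -> 'I_M'.+1} := [ffun i : 'I_N' => inord (box_ext mu i)].
have fE mu i : mu \in box_partitions N M v -> f mu i = box_ext mu i :> nat.
  move=> hmu; rewrite ffunE inordK// ltnS; apply: leq_trans vM.
  by apply: leq_trans (box_ext_bounds i hmu); rewrite leq_pmull.
have finj : {in box_partitions N M v &, injective f}.
  move=> mu nu hmu hnu e; apply/ffunP => i; apply/val_inj => /=.
  rewrite -(box_extE mu) -(box_extE nu).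
  have [iN|iN] := ltnP i N'.
    by have := fE mu (Ordinal iN) hmu; rewrite e fE//= => ->.
  have := box_ext_bounds i hmu; have := box_ext_bounds i hnu.
  by case: (box_ext mu i) => [|a]; case: (box_ext nu i) => [|b]//; nia.
rewrite -(card_in_imset finj); apply/subset_leq_card/fintype.subsetP => _ /finset.imsetP [mu hmu ->].
rewrite inE; apply/eqP; rewrite -[RHS](box_ext_sum hmu vN).
by apply: eq_bigr => i _; rewrite fE.
Qed.

Lemma card_box_partitions N M v : v <= N -> v <= M -> #|box_partitions N M v| = num_partitions v.
Proof.
by move=> vN vM; apply/eqP; rewrite eqn_leq; apply/andP; split; exact: leq_card_box.
Qed.

Lemma num_partitions0 : num_partitions 0 = 1.
Proof.
apply/eqP/cards1P; exists ([ffun=> ord0] : {ffun 'I_0 -> 'I_1}); apply/setP => mu; rewrite !inE big_ord0 eqxx; symmetry; apply/eqP/ffunP => -[].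
by [].
Qed.

Lemma num_partitions1 : num_partitions 1 = 1.
Proof.
apply/eqP/cards1P; exists ([ffun=> ord_max] : {ffun 'I_1 -> 'I_2}); apply/setP => mu; rewrite !inE big_ord1 mul1n; apply/eqP/eqP => [h|->]; last by rewrite ffunE.
by apply/ffunP => i; rewrite (ord1 i) ffunE; apply/val_inj.
Qed.

Lemma num_partitions2 : num_partitions 2 = 2.
Proof.
pose f1 : {ffun 'I_2 -> 'I_3} := [ffun i => if i == ord0 then inord 2 else inord 0].
pose f2 : {ffun 'I_2 -> 'I_3} := [ffun i => if i == ord0 then inord 0 else inord 1].
apply/eqP/cards2P; exists f1, f2; split.
  by apply/eqP => /ffunP/(_ ord0); rewrite !ffunE /= => /(congr1 val); rewrite /= !inordK.
apply/setP => mu; rewrite !inE !big_ord_recl big_ord0 addn0 /bump /= mul1n.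
apply/eqP/orP => [h|[]/eqP->]; last 2 first.
- by rewrite !ffunE /= !inordK.
- by rewrite !ffunE /= !inordK.
have aux (a b : nat) : b + 2 * a = 2 -> a = 0 /\ b = 2 \/ a = 1 /\ b = 0 by lia.
case: (aux _ _ h) => -[h1 h2]; [left|right]; apply/eqP/ffunP => i; rewrite ffunE; apply/val_inj => /=;
  by case: (unliftP ord0 i) => [j ->|->]; rewrite ?(ord1 j) /= inordK.
Qed.

End PartitionBoxes.

Lemma card_equivalence_partition (T : finType) (U : finType) (f : T -> U) (e : rel T) (D : {set T}) :
  {in D &, forall x y, e x y = (f x == f y)} ->
  #|equivalence_partition e D| = #|[set f x | x in D]%SET|.
Proof.
move=> he; pose g (v : U) := [set y in D | v == f y]%SET.
have -> : equivalence_partition e D = [set g v | v in [set f x | x in D]%SET]%SET.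
  apply/setP => A; apply/finset.imsetP/finset.imsetP => [[x xD ->]|[v /finset.imsetP [x xD ->] ->]].
    exists (f x); first by apply/finset.imsetP; exists x.
    by apply/setP => y; rewrite !inE; case: (boolP (y \in D)) => //= yD; rewrite he.
  exists x => //.
  by apply/setP => y; rewrite !inE; case: (boolP (y \in D)) => //= yD; rewrite he.
apply: card_in_imset => u v /finset.imsetP [x xD ->] /finset.imsetP [y yD ->] /setP /(_ x).
by rewrite !inE xD eqxx /= => /esym /eqP.
Qed.

Section CountAbelian.
Local Open Scope nat_scope.

(** The group structure needs a proof of [abelian_law m]; matching on [idP] supplies one and keeps
    the function total. *)
Definition law_mult n (m : {ffun 'I_n -> {ffun 'I_n -> 'I_n}}) (p i : nat) : nat :=
  if @idP (abelian_law m) is ReflectT h then type_mult [set: law_type h]%SET p i else 0.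

Lemma law_multE n (m : {ffun 'I_n -> {ffun 'I_n -> 'I_n}}) (h : abelian_law m) p i :
  law_mult m p i = type_mult [set: law_type h]%SET p i.
Proof. by rewrite /law_mult; case: {-}_ / idP => // h'; rewrite (bool_irrelevance h h'). Qed.

(** A complete invariant with values in a finite type: the partition of [logn p n] for each prime p
    <= n. Rows at non-primes are frozen so that the image is exactly a product of boxes. *)
Definition law_family n (m : {ffun 'I_n -> {ffun 'I_n -> 'I_n}}) : {ffun 'I_n.+1 -> {ffun 'I_n -> 'I_n.+1}} :=
  [ffun p : 'I_n.+1 => [ffun i : 'I_n => if prime p then inord (law_mult m p i) else ord0]].

Lemma logn_leq p n : logn p n <= n.
Proof. by case: n => [|n]; [rewrite logn0|apply/ltnW/ltn_logl]. Qed.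

Lemma law_mult_leq n (m : {ffun 'I_n -> {ffun 'I_n -> 'I_n}}) p i : abelian_law m ->
  prime p -> i < n -> law_mult m p i <= n.
Proof.
move=> h pp hi; rewrite (law_multE h).
have := @type_mult_sum _ [set: law_type h]%G p n (law_abelian h) pp.
rewrite /= card_law_type => /(_ (logn_leq p n)) hs.
apply: leq_trans (logn_leq p n); rewrite -hs (bigD1 (Ordinal hi)) //=.
by apply: leq_trans (leq_addr _ _); rewrite leq_pmull.
Qed.

Lemma law_family_isog n : 0 < n -> {in [set m | abelian_law m]%SET &, forall m1 m2 : {ffun 'I_n -> {ffun 'I_n -> 'I_n}},
  isog_law m1 m2 = (law_family m1 == law_family m2)}.
Proof.
move=> n0 m1 m2; rewrite !inE => h1 h2; rewrite (isog_lawP h1 h2); apply/idP/eqP => [iso|e].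
  apply/ffunP => p; rewrite !ffunE; apply/ffunP => i; rewrite !ffunE.
  by rewrite (law_multE h1) (law_multE h2) /type_mult (isog_abelian_type iso).
apply: type_mult_isog; rewrite ?card_law_type ?law_abelian// => p i pp hi.
have pn : p < n.+1.
  have : 0 < logn p n by apply: leq_ltn_trans hi.
  by rewrite logn_gt0 mem_primes => /and3P[_ _ /dvdn_leq]; rewrite ltnS; apply.
have iN : i < n by apply: leq_trans hi (logn_leq p n).
move/ffunP/(_ (Ordinal pn)): e; rewrite !ffunE => /ffunP/(_ (Ordinal iN)); rewrite !ffunE /= pp.
move=> /(congr1 val) /=; rewrite !inordK ?ltnS ?law_mult_leq//.
by rewrite (law_multE h1) (law_multE h2).
Qed.

(** Each row coming from a law is a partition of [logn p n]; conversely, every choice of such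
    partitions is realised by a product of cyclic groups of prime-power order. *)
Lemma law_family_image n : 0 < n ->
  [set law_family m | m in [set m | abelian_law m]]%SET =
  [set F : {ffun 'I_n.+1 -> {ffun 'I_n -> 'I_n.+1}} | F \in family (fun p : 'I_n.+1 =>
     if prime p then mem (box_partitions n n (logn p n)) else mem [set [ffun=> ord0]]%SET)]%SET.
Proof.
move=> n0; apply/setP => F; rewrite inE; apply/finset.imsetP/familyP => [[m]|hF].
  rewrite inE => h -> p; case: ifP => pp; rewrite !inE ffunE; last first.
    by apply/eqP/ffunP => i; rewrite !ffunE pp.
  have := @type_mult_sum _ [set: law_type h]%G p n (law_abelian h) pp.
  rewrite /= card_law_type => /(_ (logn_leq p n)) hs; apply/eqP; rewrite -[RHS]hs.
  by apply: eq_bigr => i _; rewrite ffunE pp inordK ?ltnS ?law_mult_leq// law_multE.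
(* One cyclic factor of order p^(i+1) for each part i+1 of the partition at p. *)
pose s := flatten [seq flatten [seq nseq (F p i) (p ^ i.+1) | i <- enum 'I_n] | p <- [seq p : 'I_n.+1 <- enum 'I_n.+1 | prime p]].
have s0 : all (fun k => 0 < k) s.
  apply/allP => k /flattenP [u /mapP [p]]; rewrite mem_filter => /andP[pp _] -> {u} /flattenP [u /mapP [i _ ->]].
  by rewrite mem_nseq => /andP[_ /eqP ->]; rewrite expn_gt0 prime_gt0.
have [gT [b [cG defG ob]]] := abelian_group_of_orders s0.
have sumF (p : 'I_n.+1) : prime p -> \sum_(i < n) i.+1 * F p i = logn p n.
  by move=> pp; have := hF p; rewrite pp inE => /eqP.
have oG : #|gT| = n.
  rewrite -cardsT -(bigdprod_card defG) -(big_map order xpredT id) ob /s big_flatten big_map /=.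
  rewrite big_filter big_enum_cond /= -[RHS]partnT// /partn big_mkord big_mkcond /=.
  apply: eq_bigr => p _; case: ifP => pp; last by rewrite lognE pp.
  rewrite big_flatten big_map big_enum /= -(sumF p pp) expn_sum.
  by apply: eq_bigr => i _; rewrite big_nseq iter_muln_1 expnM.
have [m [hm iso]] := law_of_group cG oG.
exists m; first by rewrite inE.
apply/ffunP => p; rewrite ffunE; apply/ffunP => i; rewrite ffunE.
case: ifP (hF p) => pp hp; last by move: hp; rewrite !inE => /eqP ->; rewrite ffunE.
apply/val_inj => /=; rewrite (law_multE hm) /type_mult -(isog_abelian_type iso).
have := @type_mult_basis _ [set: gT]%G b p i cG defG; rewrite /type_mult /= => ->.
suff -> : count [pred k | logn p k == i.+1] (map order b) = F p i by rewrite inordK.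
rewrite ob -sum1_count big_mkcond /s big_flatten big_map big_filter big_enum_cond /=.
(* Only the copies of p^(i+1) have p-exponent i+1, so the count at (p, i) collapses to [F p i]. *)
have inner (q : 'I_n.+1) (j : 'I_n) : prime q ->
    \sum_(k <- nseq (F q j) (q ^ j.+1)) (if logn p k == i.+1 then 1 else 0) =
    if (q == p) && (j == i) then F q j : nat else 0.
  move=> pq; rewrite big_nseq iter_addn_0 lognX (logn_prime _ pq).
  have [->|npq] := eqVneq q p; last by rewrite eq_sym -val_eqE /= in npq *; rewrite eq_sym (negbTE npq) muln0.
  by rewrite eqxx muln1 eqSS /= -val_eqE /=; case: eqP => //; rewrite ?mul1n.
rewrite (bigD1 p) //= [X in _ + X]big1 ?addn0; last first.
  move=> q /andP[pq npq]; rewrite big_flatten big_map big_enum /= big1// => j _.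
  by rewrite inner// (negbTE npq).
rewrite big_flatten big_map big_enum /= (bigD1 i) //= inner// !eqxx /= big1 ?addn0// => j nji.
by rewrite inner// (negbTE nji) andbF.
Qed.

Lemma num_abelianE n : 0 < n -> num_abelian n = \prod_(p <- primes n) num_partitions (logn p n).
Proof.
move=> n0; rewrite /num_abelian (card_equivalence_partition (law_family_isog n0)) law_family_image//.
rewrite cardsE card_family foldrE big_map big_enum /=.
have -> : \prod_(p < n.+1) #|if prime p then mem (box_partitions n n (logn p n))
     else mem [set [ffun=> ord0 : 'I_n.+1]]%SET| = \prod_(p < n.+1 | prime p) num_partitions (logn p n).
  rewrite [RHS]big_mkcond; apply: eq_bigr => p _; case: ifP => pp; last by rewrite cards1.
  by rewrite card_box_partitions ?logn_leq.
rewrite -(big_mkord prime (fun p => num_partitions (logn p n))).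
rewrite (bigID (mem (primes n))) /= [X in _ * X]big1 ?muln1; last first.
  by move=> p /andP[_]; rewrite -logn_gt0 -eqn0Ngt => /eqP ->; rewrite num_partitions0.
rewrite -big_filter; apply: perm_big; apply: uniq_perm; rewrite ?filter_uniq ?iota_uniq ?primes_uniq//.
move=> p; rewrite mem_filter mem_index_iota /= mem_primes n0 /=.
by apply/idP/idP => [/andP[/andP[_ //]]|/andP[pp pn]]; rewrite pp pn ltnS dvdn_leq.
Qed.

End CountAbelian.

(** * Multiplicative functions and hyperbolic sums *)

Section PowerDivisorSums.
Variable R : comNzRingType.
Implicit Types (f F : nat -> R) (c : nat -> R) (j n X : nat).

(* In terms of the local series sum_v c(v) t^v, lconv j divides it by 1 - t^j and
   ldiff j multiplies it by 1 - t^j. *)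
Definition multf c n : R := \prod_(p <- primes n) c (logn p n).

Definition lconv j c v : R := \sum_(0 <= i < v.+1 | (i * j <= v)%N) c (v - i * j)%N.

Definition ldiff j c v : R := c v - (if (j <= v)%N then c (v - j)%N else 0).

(** The Dirichlet convolution of f with the indicator of j-th powers. *)
Definition powdiv_sum j f n : R := \sum_(1 <= d < n.+1 | (d ^ j %| n)%N) f (n %/ d ^ j)%N.

Definition summatory f X : R := \sum_(1 <= n < X.+1) f n.

(** The terms with d^j > X are [F 0], which vanishes for a summatory function, so the generous range
    d <= X adds nothing. *)
Definition dilation_sum j F X : R := \sum_(1 <= d < X.+1) F (X %/ d ^ j)%N.

(** If F is the summatory function of g, this is the summatory function of the Dirichlet convolution
    of f and g. *)
Definition dirichlet f F X : R := \sum_(1 <= m < X.+1) f m * F (X %/ m)%N.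

Lemma lconv_rec j c v : (0 < j)%N ->
  lconv j c v = c v + (if (j <= v)%N then lconv j c (v - j) else 0).
Proof.
move=> j0; rewrite /lconv big_mkcond big_nat_recl//= mul0n subn0; congr (_ + _).
case: ifP => jv.
  have vjv : (v - j < v)%N by lia.
  rewrite [RHS]big_mkcond (big_cat_nat _ vjv)//=.
  rewrite [X in _ + X]big1_seq ?addr0; last first.
    move=> i /andP[_]; rewrite mem_index_iota => /andP[h _]; rewrite ifF//; nia.
  apply: eq_big_nat => i _.
  have -> : (i.+1 * j <= v)%N = (i * j <= v - j)%N by rewrite mulSn; lia.
  by rewrite mulSn subnDA.
by rewrite big1// => i _; rewrite ifF//; rewrite mulSn; lia.
Qed.

Lemma lconvK j c v : (0 < j)%N -> lconv j (ldiff j c) v = c v.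
Proof.
move=> j0; elim/ltn_ind: v => v IH; rewrite lconv_rec// {1}/ldiff; case: ifP => jv; last by rewrite subr0 addr0.
by rewrite IH ?subrK//; lia.
Qed.

Lemma multf_widen c n N : c 0%N = 1 -> (0 < n)%N -> (n < N)%N ->
  multf c n = \prod_(0 <= p < N | prime p) c (logn p n).
Proof.
move=> c0 n0 nN; rewrite (bigID (mem (primes n))) /= [X in _ * X]big1 ?mulr1; last first.
  by move=> p /andP[_]; rewrite -logn_gt0 -eqn0Ngt => /eqP ->.
rewrite -big_filter; apply: perm_big; apply: uniq_perm; rewrite ?filter_uniq ?iota_uniq ?primes_uniq//.
move=> p; rewrite mem_filter mem_index_iota /= mem_primes n0 /=.
apply/idP/idP => [/andP[pp pn]|/andP[/andP[_ //]]]; rewrite pp pn /=.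
by apply: leq_ltn_trans nN; apply: dvdn_leq.
Qed.

Lemma multf1 c : multf c 1 = 1.
Proof. by rewrite /multf big_nil. Qed.

Lemma multfM c m n : c 0%N = 1 -> (0 < m)%N -> (0 < n)%N -> coprime m n ->
  multf c (m * n) = multf c m * multf c n.
Proof.
move=> c0 m0 n0 co; pose N := (m * n + m + n).+1.
rewrite !(@multf_widen c _ N)// ?muln_gt0 ?m0 ?n0//; try (by rewrite /N; lia).
rewrite -big_split /=; apply: eq_bigr => p pp; rewrite lognM//.
case: (posnP (logn p m)) => [->|pm]; first by rewrite c0 mul1r add0n.
case: (posnP (logn p n)) => [->|pn]; first by rewrite c0 mulr1 addn0.
move: pm pn; rewrite !logn_gt0 !mem_primes => /and3P[_ _ pm] /and3P[_ _ pn].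
by move: (coprime_dvdl pm co); rewrite prime_coprime// pn.
Qed.

Lemma multf_pX c p v : prime p -> c 0%N = 1 -> multf c (p ^ v) = c v.
Proof.
move=> pp c0; case: v => [|v]; first by rewrite expn0 multf1 c0.
by rewrite /multf primesX// primes_prime// big_seq1 pfactorK.
Qed.

(** Dividing every Euler factor by 1 - p^(-js) multiplies the Dirichlet series by zeta(js). The
    induction removes the full power p^v of the least prime factor: each d with d^j | n splits
    uniquely as p^i d' with i j <= v and d'^j | m. *)
Lemma multf_lconv j c n : (0 < j)%N -> c 0%N = 1 -> (0 < n)%N ->
  multf (lconv j c) n = powdiv_sum j (multf c) n.
Proof.
move=> j0 c0; elim/ltn_ind: n => n IH n0.
have lc0 : lconv j c 0%N = 1 by rewrite lconv_rec// ifF ?addr0//; lia.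
case: (ltnP 1 n) => [n1|n1]; last first.
  have -> : n = 1%N by lia.
  by rewrite multf1 /powdiv_sum big_mkcond big_nat1 exp1n /= multf1.
pose p := pdiv n; have pp : prime p := pdiv_prime n1.
pose v := logn p n; pose m := (n`_p^')%N.
have nE : n = (p ^ v * m)%N by rewrite -p_part partnC.
have v0 : (0 < v)%N by rewrite logn_gt0 mem_primes pp n0 pdiv_dvd.
have m0 : (0 < m)%N by apply: part_gt0.
have pm : coprime p m.
  by rewrite -(part_pnat_id (pnat_id pp)) coprime_partC.
have mn : (m < n)%N.
  by rewrite nE ltn_Pmull// -(expn0 p) ltn_exp2l// prime_gt1.
have pvm : coprime (p ^ v) m by apply: coprimeXl.
rewrite [in LHS]nE multfM ?expn_gt0 ?(prime_gt0 pp)// multf_pX// IH//.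
have logpm d : (d ^ j %| m)%N -> coprime p d /\ (0 < d)%N.
  move=> dm; have d0 : (0 < d)%N by move: (dvdn_gt0 m0 dm); rewrite expn_gt0 (gtn_eqF j0) orbF.
  by split=> //; apply: coprime_dvdr pm; apply: dvdn_trans dm; apply: dvdn_exp.
have logpd i d : (d ^ j %| m)%N -> logn p (p ^ i * d) = i.
  move=> /logpm[pd d0]; rewrite lognM ?expn_gt0 ?(prime_gt0 pp)// pfactorK// (_ : logn p d = 0%N) ?addn0//.
  by apply/eqP; rewrite eqn0Ngt logn_gt0 mem_primes pp d0 /= -prime_coprime.
pose I := [seq i <- index_iota 0 v.+1 | (i * j <= v)%N].
pose S' := [seq d <- index_iota 1 m.+1 | (d ^ j %| m)%N].
have S'P d : d \in S' = (d ^ j %| m)%N.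
  rewrite mem_filter mem_index_iota; apply/andP/idP => [[]//|dm]; split=> //.
  have [_ d0] := logpm d dm; rewrite d0 ltnS /=; apply: dvdn_leq => //.
  by apply: dvdn_trans dm; apply: dvdn_exp.
have IP i : i \in I = (i * j <= v)%N.
  by rewrite mem_filter mem_index_iota; apply/andP/idP => [[]//|h]; split=> //=; nia.
(* The bijection (i, d') -> p^i d' onto the d with d^j | n. *)
have E : perm_eq [seq d <- index_iota 1 n.+1 | (d ^ j %| n)%N] [seq (p ^ i * d)%N | i <- I, d <- S'].
  apply: uniq_perm; first by rewrite filter_uniq ?iota_uniq.
    apply: allpairs_uniq; rewrite ?filter_uniq ?iota_uniq//.
    move=> [i d] [i' d'] hx hy; have /allpairsP [[i1 d1] /= [_ h1 [-> ->]]] := hx.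
    have /allpairsP [[i2 d2] /= [_ h2 [-> ->]]] := hy => e.
    rewrite !S'P in h1 h2; have ei : i1 = i2 by rewrite -(logpd i1 d1)// e logpd.
    move: e; rewrite ei => /eqP; rewrite eqn_pmul2l ?expn_gt0 ?(prime_gt0 pp)// => /eqP ->.
    by [].
  move=> d; rewrite mem_filter mem_index_iota.
  apply/andP/allpairsP => [[dn /andP[d0 _]]|[[i d'] /= []]].
    exists (logn p d, d`_p^')%N => /=; rewrite IP S'P -p_part partnC//; split=> //.
      by rewrite mulnC -lognX /v dvdn_leq_log.
    have : (d`_p^' ^ j %| p ^ v * m)%N.
      by rewrite -nE; apply: dvdn_trans dn; apply: dvdn_exp2r; apply: dvdn_part.
    rewrite Gauss_dvdr// coprimeXl// coprimeXr// coprime_sym.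
    by rewrite -{1}(part_pnat_id (pnat_id pp)) coprime_partC.
  rewrite IP S'P => hi hd ->; have [_ d0] := logpm d' hd; split.
    by rewrite nE expnMn -expnM dvdn_mul// dvdn_exp2l.
  rewrite muln_gt0 expn_gt0 (prime_gt0 pp) d0 /= ltnS; apply: dvdn_leq => //.
  rewrite nE dvdn_mul//; first by rewrite dvdn_exp2l//; nia.
  by apply: dvdn_trans hd; apply: dvdn_exp.
rewrite /powdiv_sum /lconv -[RHS]big_filter (perm_big _ E) big_allpairs_dep /=.
rewrite -[X in X * _]big_filter -[X in _ * X]big_filter.
rewrite big_distrlr /=; apply: eq_big_seq => i; rewrite IP => hi; apply: eq_big_seq => d; rewrite S'P => hd.
have [_ d0] := logpm d hd.
have -> : (n %/ (p ^ i * d) ^ j = p ^ (v - i * j) * (m %/ d ^ j))%N.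
  have hv : (p ^ v = p ^ (v - i * j) * p ^ (i * j))%N by rewrite -expnD subnK.
  rewrite {1}nE hv expnMn -expnM divnMA mulnAC mulnK ?expn_gt0 ?(prime_gt0 pp)//.
  by rewrite muln_divA.
rewrite multfM ?expn_gt0 ?(prime_gt0 pp)//.
- by rewrite multf_pX.
- by rewrite divn_gt0 ?expn_gt0 ?d0// dvdn_leq.
- by apply: coprimeXl; apply: coprime_dvdr pm; apply: dvdn_div.
Qed.

Lemma summatory_powdiv j f X : (0 < j)%N ->
  summatory (powdiv_sum j f) X = dilation_sum j (summatory f) X.
Proof.
move=> j0; rewrite /summatory /dilation_sum.
have multiples e Y : (0 < e)%N -> \sum_(1 <= n < Y.+1 | (e %| n)%N) f (n %/ e)%N = \sum_(1 <= n < (Y %/ e).+1) f n.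
  move=> e0; elim: Y => [|Y IH]; first by rewrite div0n !big_geq.
  rewrite big_mkcond big_nat_recr//= -big_mkcond IH divnS//; case: ifP => eY.
    rewrite add1n [in RHS]big_nat_recr//=; congr (_ + f _).
    by rewrite eY add1n.
  by rewrite addr0.
have -> : \sum_(1 <= n < X.+1) powdiv_sum j f n =
   \sum_(1 <= n < X.+1) \sum_(1 <= d < X.+1) (if (d ^ j %| n)%N then f (n %/ d ^ j)%N else 0).
  apply: eq_big_nat => n /andP[n0 nX]; rewrite /powdiv_sum big_mkcond.
  rewrite [RHS](big_cat_nat (n := n.+1))//= [X in _ + X]big1_seq ?addr0// => d /andP[_].
  rewrite mem_index_iota => /andP[nd _]; rewrite ifF//; apply/negbTE/negP => /(dvdn_leq n0).
  have d0 : (0 < d)%N by apply: leq_ltn_trans nd.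
  by apply/negP; rewrite -ltnNge; apply: leq_trans nd _; rewrite -{1}(expn1 d) leq_pexp2l.
rewrite exchange_big_nat /=; apply: eq_big_nat => d /andP[d0 _].
by rewrite -big_mkcond multiples// expn_gt0 d0.
Qed.

Lemma dilation_sum_widen j F X Y : (0 < j)%N -> F 0%N = 0 -> (X <= Y)%N ->
  dilation_sum j F X = \sum_(1 <= d < Y.+1) F (X %/ d ^ j)%N.
Proof.
move=> j0 F0 XY; rewrite /dilation_sum [RHS](big_cat_nat (n := X.+1))//= [X in _ + X]big1_seq ?addr0//.
move=> d /andP[_]; rewrite mem_index_iota => /andP[Xd _].
have d0 : (0 < d)%N by apply: leq_ltn_trans Xd.
by rewrite divn_small//; apply: leq_trans Xd _; rewrite -{1}(expn1 d) leq_pexp2l.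
Qed.

Lemma dilation_sum0 j F : dilation_sum j F 0 = 0.
Proof. by rewrite /dilation_sum big_geq. Qed.

(** Both sides sum f(m) F(X / (m d^j)), since nested floors of quotients are a single floor. *)
Lemma dilation_dirichlet j f F X : (0 < j)%N -> F 0%N = 0 ->
  dilation_sum j (dirichlet f F) X = dirichlet f (dilation_sum j F) X.
Proof.
move=> j0 F0; rewrite /dirichlet /dilation_sum.
have -> : \sum_(1 <= d < X.+1) \sum_(1 <= m < (X %/ d ^ j).+1) f m * F (X %/ d ^ j %/ m)%N =
  \sum_(1 <= d < X.+1) \sum_(1 <= m < X.+1) f m * F (X %/ d ^ j %/ m)%N.
  apply: eq_big_nat => d _; rewrite [RHS](big_cat_nat (n := (X %/ d ^ j).+1))//=; last by rewrite ltnS leq_div.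
  rewrite [X in _ + X]big1_seq ?addr0// => m /andP[_]; rewrite mem_index_iota => /andP[h _].
  by rewrite (divn_small h) F0 mulr0.
rewrite exchange_big_nat /=; apply: eq_big_nat => m _; rewrite -mulr_sumr; congr (_ * _).
rewrite [RHS](dilation_sum_widen (Y := X))// ?leq_div//.
by apply: eq_big_nat => d _; rewrite -!divnMA mulnC.
Qed.

Lemma dilation_comm i j F X : (0 < i)%N -> (0 < j)%N -> F 0%N = 0 ->
  dilation_sum i (dilation_sum j F) X = dilation_sum j (dilation_sum i F) X.
Proof.
move=> i0 j0 F0.
have e a b : (0 < a)%N -> (0 < b)%N -> dilation_sum a (dilation_sum b F) X =
   \sum_(1 <= d < X.+1) \sum_(1 <= k < X.+1) F (X %/ (d ^ a * k ^ b))%N.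
  move=> a0 b0; rewrite {1}/dilation_sum; apply: eq_big_nat => d _.
  by rewrite (dilation_sum_widen (Y := X))// ?leq_div//; apply: eq_big_nat => k _; rewrite divnMA.
rewrite (e i j)// (e j i)// exchange_big_nat /=.
by apply: eq_big_nat => d _; apply: eq_big_nat => k _; rewrite mulnC.
Qed.

Lemma eq_dilation_sum j F G X : F =1 G -> dilation_sum j F X = dilation_sum j G X.
Proof. by move=> FG; apply: eq_bigr => d _; rewrite FG. Qed.

End PowerDivisorSums.

Section GenDivisor.
Local Open Scope nat_scope.

(** [gen_divisor] ties the bound on the entries to n. Peeling off an exponent replaces n by a
    quotient, so the bound is made independent of n here. *)
Definition divisor_box (B : nat) (js : seq nat) (n : nat) : {set {ffun 'I_(size js) -> 'I_B.+1}} :=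
  [set d : {ffun 'I_(size js) -> 'I_B.+1} |
      [forall i, 0 < d i] && (\prod_(i < size js) d i ^ nth 0 js i == n)]%SET.

Lemma card_divisor_box_cons B j js n : 0 < j -> 0 < n ->
  #|divisor_box B (j :: js) n| =
  \sum_(1 <= d < B.+1 | d ^ j %| n) #|divisor_box B js (n %/ d ^ j)|.
Proof.
move=> j0 n0; rewrite -sum1_card.
rewrite (partition_big (fun f : {ffun 'I_(size js).+1 -> 'I_B.+1} => f ord0) xpredT)//=.
have -> : \sum_(1 <= d < B.+1 | d ^ j %| n) #|divisor_box B js (n %/ d ^ j)|
   = \sum_(d < B.+1) if (0 < d) && (d ^ j %| n) then #|divisor_box B js (n %/ d ^ j)| else 0.
  by rewrite [RHS]big_ord_recl /= add0n big_add1 big_mkcond big_mkord.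
apply: eq_bigr => d _.
pose cons (g : {ffun 'I_(size js) -> 'I_B.+1}) : {ffun 'I_(size js).+1 -> 'I_B.+1} :=
  [ffun i => if unlift ord0 i is Some i' then g i' else d].
pose tail (f : {ffun 'I_(size js).+1 -> 'I_B.+1}) : {ffun 'I_(size js) -> 'I_B.+1} :=
  [ffun i => f (lift ord0 i)].
have cons0 g : cons g ord0 = d by rewrite ffunE unlift_none.
have consS g i : cons g (lift ord0 i) = g i by rewrite ffunE liftK.
have inbox f : (f \in divisor_box B (j :: js) n) =
    [&& 0 < f ord0, [forall i, 0 < tail f i] & f ord0 ^ j * \prod_(i < size js) tail f i ^ nth 0 js i == n].
  rewrite inE big_ord_recl /= andbA; congr (_ && _).
    apply/forallP/andP => [h|[h0 /forallP h] i].
      by split; [exact: h|apply/forallP => i; rewrite ffunE; exact: h].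
    by case: (unliftP ord0 i) => [i' ->|->//]; have := h i'; rewrite ffunE.
  by congr (_ * _ == _); apply: eq_bigr => i _; rewrite ffunE.
have consK g : tail (cons g) = g by apply/ffunP => i; rewrite ffunE consS.
rewrite (reindex_onto cons tail) /=; last first.
  move=> f /andP[_ /eqP f0]; apply/ffunP => i; case: (unliftP ord0 i) => [i' ->|->].
    by rewrite consS ffunE.
  by rewrite cons0.
under eq_bigl => g do rewrite inbox cons0 consK !eqxx !andbT.
case: ifP => [/andP[d0 dn]|hd]; last first.
  rewrite big1// => g /and3P[d0 _ /eqP e]; move: hd; rewrite d0 /= -e dvdn_mulr//.
rewrite -sum1_card; apply: eq_bigl => g; rewrite d0 inE /=; congr (_ && _).
by rewrite mulnC -[RHS](eqn_pmul2r (m := d ^ j)) ?expn_gt0 ?d0// divnK.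
Qed.

Fixpoint gen_divisor_rec (js : seq nat) (n : nat) : nat :=
  if js is j :: js' then \sum_(1 <= d < n.+1 | d ^ j %| n) gen_divisor_rec js' (n %/ d ^ j)
  else n == 1.

Lemma card_divisor_box B js n : all (leq 1) js -> 0 < n -> n <= B ->
  #|divisor_box B js n| = gen_divisor_rec js n.
Proof.
elim: js n => [|j js IH] n.
  move=> _ n0 _ /=; case: eqP => [->|n1].
    apply/eqP/cards1P; exists ([ffun=> ord0] : {ffun 'I_0 -> 'I_B.+1}); apply/setP => f; rewrite !inE big_ord0 eqxx andbT.
    transitivity true; first by apply/forallP => -[].
    by apply/esym/eqP/ffunP => -[].
  by apply/eqP; rewrite cards_eq0; apply/eqP/setP => f; rewrite !inE big_ord0 eq_sym; case: eqP; rewrite ?andbF.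
move=> /andP[j0 hjs] n0 nB; rewrite card_divisor_box_cons//=.
rewrite big_mkcond (big_cat_nat (n := n.+1))//= [X in _ + X]big1_seq ?addn0; last first.
  move=> d /andP[_]; rewrite mem_index_iota => /andP[nd _]; rewrite ifF//; apply/negbTE/negP => /(dvdn_leq n0).
  have d0 : 0 < d by apply: leq_ltn_trans nd.
  by apply/negP; rewrite -ltnNge; apply: leq_trans nd _; rewrite -{1}(expn1 d) leq_pexp2l.
rewrite -big_mkcond; rewrite big_mkcond [RHS]big_mkcond; apply: eq_big_nat => d /andP[d0 _].
case: ifP => // dn; apply: IH => //; last by apply: leq_trans (leq_div _ _) nB.
by rewrite divn_gt0 ?expn_gt0 ?d0// dvdn_leq.
Qed.

Lemma gen_divisorE js n : all (leq 1) js -> 0 < n -> gen_divisor js n = gen_divisor_rec js n.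
Proof. by move=> hjs n0; exact: card_divisor_box. Qed.

End GenDivisor.

(** The base case is the summatory function of the unit of Dirichlet convolution. *)
Definition iter_dilation (R : comNzRingType) (js : seq nat) : nat -> R :=
  foldr (@dilation_sum R) (fun X => (0 < X)%N%:R) js.

Lemma gen_divisor_summatory (R : comNzRingType) (js : seq nat) (X : nat) : all (leq 1) js ->
  (\sum_(1 <= n < X.+1) gen_divisor js n)%N%:R = iter_dilation R js X.
Proof.
move=> hjs.
have -> : (\sum_(1 <= n < X.+1) gen_divisor js n)%N%:R = summatory (fun n => (gen_divisor_rec js n)%:R : R) X.
  by rewrite natr_sum; apply: eq_big_nat => n /andP[n0 _]; rewrite gen_divisorE.
elim: js X hjs => [|j js IH] X.
  move=> _; rewrite /summatory /=; case: X => [|X]; first by rewrite big_geq.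
  by rewrite big_ltn// big1_seq ?addr0// => i /andP[_]; rewrite mem_index_iota => /andP[h _]; rewrite gtn_eqF.
move=> /andP[j0 hjs]; rewrite [RHS]/= -/(iter_dilation R js).
rewrite -(eq_dilation_sum j X (fun Y => IH Y hjs)) -summatory_powdiv//.
by apply: eq_bigr => n _; rewrite /= natr_sum.
Qed.

(** * Absolutely convergent series and Euler products *)

Section AbsoluteSums.
Variable R : realType.
Implicit Types (u w : nat -> R) (B : R).

Definition abs_bounded u B := forall N, \sum_(0 <= n < N) `|u n| <= B.

Lemma abs_sum_homo u : {homo (fun N => \sum_(0 <= n < N) `|u n|) : x y / (x <= y)%N >-> x <= y}.
Proof.
by move=> x y xy; rewrite [leRHS](big_cat_nat (n := x))//= lerDl sumr_ge0.
Qed.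

Lemma abs_bounded_is_cvg u B : abs_bounded u B -> cvgn (fun N => \sum_(0 <= n < N) `|u n|).
Proof.
move=> h; apply: nondecreasing_is_cvgn; first exact: abs_sum_homo.
by exists B => _ [n _ <-]; apply: h.
Qed.

Lemma abs_bounded_cvg u B : abs_bounded u B -> cvgn (series u).
Proof. by move=> h; apply: normed_cvg; exact: (abs_bounded_is_cvg h). Qed.

Lemma abs_bounded_ge0 u B : abs_bounded u B -> 0 <= B.
Proof. by move=> /(_ 0%N); rewrite big_geq. Qed.

Lemma abs_bounded_le u w B : (forall n, `|u n| <= `|w n|) -> abs_bounded w B -> abs_bounded u B.
Proof. by move=> uw h N; apply: le_trans (h N); apply: ler_sum => n _. Qed.

Lemma abs_bounded_scale u B (k : R) : abs_bounded u B -> abs_bounded (fun n => k * u n) (`|k| * B).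
Proof.
move=> h N; under eq_bigr do rewrite normrM.
by rewrite -mulr_sumr ler_wpM2l.
Qed.

Lemma abs_bounded_tail u B (e : R) : abs_bounded u B -> 0 < e ->
  exists N, forall M, \sum_(N <= n < M) `|u n| <= e.
Proof.
move=> h e0; have c := abs_bounded_is_cvg h.
have /cvgrPdist_lt /(_ _ e0) [N _ hN] := c; exists N => M.
have [MN|NM] := leqP M N; first by rewrite big_geq// ltW.
have hM := nondecreasing_cvgn_le (@abs_sum_homo u) c M.
have := hN N (leqnn N); rewrite /= => hlt; have := ltW (le_lt_trans (ler_norm _) hlt).
apply: le_trans; apply: le_trans (lerB hM (lexx _)).
by rewrite [X in _ <= X - _](big_cat_nat (n := N)) ?(ltnW NM)//= addrAC subrr add0r.
Qed.

(** Dominated convergence for a sum whose number of terms grows with X. Up to N the convergence is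
    termwise; beyond N the tail of w controls both sums. The four errors are e/4 each. *)
Lemma tannery (u : nat -> nat -> R) (v w : nat -> R) B :
  (forall X m, `|u X m| <= w m) -> abs_bounded w B ->
  (forall m, (fun X => u X m) @ \oo --> v m) ->
  abs_bounded v B /\
  (fun X => \sum_(0 <= m < X) u X m) @ \oo --> limn (series v).
Proof.
move=> uw hw cu.
have vw m : `|v m| <= w m.
  have c : (fun X => `|u X m|) @ \oo --> `|v m| by apply: cvg_norm.
  rewrite -(cvg_lim _ c)//; apply: limr_le; first by apply/cvgP: c.
  by near=> X; apply: uw.
have hv : abs_bounded v B.
  by apply: abs_bounded_le hw => n; apply: le_trans (vw n) (ler_norm _).
split=> //; have cv := abs_bounded_cvg hv.
apply/cvgrPdist_le => e e0; have e4 : 0 < e / 4 by rewrite divr_gt0.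
have [N hN] := abs_bounded_tail hw e4.
have c1 : (fun X => \sum_(0 <= m < N) u X m) @ \oo --> \sum_(0 <= m < N) v m.
  by apply: cvg_big => [|m _]; [exact: add_continuous|exact: cu].
have /cvgrPdist_le /(_ _ e4) h1 := c1.
have /cvgrPdist_le /(_ _ e4) h2 := cv.
near=> X.
have NX : (N <= X)%N by near: X; exists N.
have k1 : `|\sum_(0 <= m < N) v m - \sum_(0 <= m < N) u X m| <= e / 4 by near: X.
have k2 : `|limn (series v) - series v X| <= e / 4 by near: X.
have tail (f : nat -> R) : (forall m, `|f m| <= w m) -> `|\sum_(N <= m < X) f m| <= e / 4.
  move=> fw; apply: le_trans (ler_norm_sum _ _ _) _; apply: le_trans (hN X).
  by apply: ler_sum => m _; apply: le_trans (fw m) (ler_norm _).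
have k3 := tail v vw; have k4 := tail (u X) (uw X).
rewrite /series /= (big_cat_nat (n := N))//= in k2.
rewrite (big_cat_nat (n := N))//=.
move: k1 k2 k3 k4; rewrite !ler_norml => /andP[? ?] /andP[? ?] /andP[? ?] /andP[? ?].
by apply/andP; split; lra.
Unshelve. all: by end_near. Qed.

Lemma sum_dyadic (f : nat -> R) (K : nat) (a b : R) :
  (forall k n, (2 ^ k <= n < 2 ^ k.+1)%N -> f n <= a * b ^+ k) -> 
  \sum_(1 <= n < 2 ^ K) f n <= \sum_(0 <= k < K) a * (2 * b) ^+ k.
Proof.
move=> h; elim: K => [|K IH]; first by rewrite expn0 !big_geq.
rewrite (big_cat_nat (n := 2 ^ K)) ?expn_gt0 ?leq_exp2l//= [leRHS]big_nat_recr//= lerD//.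
apply: (@le_trans _ _ (\sum_(2 ^ K <= n < 2 ^ K.+1) a * b ^+ K)).
  by apply: ler_sum_nat => n hn; apply: h.
rewrite sumr_const_nat expnS mul2n -addnn addnK -[leLHS]mulr_natr natrX exprMn.
by rewrite -mulrA [2 ^+ K * _]mulrC.
Qed.

Lemma geometric_sum_le (K : nat) (q : R) : 0 <= q < 1 -> \sum_(0 <= k < K) q ^+ k <= (1 - q)^-1.
Proof.
move=> /andP[q0 q1]; have d0 : 0 < 1 - q by rewrite subr_gt0.
rewrite -[leRHS]mul1r ler_pdivlMr// big_mkord mulrC -opprB mulNr -subrX1 opprB.
by rewrite gerBl exprn_ge0.
Qed.

Lemma gt1_ltr_powR (a x y : R) : 1 < a -> x < y -> a `^ x < a `^ y.
Proof.
move=> a1 xy; have a0 : 0 < a by apply: lt_trans a1.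
by rewrite /powR gt_eqF// ltr_expR ltr_pM2r// ln_gt0.
Qed.

Lemma pseries_bound (s : R) : 1 < s -> exists B, abs_bounded (fun n => n.+1%:R `^ (- s)) B.
Proof.
move=> s1; pose b : R := 2 `^ (- s).
have b0 : 0 <= 2 * b by rewrite mulr_ge0 ?powR_ge0.
have b1 : 2 * b < 1.
  rewrite /b powRN ltr_pdivrMr ?powR_gt0// mul1r -{1}[2]powRr1//.
  by apply: gt1_ltr_powR; rewrite ?ltr1n.
exists (1 - 2 * b)^-1 => N.
have -> : \sum_(0 <= n < N) `|n.+1%:R `^ (- s)| = \sum_(1 <= n < N.+1) n%:R `^ (- s) :> R.
  by rewrite big_add1 /=; apply: eq_bigr => n _; rewrite ger0_norm// powR_ge0.
apply: (@le_trans _ _ (\sum_(1 <= n < 2 ^ N.+1) n%:R `^ (- s))).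
  rewrite [leRHS](big_cat_nat (n := N.+1))//=; last by apply/ltnW/ltn_expl.
  by rewrite lerDl sumr_ge0// => n _; rewrite powR_ge0.
apply: le_trans (geometric_sum_le N.+1 (introT andP (conj b0 b1))).
apply: le_trans (@sum_dyadic _ _ 1 b _) _; last by under eq_bigr do rewrite mul1r.
move=> k n /andP[kn _]; rewrite mul1r /b -powR_mulrn ?powR_ge0// -powRrM mulrC powRrM powR_mulrn//.
rewrite !powRN lef_pV2 ?posrE ?powR_gt0 ?exprn_gt0// ?ltr0n; last first.
  by apply: leq_trans kn; rewrite expn_gt0.
by apply: ge0_ler_powR; rewrite ?nnegrE ?exprn_ge0 ?ler0n//; [lra|rewrite -natrX ler_nat].
Qed.

End AbsoluteSums.

(** With t = 1/q < 1, P(n) t^n is at most the product of the 1/(1 - t^i), i <= n, which is bounded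
    independently of n. *)
Lemma num_partitions_bound (R : realType) (q : R) : 1 < q ->
  exists C : R, forall n, (num_partitions n)%:R <= C * q ^+ n.
Proof.
move=> q1; have q0 : 0 < q by apply: lt_trans q1.
pose t := q^-1; have t0 : 0 < t by rewrite invr_gt0.
have t1 : t < 1 by rewrite invf_lt1.
have d0 : 0 < 1 - t by rewrite subr_gt0.
exists (expR (t / (1 - t) * (1 - t)^-1)) => n.
have -> : q ^+ n = (t ^+ n)^-1 by rewrite exprVn invrK.
rewrite ler_pdivlMr ?exprn_gt0//.
have tX i : 0 < t ^+ i by rewrite exprn_gt0.
have tX1 i : t ^+ i.+1 < 1 by rewrite exprn_ilt1// ltW.
have -> : (num_partitions n)%:R * t ^+ n = \sum_(mu in box_partitions n n n) \prod_(i < n) (t ^+ i.+1) ^+ mu i.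
  rewrite -[num_partitions n]/(#|box_partitions n n n|) -sum1_card natr_sum mulr_suml.
  apply: eq_bigr => mu; rewrite inE => /eqP e; rewrite mul1r -{1}e expr_sum.
  by apply: eq_bigr => i _; rewrite exprM.
(* Dropping the constraint on the sum of the parts makes the expression a product over part
   sizes. *)
apply: (@le_trans _ _ (\sum_(mu : {ffun 'I_n -> 'I_n.+1}) \prod_(i < n) (t ^+ i.+1) ^+ mu i)).
  rewrite [leRHS](bigID (mem (box_partitions n n n))) /= lerDl sumr_ge0// => mu _.
  by rewrite prodr_ge0// => i _; rewrite exprn_ge0// ltW.
rewrite -(bigA_distr_bigA (fun (i : 'I_n) (m : 'I_n.+1) => (t ^+ i.+1) ^+ m)).
apply: (@le_trans _ _ (\prod_(i < n) expR (t ^+ i.+1 * (1 - t)^-1))).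
  apply: ler_prod => i _; rewrite sumr_ge0/=; last by move=> m _; rewrite exprn_ge0// ltW.
  have h := @geometric_sum_le R n.+1 (t ^+ i.+1); rewrite big_mkord in h.
  apply: (le_trans (h _)); first by rewrite ltW//=.
  rewrite -[(1 - t ^+ i.+1)^-1]invrK -[leRHS]invrK lef_pV2 ?posrE ?invr_gt0 ?invrK ?subr_gt0 ?expR_gt0// -expRN.
  (* With y = t^(i+1): 1/(1-y) = 1 + y/(1-y) <= exp (y/(1-y)), and 1 - y >= 1 - t. *)
  have e : 1 - t ^+ i.+1 = (1 + t ^+ i.+1 / (1 - t ^+ i.+1))^-1.
    have ny : 1 - t ^+ i.+1 != 0 by rewrite subr_eq0 gt_eqF.
    by rewrite -{1}[1 - _]invrK; congr (_^-1); move: (t ^+ i.+1) ny => y ny; field.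
  rewrite e expRN lef_pV2 ?posrE ?expR_gt0//; last by rewrite ltr_wpDr// divr_ge0 ?subr_ge0// ltW.
  apply: (le_trans (expR_ge1Dx _)); rewrite ler_expR ler_wpM2l ?(ltW (tX _))//.
  rewrite lef_pV2 ?posrE ?subr_gt0// lerB// exprS ger_pMr//; apply: exprn_ile1; exact: ltW.
rewrite -expR_sum ler_expR -mulr_suml ler_wpM2r ?invr_ge0 ?(ltW d0)//.
have -> : \sum_(i < n) t ^+ i.+1 = t * \sum_(0 <= i < n) t ^+ i.
  by rewrite big_mkord mulr_sumr; apply: eq_bigr => i _; rewrite exprS.
by rewrite ler_wpM2l ?(ltW t0)//; apply: geometric_sum_le; rewrite (ltW t0).
Qed.

Section SmoothNumbers.
Local Open Scope nat_scope.

(** The numbers obtained by expanding the product over primes p < N of 1 + h(p) + ... + h(p^(M-1)),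
    for multiplicative h. *)
Fixpoint smooth (N M : nat) : seq nat :=
  if N is N'.+1 then
    if prime N' then [seq N' ^ i * m | i <- iota 0 M, m <- smooth N' M] else smooth N' M
  else [:: 1].

Lemma smooth_primes N M m : m \in smooth N M -> 0 < m /\ forall p, prime p -> p %| m -> p < N.
Proof.
elim: N m => [|N IH] m /=.
  by rewrite inE => /eqP ->; split=> // p pp; rewrite dvdn1 => /eqP p1; rewrite p1 in pp.
case: ifP => [pN /allpairsP [[i d] /= [_ /IH [d0 hd] ->]]|_ /IH [m0 hm]].
  split=> [|p pp]; first by rewrite muln_gt0 expn_gt0 prime_gt0.
  rewrite Euclid_dvdM// => /orP[|/(hd p pp)]; last exact: ltnW.
  by rewrite Euclid_dvdX// => /andP[/dvdn_leq]; rewrite ltnS => h _; apply: h; apply: prime_gt0.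
by split=> // p pp /(hm p pp); apply: ltnW.
Qed.

Lemma smooth_coprime N M m i : prime N -> m \in smooth N M -> coprime (N ^ i) m.
Proof.
move=> pN /smooth_primes [m0 hm]; apply: coprimeXl; rewrite prime_coprime//.
by apply/negP => /(hm N pN); rewrite ltnn.
Qed.

Lemma smooth_uniq N M : uniq (smooth N M).
Proof.
elim: N => //= N IH; case: ifP => // pN; apply: allpairs_uniq; rewrite ?iota_uniq//.
have lg i d : d \in smooth N M -> logn N (N ^ i * d) = i.
  move=> hd; have [d0 hd'] := smooth_primes hd.
  rewrite lognM ?expn_gt0 ?(prime_gt0 pN)// pfactorK// (_ : logn N d = 0) ?addn0//.
  by apply/eqP; rewrite eqn0Ngt logn_gt0 mem_primes pN d0 /=; apply/negP => /(hd' N pN); rewrite ltnn.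
move=> [i d] [i' d'] hx hy; have /allpairsP [[i1 d1] /= [_ h1 [-> ->]]] := hx.
have /allpairsP [[i2 d2] /= [_ h2 [-> ->]]] := hy => e.
have ei : i1 = i2 by rewrite -(lg i1 d1)// e lg.
by move: e; rewrite ei => /eqP; rewrite eqn_pmul2l ?expn_gt0 ?(prime_gt0 pN)// => /eqP ->.
Qed.

Lemma mem_smooth N M m : 0 < m -> (forall p, prime p -> p %| m -> p < N) ->
  (forall p, logn p m < M) -> m \in smooth N M.
Proof.
elim: N m => [|N IH] m m0 hm hM /=.
  rewrite inE; apply/eqP; case: (ltnP 1 m) => [m1|]; last by lia.
  by have := hm _ (pdiv_prime m1) (pdiv_dvd m).
case: ifP => pN; last first.
  apply: IH => // p pp pm; have := hm p pp pm; rewrite ltnS leq_eqVlt => /orP[/eqP e|//].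
  by rewrite e pN in pp.
apply/allpairsP; exists (logn N m, m`_N^') => /=; rewrite mem_iota /= add0n hM -p_part partnC//; split=> //.
apply: IH; first exact: part_gt0.
  move=> p pp pm; have := hm p pp (dvdn_trans pm (dvdn_part _ _)); rewrite ltnS leq_eqVlt => /orP[/eqP e|//].
  have : coprime N m`_N^' by rewrite -{1}(part_pnat_id (pnat_id pN)) coprime_partC.
  by rewrite e in pm; rewrite prime_coprime// pm.
move=> p; apply: leq_ltn_trans (hM p); case: (boolP (prime p)) => [pp|np].
  by apply: dvdn_leq_log => //; apply: dvdn_part.
by rewrite lognE (negbTE np).
Qed.

End SmoothNumbers.

Section EulerProduct.
Variables (R : realType) (h : nat -> R).
Hypothesis h1 : h 1%N = 1.
Hypothesis hM : forall m n, (0 < m)%N -> (0 < n)%N -> coprime m n -> h (m * n)%N = h m * h n.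

Lemma smooth_sum (N M : nat) :
  \sum_(m <- smooth N M) h m = \prod_(p < N | prime p) \sum_(0 <= i < M) h (p ^ i)%N.
Proof.
elim: N => [|N IH] /=; first by rewrite big_seq1 big_ord0.
rewrite [RHS]big_mkcond big_ord_recr -big_mkcond /= -IH; case: ifP => pN; last by rewrite mulr1.
rewrite big_allpairs_dep /= [RHS]mulrC big_distrlr /= /index_iota subn0; apply: eq_bigr => i _.
apply: eq_big_seq => m hm; rewrite hM ?expn_gt0 ?(prime_gt0 pN)//.
  by case: (smooth_primes hm).
exact: smooth_coprime hm.
Qed.
End EulerProduct.

Section EulerProductLimit.
Variables (R : realType) (h : nat -> R) (B : R).
Hypothesis h1 : h 1%N = 1.
Hypothesis hM : forall m n, (0 < m)%N -> (0 < n)%N -> coprime m n -> h (m * n)%N = h m * h n.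
Hypothesis hB : forall N M, \sum_(p < N | prime p) \sum_(1 <= i < M) `|h (p ^ i)%N| <= B.

(** Every n <= X occurs among the smooth numbers, so the sum is at most a finite product of factors
    1 + a_p <= exp a_p, where the a_p add up to at most B. *)
Lemma euler_abs_bounded : abs_bounded (fun n => h n.+1) (expR B).
Proof.
move=> X; pose g n := `|h n|.
have -> : \sum_(0 <= n < X) `|h n.+1| = \sum_(m <- index_iota 1 X.+1) g m by rewrite big_add1.
have gM m n : (0 < m)%N -> (0 < n)%N -> coprime m n -> g (m * n)%N = g m * g n.
  by move=> m0 n0 co; rewrite /g hM// normrM.
apply: (@le_trans _ _ (\sum_(m <- smooth X.+1 X.+1) g m)).
  rewrite [leRHS](bigID (mem (index_iota 1 X.+1))) /=.
  rewrite -[X in _ <= X + _]big_filter.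
  have -> : \sum_(i <- [seq i <- smooth X.+1 X.+1 | i \in index_iota 1 X.+1]) g i = \sum_(m <- index_iota 1 X.+1) g m.
    apply: perm_big; apply: uniq_perm; rewrite ?filter_uniq ?smooth_uniq ?iota_uniq// => m.
    rewrite mem_filter; apply: andb_idr; rewrite mem_index_iota => /andP[m0 mX].
    apply: mem_smooth => // [p pp pm|p]; first by apply: leq_ltn_trans mX; apply: dvdn_leq.
    by apply: leq_trans mX; rewrite ltnS; apply: logn_leq.
  by rewrite lerDl sumr_ge0// => i _; apply: normr_ge0.
rewrite (smooth_sum _ gM); last by rewrite /g h1 normr1.
apply: (@le_trans _ _ (\prod_(p < X.+1 | prime p) expR (\sum_(1 <= i < X.+1) g (p ^ i)%N))).
  apply: ler_prod => p pp; rewrite sumr_ge0/=; last by move=> i _; apply: normr_ge0.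
  by rewrite big_ltn// expn0 {1}/g h1 normr1 expR_ge1Dx.
by rewrite -expR_sum ler_expR hB.
Qed.

Definition local_factor (p : nat) : R := limn (series (fun i => h (p ^ i)%N)).

Lemma local_bounded p : prime p -> abs_bounded (fun i => h (p ^ i)%N) (1 + B).
Proof.
move=> pp [|M]; have := hB p.+1; rewrite /= => hp.
  rewrite big_geq// addr_ge0//; apply: le_trans (hp 0%N).
  by rewrite sumr_ge0// => q _; rewrite sumr_ge0.
rewrite big_ltn// expn0 h1 normr1 lerD2l; apply: le_trans (hp M.+1).
rewrite [leRHS](bigD1 ord_max)//= lerDl.
by rewrite sumr_ge0// => q _; rewrite sumr_ge0.
Qed.

Lemma local_cvg p : prime p -> series (fun i => h (p ^ i)%N) @ \oo --> local_factor p.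
Proof. by move=> pp; apply: abs_bounded_cvg (local_bounded pp). Qed.

(** With exponents cut at M, the product is the sum of h over smooth numbers. For N, M > K these
    include 1, ..., K, so it differs from the full sum by tails only. For fixed N, M goes to
    infinity first. *)
Lemma euler_product :
  (fun N => \prod_(p < N | prime p) local_factor p) @ \oo --> limn (series (fun n => h n.+1)).
Proof.
have ca := euler_abs_bounded.
apply/cvgrPdist_le => e e0; have e2 : 0 < e / 2 by rewrite divr_gt0.
have [N0 hN0] := abs_bounded_tail ca e2.
have /cvgrPdist_le /(_ _ e2) [N1 _ hN1] := abs_bounded_cvg ca.
pose K := maxn N0 N1.
near=> N.
have KN : (K < N)%N by near: N; exists K.+1.
have cN : (fun M => \prod_(p < N | prime p) series (fun i => h (p ^ i)%N) M) @ \oo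
     --> \prod_(p < N | prime p) local_factor p.
  by apply: cvg_big => [|p pp]; [exact: mul_continuous|exact: local_cvg].
set S := limn _.
have cS : (fun M => S - \prod_(p < N | prime p) series (fun i => h (p ^ i)%N) M) @ \oo
     --> S - \prod_(p < N | prime p) local_factor p by apply: cvgB cN; exact: cvg_cst.
have cn : (fun M => `|S - \prod_(p < N | prime p) series (fun i => h (p ^ i)%N) M|) @ \oo
     --> `|S - \prod_(p < N | prime p) local_factor p| by apply: cvg_norm.
rewrite -(cvg_lim _ cn)//; apply: limr_le; first by apply/cvgP: cn.
near=> M.
have KM : (K < M)%N by near: M; exists K.+1.
rewrite /series /= -smooth_sum//.
rewrite (bigID (mem (index_iota 1 K.+1))) /= -big_filter.
have -> : \sum_(i <- [seq i <- smooth N M | i \in index_iota 1 K.+1]) h i = series (fun n => h n.+1) K.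
  rewrite /series /=; have -> : \sum_(0 <= n < K) h n.+1 = \sum_(m <- index_iota 1 K.+1) h m by rewrite big_add1.
  apply: perm_big; apply: uniq_perm; rewrite ?filter_uniq ?smooth_uniq ?iota_uniq// => m.
  rewrite mem_filter; apply: andb_idr; rewrite mem_index_iota => /andP[m0 mK].
  apply: mem_smooth => // [p pp pm|p].
    by apply: leq_trans KN; apply: leq_trans mK; rewrite ltnS; apply: dvdn_leq.
  by apply: leq_trans KM; apply: leq_trans mK; rewrite ltnS; apply: logn_leq.
rewrite opprD addrA; apply: (le_trans (ler_normB _ _)).
rewrite [leRHS](splitr e) lerD//; first by apply: hN1; rewrite /= leq_maxr.
apply: (le_trans (ler_norm_sum _ _ _)).
(* The remaining smooth numbers are distinct and exceed K >= N0, so they are compared with the whole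
   range from N0 to their maximum. *)
pose L := (\max_(m <- smooth N M) m).
apply: le_trans (hN0 L).
rewrite -big_filter.
have -> : \sum_(N0 <= n < L) `|h n.+1| = \sum_(N0.+1 <= n < L.+1) `|h n| by rewrite big_add1.
set s := [seq _ <- _ | _].
have hs : perm_eq s [seq m <- index_iota N0.+1 L.+1 | m \in s].
  apply: uniq_perm; rewrite ?filter_uniq ?smooth_uniq ?iota_uniq// => m.
  rewrite [RHS]mem_filter; apply/esym/andb_idr; rewrite mem_filter mem_index_iota => /andP[hm ms].
  have [m0 _] := smooth_primes ms.
  have mL : (m <= L)%N by rewrite /L (big_rem m ms) /= leq_max leqnn.
  rewrite ltnS mL andbT.
  by move: hm; rewrite mem_index_iota m0 /= -leqNgt => Km; apply: leq_ltn_trans Km; rewrite leq_maxl.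
rewrite (perm_big _ hs) big_filter [leRHS](bigID (mem s)) /= lerDl.
by rewrite sumr_ge0.
Unshelve. all: by end_near. Qed.

End EulerProductLimit.

Section EulerPositivity.
Variables (R : realType) (h : nat -> R) (B : R).
Hypothesis h1 : h 1%N = 1.
Hypothesis hM : forall m n, (0 < m)%N -> (0 < n)%N -> coprime m n -> h (m * n)%N = h m * h n.
Hypothesis hB : forall N M, \sum_(p < N | prime p) \sum_(1 <= i < M) `|h (p ^ i)%N| <= B.

(** The upper bound is carried along because the induction step for the lower one uses it. *)
Lemma prodr_1B_ge (I : Type) (r : seq I) (P : pred I) (x : I -> R) :
  (forall i, P i -> 0 <= x i <= 1) ->
  1 - \sum_(i <- r | P i) x i <= \prod_(i <- r | P i) (1 - x i) <= 1.
Proof.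
move=> hx; elim: r => [|i r IH]; first by rewrite !big_nil subr0 lexx.
rewrite !big_cons; case: ifP => // Pi.
have /andP[x0 x1] := hx i Pi; have /andP[h2 h3] := IH.
have s0 : 0 <= \sum_(j <- r | P j) x j by rewrite sumr_ge0// => j /hx /andP[].
have p0 : 0 <= \prod_(j <- r | P j) (1 - x j) by rewrite prodr_ge0// => j /hx /andP[_]; rewrite subr_ge0.
apply/andP; split; nra.
Qed.

Lemma local_factor_dist N : \sum_(p < N | prime p) `|local_factor h p - 1| <= B.
Proof.
have c : (fun M => \sum_(p < N | prime p) `|series (fun i => h (p ^ i)%N) M - 1|) @ \oo
   --> \sum_(p < N | prime p) `|local_factor h p - 1|.
  apply: cvg_big => [|p pp]; first exact: add_continuous.
  by apply: cvg_norm; apply: cvgB; [exact: (local_cvg h1 hB pp)|exact: cvg_cst].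
rewrite -(cvg_lim _ c)//; apply: limr_le; first by apply/cvgP: c.
near=> M; apply: le_trans (hB N M).
apply: ler_sum => p pp.
have M0 : (0 < M)%N by near: M; exists 1%N.
rewrite /series /= big_ltn// expn0 h1 addrC addKr; exact: ler_norm_sum.
Unshelve. all: by end_near. Qed.

(** From some N0 on, the distances of the factors from 1 add up to at most 1/2, so the later factors
    multiply to at least 1/2; the finitely many earlier ones give a positive constant. *)
Lemma euler_product_gt0 : (forall p, prime p -> 0 < local_factor h p) ->
  0 < limn (series (fun n => h n.+1)).
Proof.
move=> pos.
pose b p : R := if prime p then `|local_factor h p - 1| else 0.
have bB : abs_bounded b B.
  move=> N; apply: le_trans (local_factor_dist N).
  rewrite big_mkord [leRHS]big_mkcond; apply: ler_sum => p _; rewrite /b.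
  by case: ifP; rewrite ?normr0// normr_id.
have h20 : 0 < 2^-1 :> R by rewrite invr_gt0.
have [N0 hN0] := abs_bounded_tail bB h20.
have bge p : 0 <= b p by rewrite /b; case: ifP.
have b1 p : (N0 <= p)%N -> b p <= 2^-1.
  by move=> hp; have := hN0 p.+1; rewrite big_nat_recr//= ger0_norm//; apply: le_trans; rewrite lerDr sumr_ge0.
pose c := \prod_(0 <= p < N0 | prime p) local_factor h p.
have c0 : 0 < c by apply: prodr_gt0.
have ce := euler_product h1 hM hB.
apply: (@lt_le_trans _ _ (c / 2)); first by rewrite divr_gt0.
rewrite -(cvg_lim _ ce)//; apply: limr_ge; first by apply/cvgP: ce.
near=> N; have NN : (N0 <= N)%N by near: N; exists N0.
rewrite -(big_mkord prime (local_factor h)) (big_cat_nat (n := N0))//= -/c ler_wpM2l ?(ltW c0)//.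
rewrite big_nat_cond.
have hx p : (N0 <= p < N)%N && prime p -> 0 <= b p <= 1.
  by move=> /andP[/andP[hp _] _]; rewrite bge/=; apply: le_trans (b1 p hp) _; rewrite invf_le1// ler1n.
have /andP[hw _] := prodr_1B_ge (index_iota N0 N) hx.
apply: (@le_trans _ _ (1 - \sum_(N0 <= p < N | (N0 <= p < N)%N && prime p) b p)).
  rewrite lerBrDl -lerBrDr.
  have -> : 1 - 2^-1 = 2^-1 :> R by lra.
  apply: le_trans (hN0 N); rewrite -big_nat_cond big_mkcond; apply: ler_sum => p _.
  by rewrite [X in _ <= X]ger0_norm//; case: ifP.
apply: (le_trans hw).
apply: ler_prod => p /andP[/andP[hp _] pp]; apply/andP; split.
  by rewrite subr_ge0; apply: le_trans (b1 p hp) _; rewrite invf_le1// ler1n.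
rewrite /b pp lerBlDr -lerBlDl distrC; exact: ler_norm.
Unshelve. all: by end_near. Qed.

End EulerPositivity.

Lemma powR_exprn (R : realType) (x s : R) (i : nat) : 0 <= x -> (x ^+ i) `^ s = (x `^ s) ^+ i.
Proof. by move=> x0; rewrite -!powR_mulrn ?powR_ge0// -!powRrM mulrC. Qed.

(** The first surviving term at p has order p^(-js), and js > 1 makes these summable. Later terms
    decay geometrically with ratio q p^(-s), bounded below 1 for all p because q < 2^s. *)
Lemma multf_local_bound (R : realType) (c : nat -> R) (j : nat) (s q K : R) :
  c 0%N = 1 -> (forall v, (0 < v < j)%N -> c v = 0) -> (forall v, `|c v| <= K * q ^+ v) ->
  0 < q -> q < 2 `^ s -> 1 < j%:R * s -> 0 < s ->
  exists B, forall N M, \sum_(p < N | prime p) \sum_(1 <= i < M)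
     `|multf c (p ^ i) * (p ^ i)%:R `^ (- s)| <= B.
Proof.
move=> c0 cj cK q0 qs js s0.
have K0 : 0 <= K by have := cK 0%N; rewrite c0 normr1 expr0 mulr1; apply: le_trans.
pose rho := q * 2 `^ (- s).
have r0 : 0 <= rho by rewrite mulr_ge0 ?powR_ge0// ltW.
have r1 : rho < 1 by rewrite /rho powRN ltr_pdivrMr ?powR_gt0// mul1r.
have d0 : 0 < 1 - rho by rewrite subr_gt0.
have [P hP] := pseries_bound js.
exists (K * q ^+ j / (1 - rho) * P) => N M.
have inner p : prime p -> \sum_(1 <= i < M) `|multf c (p ^ i) * (p ^ i)%:R `^ (- s)|
    <= K * q ^+ j / (1 - rho) * p%:R `^ (- (j%:R * s)).
  move=> pp; pose y := q * p%:R `^ (- s).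
  have p0 : 0 < p%:R :> R by rewrite ltr0n prime_gt0.
  have y0 : 0 <= y by rewrite mulr_ge0 ?powR_ge0// ltW.
  have yr : y <= rho.
    rewrite /y /rho ler_wpM2l ?(ltW q0)// !powRN lef_pV2 ?posrE ?powR_gt0//.
    by apply: ge0_ler_powR; rewrite ?nnegrE ?(ltW s0)// ler_nat prime_gt1.
  have yX i : (q ^+ i) * (p ^ i)%:R `^ (- s) = y ^+ i.
    by rewrite /y exprMn natrX powR_exprn// ltW.
  apply: (@le_trans _ _ (\sum_(j <= i < M) K * y ^+ i)).
    have [jM|Mj] := leqP j M; last first.
      rewrite [leRHS]big_geq ?(ltnW Mj)// big1_seq// => i /andP[_]; rewrite mem_index_iota => /andP[i0 iM].
      by rewrite multf_pX// cj ?mul0r ?normr0// i0 (ltn_trans iM).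
    have j0 : (0 < j)%N by case: (j) js => //; rewrite mul0r ltr10.
    rewrite (big_cat_nat (n := j))//= big1_seq ?add0r; last first.
      move=> i /andP[_]; rewrite mem_index_iota => /andP[i0 iM].
      by rewrite multf_pX// cj ?mul0r ?normr0// i0.
    apply: ler_sum_nat => i _; rewrite multf_pX// normrM [X in _ * X]ger0_norm ?powR_ge0//.
    by rewrite -yX mulrA ler_wpM2r ?powR_ge0.
  rewrite -mulr_sumr -!mulrA ler_wpM2l//.
  have -> : q ^+ j * ((1 - rho)^-1 * p%:R `^ (- (j%:R * s))) = y ^+ j * (1 - rho)^-1.
    have -> : p%:R `^ (- (j%:R * s)) = (p ^ j)%:R `^ (- s).
      by rewrite natrX -powR_mulrn ?ltW// -powRrM mulrN.
    by rewrite -yX -mulrA [(1 - rho)^-1 * _]mulrC.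
  apply: (@le_trans _ _ (y ^+ j * \sum_(0 <= i < M) y ^+ i)).
    have [jM|Mj] := leqP j M; last first.
      by rewrite big_geq ?(ltnW Mj)// mulr_ge0 ?exprn_ge0// sumr_ge0// => i _; rewrite exprn_ge0.
    rewrite mulr_sumr -[X in index_iota X M]add0n big_addn.
    rewrite [leRHS](big_cat_nat (n := (M - j)%N)) ?leq_subr//=.
    rewrite -[leLHS]addr0 lerD//.
      by apply: ler_sum_nat => i _; rewrite exprD mulrC.
    by rewrite sumr_ge0// => i _; rewrite mulr_ge0 ?exprn_ge0.
  rewrite ler_wpM2l ?exprn_ge0//.
  apply: (@le_trans _ _ (1 - y)^-1); first by apply: geometric_sum_le; rewrite y0/=; apply: le_lt_trans r1.
  by rewrite lef_pV2 ?posrE ?subr_gt0// ?lerB//; apply: le_lt_trans r1.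
apply: (@le_trans _ _ (\sum_(p < N | prime p) K * q ^+ j / (1 - rho) * p%:R `^ (- (j%:R * s)))).
  by apply: ler_sum => p; exact: inner.
rewrite -mulr_sumr ler_wpM2l ?divr_ge0 ?mulr_ge0 ?exprn_ge0 ?(ltW d0) ?(ltW q0)//.
apply: le_trans (hP N).
have -> : \sum_(0 <= n < N) `|n.+1%:R `^ (- (j%:R * s))| = \sum_(1 <= n < N.+1) n%:R `^ (- (j%:R * s)) :> R.
  by rewrite big_add1 /=; apply: eq_bigr => n _; rewrite ger0_norm// powR_ge0.
rewrite -(big_mkord prime (fun p => p%:R `^ (- (j%:R * s)))).
case: N => [|N]; first by rewrite !big_geq.
rewrite big_ltn_cond//= [leRHS]big_nat_recr//= big_mkcond.
apply: (@le_trans _ _ (\sum_(1 <= p < N.+1) p%:R `^ (- (j%:R * s)))).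
  by apply: ler_sum => p _; case: ifP => // _; rewrite powR_ge0.
by rewrite lerDl powR_ge0.
Qed.

(** * The local coefficients of a(n)^r and their Dirichlet quotients *)

Section LocalCoefficients.
Variables (R : realType) (r : nat).

Definition partition_pow (v : nat) : R := (num_partitions v)%:R ^+ r.

(* The local coefficients of (1 - t) (1 - t^2)^k sum_v P(v)^r t^v. *)
Definition quotient_coef (k : nat) : nat -> R := iter k (ldiff 2) (ldiff 1 partition_pow).

Lemma quotient_coef012 k : [/\ quotient_coef k 0 = 1, quotient_coef k 1 = 0
  & quotient_coef k 2 = 2 ^+ r - 1 - k%:R].
Proof.
elim: k => [|k [h0 h1 h2]].
  rewrite /quotient_coef /= /ldiff /partition_pow /= num_partitions0 num_partitions1 num_partitions2.
  by rewrite expr1n subrr !subr0.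
rewrite /quotient_coef iterS -/(quotient_coef k) /ldiff /= subnn h0 h1 h2 !subr0; split => //.
by rewrite -[k.+1%:R]natr1 opprD addrA.
Qed.

Lemma partition_pow_bound (q : R) : 1 < q -> exists K, forall v, `|partition_pow v| <= K * q ^+ v.
Proof.
move=> q1; have q0 : 0 < q by apply: lt_trans q1.
case: (posnP r) => [r0|r0].
  by exists 1 => v; rewrite /partition_pow r0 expr0 normr1 mul1r exprn_ege1// ltW.
(* With t^r = q, the bound P(v) <= C t^v yields P(v)^r <= C^r q^v. *)
pose t := q `^ (r%:R^-1).
have t1 : 1 < t by rewrite -(powRr0 q); apply: gt1_ltr_powR => //; rewrite invr_gt0 ltr0n.
have tr : t ^+ r = q by rewrite -powR_mulrn ?powR_ge0// -powRrM mulVf ?powRr1 ?(ltW q0)// pnatr_eq0 gtn_eqF.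
have [C hC] := num_partitions_bound t1.
exists (C ^+ r) => v; rewrite /partition_pow ger0_norm ?exprn_ge0//.
rewrite -tr -exprM mulnC exprM -exprMn lerXn2r ?nnegrE//.
by apply: le_trans (hC v).
Qed.

Lemma quotient_coef_bound k (q : R) : 1 < q -> exists K, forall v, `|quotient_coef k v| <= K * q ^+ v.
Proof.
move=> q1; have q0 : 0 < q by apply: lt_trans q1.
have step j c : (exists K, forall v, `|c v| <= K * q ^+ v) -> exists K, forall v, `|ldiff j c v : R| <= K * q ^+ v.
  move=> [K hK]; exists (2 * K) => v; rewrite /ldiff; apply: (le_trans (ler_normB _ _)).
  have K0 : 0 <= K by have := hK 0%N; rewrite expr0 mulr1; apply: le_trans.
  rewrite mulr2n !mulrDl !mul1r lerD//; case: ifP => _; last by rewrite normr0 mulr_ge0 ?exprn_ge0// ltW.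
  by apply: (le_trans (hK _)); rewrite ler_wpM2l// ler_weXn2l ?(ltW q1)// leq_subr.
elim: k => [|k]; last by exact: step.
by apply: step; exact: partition_pow_bound.
Qed.

Lemma quotient_coefK k : iter k (lconv 2) (quotient_coef k) =1 ldiff 1 partition_pow.
Proof.
elim: k => // k IH v.
have -> : iter k.+1 (lconv 2) (quotient_coef k.+1) = iter k (lconv 2) (quotient_coef k); last exact: IH.
rewrite iterSr; congr (iter k _ _); apply/funext => w.
exact: lconvK.
Qed.

Lemma num_abelian_multf n : (0 < n)%N -> (num_abelian n ^ r)%N%:R = multf partition_pow n.
Proof.
by move=> n0; rewrite num_abelianE// natrX natr_prod -prodrXl.
Qed.

Lemma summatory_multf_iter k (c : nat -> R) X : c 0%N = 1 ->
  summatory (multf (iter k (lconv 2) c)) X = iter k (dilation_sum 2) (summatory (multf c)) X.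
Proof.
move=> c0; elim: k X => // k IH X.
have i0 : iter k (lconv 2) c 0%N = 1.
  by elim: k {IH} => //= k IH; rewrite lconv_rec//= addr0.
rewrite /= -(eq_dilation_sum 2 X IH) -summatory_powdiv//.
by apply: eq_big_nat => n /andP[n0 _]; rewrite -multf_lconv.
Qed.

Lemma iter_dilation_dirichlet (f : nat -> R) js X : all (leq 1) js ->
  foldr (@dilation_sum R) (summatory f) js X = dirichlet f (iter_dilation R js) X.
Proof.
have F0 js' : iter_dilation R js' 0 = 0 by case: js' => //= j js'; rewrite /dilation_sum big_geq.
elim: js X => [|j js IH] X /=.
  move=> _; apply: eq_big_nat => m /andP[m0 mX]; rewrite ltnS in mX.
  by rewrite /iter_dilation /= divn_gt0// mX mulr1.
by move=> /andP[j0 hjs]; rewrite (eq_dilation_sum j X (fun Y => IH Y hjs)) dilation_dirichlet.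
Qed.

(** Valid for every k: the value 2^r - 1 serves the asymptotics, and k = 0, division by zeta(s)
    alone, serves the mean value. *)
Lemma abelian_dirichlet k X :
  (\sum_(1 <= n < X.+1) num_abelian n ^ r)%N%:R =
  dirichlet (multf (quotient_coef k)) (iter_dilation R (1%N :: nseq k 2%N)) X.
Proof.
have [c0 _ _] := quotient_coef012 k.
have l0 : ldiff 1 partition_pow 0 = 1 by case: (quotient_coef012 0).
rewrite -iter_dilation_dirichlet; last first.
  by apply/allP => j; rewrite inE mem_nseq => /orP[/eqP ->|/andP[_ /eqP ->]].
have -> : (\sum_(1 <= n < X.+1) num_abelian n ^ r)%N%:R = summatory (multf partition_pow) X.
  by rewrite natr_sum; apply: eq_big_nat => n /andP[n0 _]; rewrite num_abelian_multf.
have e1 : forall n, (0 < n)%N -> multf partition_pow n = powdiv_sum 1 (multf (ldiff 1 partition_pow)) n.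
  by move=> n n0; rewrite -multf_lconv//; apply: eq_bigr => p _; rewrite lconvK.
transitivity (summatory (powdiv_sum 1 (multf (ldiff 1 partition_pow))) X).
  by apply: eq_big_nat => n /andP[n0 _]; exact: e1.
rewrite summatory_powdiv//=; apply: eq_dilation_sum => Y.
have fold_iter (F : nat -> R) i : foldr (@dilation_sum R) F (nseq i 2%N) = iter i (dilation_sum 2) F.
  by elim: i => //= i ->.
rewrite fold_iter -summatory_multf_iter//.
by apply: eq_bigr => n _; apply: eq_bigr => p _; rewrite quotient_coefK.
Qed.

Lemma abelian_dirichlet1 X :
  (\sum_(1 <= n < X.+1) num_abelian n ^ r)%N%:R =
  \sum_(1 <= m < X.+1) multf (ldiff 1 partition_pow) m * (X %/ m)%:R.
Proof.
rewrite (abelian_dirichlet 0); apply: eq_bigr => m _; congr (_ * _).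
rewrite /iter_dilation /= /dilation_sum.
transitivity (\sum_(1 <= d < (X %/ m).+1) (1 : R)); last by rewrite sumr_const_nat subn1.
by apply: eq_big_nat => d /andP[d0 dX]; rewrite ltnS in dX; rewrite expn1 divn_gt0// dX.
Qed.

Lemma ldiff_series j (c : nat -> R) (x l : R) :
  series (fun i => c i * x ^+ i) @ \oo --> l ->
  series (fun i => ldiff j c i * x ^+ i) @ \oo --> (1 - x ^+ j) * l.
Proof.
move=> h.
have h2 := @series_shift R _ _ j h.
have h3 : (fun n => series (fun i => c i * x ^+ i) n - x ^+ j *
    series (fun k => if (k < j)%N then 0 else c (k - j)%N * x ^+ (k - j)) n) @ \oo --> l - x ^+ j * l.
  by apply: cvgB h _; apply: cvgMr; exact: h2.
rewrite mulrBl mul1r.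
rewrite (_ : series _ = fun n => series (fun i => c i * x ^+ i) n - x ^+ j *
    series (fun k => if (k < j)%N then 0 else c (k - j)%N * x ^+ (k - j)) n); first exact: h3.
apply/funext => n; rewrite /series /= mulr_sumr -sumrB; apply: eq_bigr => i _.
rewrite /ldiff; case: ltnP => ij; first by rewrite subr0 mulr0 subr0.
by rewrite mulrCA -exprD subnKC// mulrBl.
Qed.

Lemma partition_series_cvg (x : R) : 0 < x -> x < 1 ->
  exists2 l : R, 0 < l & series (fun i => partition_pow i * x ^+ i) @ \oo --> l.
Proof.
(* The midpoint of 1 and 1/x, so that q > 1 while q x < 1. *)
move=> x0 x1; pose q := (1 + x^-1) / 2.
have xi : 1 < x^-1 by rewrite invf_gt1.
have q1 : 1 < q by rewrite /q; lra.
have qx : q * x < 1 by rewrite /q mulrAC mulrDl mul1r mulVf ?gt_eqF//; lra.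
have qx0 : 0 <= q * x by rewrite mulr_ge0 ?(ltW x0)//; lra.
have [K hK] := partition_pow_bound q1.
have K0 : 0 <= K by have := hK 0%N; rewrite expr0 mulr1; apply: le_trans.
have hb : abs_bounded (fun i => partition_pow i * x ^+ i) (K * (1 - q * x)^-1).
  move=> N; apply: (@le_trans _ _ (\sum_(0 <= i < N) K * (q * x) ^+ i)).
    apply: ler_sum => i _; rewrite normrM [X in _ * X]ger0_norm ?exprn_ge0 ?(ltW x0)//.
    by rewrite exprMn mulrA ler_wpM2r ?exprn_ge0 ?(ltW x0).
  by rewrite -mulr_sumr ler_wpM2l// geometric_sum_le// qx0.
have c := abs_bounded_cvg hb.
exists (limn (series (fun i => partition_pow i * x ^+ i))) => //.
apply: (@lt_le_trans _ _ 1) => //; apply: limr_ge; first exact: c.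
near=> n; have n0 : (0 < n)%N by near: n; exists 1%N.
rewrite /series /= big_ltn// /partition_pow num_partitions0 expr1n expr0 mulr1 lerDl.
by rewrite sumr_ge0// => i _; rewrite mulr_ge0 ?exprn_ge0// ltW.
Unshelve. all: by end_near. Qed.

(** Single coefficients may be negative; the sum is positive because it factors as (1 - x)(1 -
    x^2)^k times a series of nonnegative terms starting with 1. *)
Lemma quotient_series_cvg k (x : R) : 0 < x -> x < 1 ->
  exists2 l : R, 0 < l & series (fun i => quotient_coef k i * x ^+ i) @ \oo --> l.
Proof.
move=> x0 x1; have h j : (0 < j)%N -> 0 < 1 - x ^+ j.
  by move=> j0; rewrite subr_gt0 exprn_ilt1 ?(ltW x0)//; lia.
elim: k => [|k [l l0 hl]].
  have [l l0 hl] := partition_series_cvg x0 x1.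
  by exists ((1 - x ^+ 1) * l); [rewrite mulr_gt0// h|exact: ldiff_series].
by exists ((1 - x ^+ 2) * l); [rewrite mulr_gt0// h|exact: ldiff_series].
Qed.

Section QuotientSeries.
Variables (k j : nat) (s : R).
Hypothesis coef0 : forall v, (0 < v < j)%N -> quotient_coef k v = 0.
Hypothesis s0 : 0 < s.
Hypothesis js : 1 < j%:R * s.

(** Used with k = 0, j = 2, s = 1 for the mean value, and with k = 2^r - 1, j = 3 and s either sigma
    or 1/2 for the asymptotics. *)
Definition quotient_term (n : nat) : R := multf (quotient_coef k) n * n%:R `^ (- s).

Lemma quotient_term1 : quotient_term 1 = 1.
Proof. by rewrite /quotient_term multf1 powR1 mulr1. Qed.

Lemma quotient_termM m n : (0 < m)%N -> (0 < n)%N -> coprime m n ->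
  quotient_term (m * n) = quotient_term m * quotient_term n.
Proof.
move=> m0 n0 co; have [c0 _ _] := quotient_coef012 k.
by rewrite /quotient_term multfM// natrM powRM// mulrACA.
Qed.

Lemma quotient_term_local : exists B, forall N M,
  \sum_(p < N | prime p) \sum_(1 <= i < M) `|quotient_term (p ^ i)| <= B.
Proof.
have [c0 _ _] := quotient_coef012 k.
(* Any q strictly between 1 and 2^s would do. *)
pose q : R := 2 `^ (s / 2).
have two1 : 1 < 2 :> R by rewrite ltr1n.
have q1 : 1 < q by rewrite /q -[ltLHS](powRr0 2); apply: gt1_ltr_powR => //; rewrite divr_gt0.
have qs : q < 2 `^ s by apply: gt1_ltr_powR => //; rewrite ltr_pdivrMr// ltr_pMr.
have [K hK] := quotient_coef_bound k q1.
exact: (multf_local_bound c0 coef0 hK (lt_trans ltr01 q1) qs js s0).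
Qed.

Lemma quotient_term_bounded : exists B, abs_bounded (fun n => quotient_term n.+1) B.
Proof.
have [B hB] := quotient_term_local; exists (expR B).
exact: (euler_abs_bounded quotient_term1 quotient_termM hB).
Qed.

Lemma quotient_local_series p l : prime p ->
  series (fun i => quotient_coef k i * (p%:R `^ (- s)) ^+ i) @ \oo --> l ->
  local_factor quotient_term p = l.
Proof.
move=> pp h; rewrite /local_factor; apply: cvg_lim => //.
rewrite (_ : (fun i => _) = (fun i => quotient_coef k i * (p%:R `^ (- s)) ^+ i)); first exact: h.
apply/funext => i; have [c0 _ _] := quotient_coef012 k.
by rewrite /quotient_term multf_pX// natrX powR_exprn.
Qed.

Lemma quotient_sum_gt0 : 0 < limn (series (fun n => quotient_term n.+1)).
Proof.
have [B hB] := quotient_term_local.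
apply: (euler_product_gt0 quotient_term1 quotient_termM hB) => p pp.
have p1 : 1 < p%:R :> R by rewrite ltr1n prime_gt1.
have x0 : 0 < p%:R `^ (- s) by rewrite powR_gt0// (lt_trans ltr01).
have x1 : p%:R `^ (- s) < 1 by rewrite -[ltRHS](powRr0 p%:R); apply: gt1_ltr_powR => //; rewrite oppr_lt0.
have [l l0 hl] := quotient_series_cvg k x0 x1.
by rewrite (quotient_local_series pp hl).
Qed.

End QuotientSeries.

(** For k = 0 and s = 1 the local series at p begins with 1 + 0, and its term of index v >= 2 is the
    summand of [euler_factor_psum]. *)
Lemma euler_factor_cvg p : prime p ->
  euler_factor_psum R r p @ \oo --> local_factor (quotient_term 0 1) p - 1.
Proof.
move=> pp.
have p1 : 1 < p%:R :> R by rewrite ltr1n prime_gt1.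
have x0 : 0 < p%:R `^ (- 1) :> R by rewrite powR_gt0// (lt_trans ltr01).
have x1 : p%:R `^ (- 1) < 1 :> R by rewrite -[ltRHS](powRr0 p%:R); apply: gt1_ltr_powR => //; rewrite oppr_lt0.
have [l l0 hl] := quotient_series_cvg 0 x0 x1.
rewrite (quotient_local_series pp hl).
have h : (fun N => series (fun i => quotient_coef 0 i * (p%:R `^ (- 1)) ^+ i) N - 1) @ \oo --> l - 1.
  by apply: cvgB hl _; exact: cvg_cst.
apply: cvg_trans h; apply: near_eq_cvg; near=> N.
have N2 : (2 <= N)%N by near: N; exists 2%N.
have [c0 c1 _] := quotient_coef012 0.
rewrite /series /= -[ldiff 1 partition_pow]/(quotient_coef 0) big_ltn ?(ltnW N2)// big_ltn// c0 c1 expr0 mul0r add0r mulr1 addrC addKr.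
rewrite /euler_factor_psum; apply: eq_big_nat => i /andP[i2 _].
rewrite /quotient_coef /= /ldiff ifT ?(ltnW i2)// subn1 /partition_pow !natrX.
by rewrite powRN powRr1 ?(ltW (lt_trans ltr01 p1))// exprVn.
Unshelve. all: by end_near. Qed.

(** C_r is thus the value at s = 1 of the Dirichlet series of a(n)^r divided by zeta(s). *)
Lemma euler_const_cvg :
  euler_pprod R r @ \oo --> limn (series (fun n => quotient_term 0 1 n.+1)).
Proof.
have [c0 c1 _] := quotient_coef012 0.
have hc v : (0 < v < 2)%N -> quotient_coef 0 v = 0 by case: v => [|[|v]].
have js : 1 < 2%:R * 1 :> R by lra.
have [B hB] := quotient_term_local hc ltr01 js.
have := euler_product (quotient_term1 0 1) (@quotient_termM 0 1) hB.
rewrite (_ : (fun N => _) = euler_pprod R r)//.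
apply/funext => N; rewrite /euler_pprod; apply: eq_bigr => p pp.
by rewrite (cvg_lim _ (euler_factor_cvg pp))// addrC subrK.
Qed.

End LocalCoefficients.

(** * The summatory function of d((1,2,...,2); n) *)

Section SquareDivisorError.
Variable R : realType.

Definition inv_squares (B : nat) : R := \sum_(1 <= d < B.+1) d%:R ^- 2.

Definition zeta2 : R := limn inv_squares.

Lemma inv_squares_gap (B M : nat) : (B <= M)%N ->
  B.+1%:R^-1 - M.+1%:R^-1 <= inv_squares M - inv_squares B /\
  ((0 < B)%N -> inv_squares M - inv_squares B <= B%:R^-1 - M%:R^-1).
Proof.
elim: M => [|M IH]; first by rewrite leqn0 => /eqP ->; rewrite !subrr.
rewrite leq_eqVlt => /orP[/eqP <-|]; first by rewrite !subrr.
rewrite ltnS => BM; have [h1 h2] := IH BM.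
have E : inv_squares M.+1 = inv_squares M + M.+1%:R ^- 2 by rewrite /inv_squares big_nat_recr.
have m0 : 0 < M.+1%:R :> R by rewrite ltr0n.
have m1 : 0 < M.+2%:R :> R by rewrite ltr0n.
have em : M.+2%:R = M.+1%:R + 1 :> R by rewrite -natr1.
split=> [|B0].
  suff : M.+1%:R^-1 - M.+2%:R^-1 <= M.+1%:R ^- 2 :> R by
    rewrite E; move: h1; move: (_.+1%:R^-1) (M.+1%:R^-1) (M.+2%:R^-1) (_ ^- 2) => a b c d; lra.
  rewrite em; move: (M.+1%:R : R) m0 => m m0.
  have -> : m^-1 - (m + 1)^-1 = (m * (m + 1))^-1 by field; rewrite !gt_eqF ?addr_gt0.
  by rewrite lef_pV2 ?posrE ?mulr_gt0 ?exprn_gt0 ?addr_gt0// expr2 ler_pM2l// lerDl.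
have M0 : 0 < M%:R :> R by rewrite ltr0n (leq_trans B0).
suff : M.+1%:R ^- 2 <= M%:R^-1 - M.+1%:R^-1 :> R by
  rewrite E; move: (h2 B0); move: (_%:R^-1) (M%:R^-1) (M.+1%:R^-1) (_ ^- 2) => a b c d; lra.
rewrite -natr1; move: (M%:R : R) M0 => m mp.
have -> : m^-1 - (m + 1)^-1 = (m * (m + 1))^-1 by field; rewrite !gt_eqF ?addr_gt0.
by rewrite lef_pV2 ?posrE ?mulr_gt0 ?exprn_gt0 ?addr_gt0// expr2 ler_pM2r ?addr_gt0// lerDl.
Qed.

Lemma inv_squares_cvg : inv_squares @ \oo --> zeta2.
Proof.
apply: nondecreasing_is_cvgn.
  by move=> a b ab; rewrite /inv_squares [leRHS](big_cat_nat (n := a.+1))//= lerDl sumr_ge0.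
exists 2 => _ [M _ <-]; case: M => [|M]; first by rewrite /inv_squares big_geq.
have [_ /(_ isT)] := @inv_squares_gap 1 M.+1 isT.
rewrite {2}/inv_squares big_nat1 expr1n invr1 => h.
have : 0 <= M.+1%:R^-1 :> R by rewrite invr_ge0.
by move: h; move: (M.+1%:R^-1) => a; lra.
Qed.

Lemma zeta2_gap (B : nat) : B.+1%:R^-1 <= zeta2 - inv_squares B /\
  ((0 < B)%N -> zeta2 - inv_squares B <= B%:R^-1).
Proof.
split=> [|B0].
  have c : (fun M => inv_squares M + M.+1%:R^-1) @ \oo --> zeta2 + 0.
    by apply: cvgD inv_squares_cvg _; exact: cvg_harmonic.
  rewrite addr0 in c; rewrite lerBrDr -(cvg_lim _ c)//; apply: limr_ge; first by apply/cvgP: c.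
  near=> M; have BM : (B <= M)%N by near: M; exists B.
  by have [h _] := inv_squares_gap BM; move: h; move: (_^-1) (_^-1) => a b; lra.
rewrite lerBlDr; apply: limr_le; first by apply/cvgP: inv_squares_cvg.
near=> M; have BM : (B <= M)%N by near: M; exists B.
have [_ /(_ B0) h] := inv_squares_gap BM.
have : 0 <= M%:R^-1 :> R by rewrite invr_ge0.
by move: h; move: (M%:R^-1) (_^-1) => a b; lra.
Unshelve. all: by end_near. Qed.

Lemma zeta2_ge1 : 1 <= zeta2.
Proof. by have [h _] := zeta2_gap 0; move: h; rewrite {1}/inv_squares big_geq// subr0 invr1. Qed.

Lemma harmonic_sum_ge (N : nat) : ln N.+1%:R <= \sum_(1 <= d < N.+1) d%:R^-1 :> R.
Proof.
elim: N => [|N IH]; first by rewrite big_geq// ln1.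
rewrite big_nat_recr//= -lerBlDr; apply: le_trans IH; rewrite lerBlDl -lerBlDr.
have n0 : 0 < N.+1%:R :> R by rewrite ltr0n.
rewrite -ln_div ?posrE ?ltr0n//.
have -> : N.+2%:R / N.+1%:R = 1 + N.+1%:R^-1 :> R.
  by rewrite -[N.+2%:R]natr1 mulrDl mulfV ?gt_eqF// mul1r.
by apply: le_ln1Dx; apply: (@lt_trans _ _ 0); rewrite ?ltrN10 ?invr_gt0.
Qed.

Lemma harmonic_sum_le (N : nat) : (0 < N)%N -> \sum_(1 <= d < N.+1) d%:R^-1 <= 1 + ln N%:R :> R.
Proof.
case: N => // N _; elim: N => [|N IH]; first by rewrite big_nat1 ln1 addr0 invr1.
rewrite big_nat_recr//=; apply: le_trans (lerD IH (lexx _)) _.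
rewrite -addrA lerD2l -lerBrDl.
have n0 : 0 < N.+1%:R :> R by rewrite ltr0n.
have n1 : 0 < N.+2%:R :> R by rewrite ltr0n.
rewrite -lerN2 opprB -ln_div ?posrE//.
have -> : N.+1%:R / N.+2%:R = 1 + - N.+2%:R^-1 :> R.
  by rewrite -[N.+2%:R]natr1; field; rewrite gt_eqF// addr_gt0.
by apply: le_ln1Dx; rewrite ltrN2 invf_lt1// ltr1n.
Qed.

Lemma truncn_div (x : R) (m : nat) : 0 <= x -> (0 < m)%N ->
  Num.truncn (x / m%:R) = (Num.truncn x %/ m)%N.
Proof.
move=> x0 m0; have m0' : 0 < m%:R :> R by rewrite ltr0n.
have /andP[h1 h2] := truncn_itv x0.
apply: truncn_def; apply/andP; split.
  by rewrite ler_pdivlMr//; apply: le_trans h1; rewrite -natrM ler_nat leq_divM.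
rewrite ltr_pdivrMr//; apply: (lt_le_trans h2); rewrite -natrM ler_nat.
by rewrite ltn_ceil.
Qed.

Definition square_count (k : nat) : nat -> R := iter k (dilation_sum 2) (fun X => X%:R).

Lemma square_count0 k : square_count k 0 = 0.
Proof. by case: k => // k; rewrite /square_count iterS dilation_sum0. Qed.

(** The dilation with exponent 1 stands outermost in [iter_dilation]; commuting it inwards makes X
    itself the base of the iteration. *)
Lemma iter_dilationE k X : iter_dilation R (1%N :: nseq k 2%N) X = square_count k X.
Proof.
rewrite /iter_dilation /=.
have F0 i : foldr (@dilation_sum R) (fun X => (0 < X)%N%:R) (nseq i 2%N) 0 = 0.
  by case: i => //= i; rewrite dilation_sum0.
elim: k X => [|k IH] X.
  rewrite /= /dilation_sum /square_count /=.
  transitivity (\sum_(1 <= d < X.+1) (1 : R)); last by rewrite sumr_const_nat subn1.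
  by apply: eq_big_nat => d /andP[d0 dX]; rewrite ltnS in dX; rewrite expn1 divn_gt0// dX.
rewrite /= dilation_comm//; apply: (eq_dilation_sum 2 X (G := square_count k)) => Y.
exact: IH.
Qed.

(* The variable is y = x^(1/2), and square_count k is the summatory function D for
   k exponents equal to 2. *)
Definition square_error (k : nat) (y : R) : R :=
  zeta2 ^+ k * y ^+ 2 - square_count k (Num.truncn (y ^+ 2)).

Lemma square_count_le k X : square_count k X <= zeta2 ^+ k * X%:R.
Proof.
have z0 : 0 <= zeta2 by apply: le_trans zeta2_ge1.
elim: k X => [|k IH] X; first by rewrite expr0 mul1r.
rewrite /square_count iterS -/(square_count k) /dilation_sum.
apply: (@le_trans _ _ (\sum_(1 <= d < X.+1) zeta2 ^+ k * X%:R * d%:R ^- 2)).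
  apply: ler_sum_nat => d /andP[d0 _]; apply: le_trans (IH _) _.
  rewrite -mulrA ler_wpM2l ?exprn_ge0// ler_pdivlMr ?exprn_gt0 ?ltr0n//.
  by rewrite -natrX -natrM ler_nat leq_divM.
rewrite -mulr_sumr exprSr [leRHS]mulrAC ler_wpM2l ?mulr_ge0 ?exprn_ge0//.
have [h _] := zeta2_gap X; rewrite -subr_ge0; apply: le_trans h.
by rewrite invr_ge0.
Qed.

Lemma square_error_ge0 k y : 0 <= y -> 0 <= square_error k y.
Proof.
move=> y0; rewrite subr_ge0; apply: le_trans (square_count_le k _) _.
rewrite ler_wpM2l ?exprn_ge0 ?(le_trans _ zeta2_ge1)//.
by have /andP[] := truncn_itv (exprn_ge0 2 y0).
Qed.

(** Split off one square factor d^2, which replaces y by y/d. The counts with d > y vanish, so the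
    main terms for d <= y fall short of the full one by the tail of zeta(2), the first summand. *)
Lemma square_error_rec k y : 0 <= y ->
  square_error k.+1 y = zeta2 ^+ k * y ^+ 2 * (zeta2 - inv_squares (Num.truncn y))
   + \sum_(1 <= d < (Num.truncn y).+1) square_error k (y / d%:R).
Proof.
move=> y0; set B := Num.truncn y; set X := Num.truncn (y ^+ 2).
have yy0 : 0 <= y ^+ 2 by rewrite exprn_ge0.
have sum_err : \sum_(1 <= d < B.+1) square_error k (y / d%:R)
   = zeta2 ^+ k * y ^+ 2 * inv_squares B - \sum_(1 <= d < B.+1) square_count k (X %/ d ^ 2)%N.
  rewrite /inv_squares mulr_sumr -sumrB; apply: eq_big_nat => d /andP[d0 _].
  rewrite /square_error exprMn exprVn mulrA; congr (_ - square_count k _).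
  by rewrite -natrX truncn_div// expn_gt0 d0.
rewrite sum_err /square_error /square_count iterS -/(square_count k) -/X /dilation_sum.
have -> : \sum_(1 <= d < X.+1) square_count k (X %/ d ^ 2)%N = \sum_(1 <= d < B.+1) square_count k (X %/ d ^ 2)%N.
  have small d : (B < d)%N -> (X %/ d ^ 2 = 0)%N.
    move=> Bd; apply: divn_small; rewrite truncn_lt_nat// natrX.
    have yd : y < d%:R by rewrite -truncn_lt_nat.
    by rewrite ltrXn2r// ?nnegrE.
  have [XB|BX] := leqP X B.
    rewrite [RHS](big_cat_nat (n := X.+1))//= [X in _ + X]big1_seq ?addr0// => d /andP[_].
    by rewrite mem_index_iota => /andP[Xd _]; rewrite divn_small ?square_count0//; nia.
  rewrite [LHS](big_cat_nat (n := B.+1))//=; last exact: ltnW.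
  rewrite [X in _ + X]big1_seq ?addr0// => d /andP[_].
  by rewrite mem_index_iota => /andP[Bd _]; rewrite small ?square_count0.
by rewrite exprS; ring.
Qed.

(** In [square_error_rec] the tail of zeta(2) contributes O(y), and summing the induction hypothesis
    over d gains one logarithm from the harmonic sum. *)
Lemma square_error_le k : exists2 C : R, 0 <= C &
  forall y, 1 <= y -> square_error k.+1 y <= C * y * (1 + ln y) ^+ k.
Proof.
have z1 := zeta2_ge1.
have hB (y : R) : 1 <= y -> [/\ (0 < Num.truncn y)%N, y / 2 <= (Num.truncn y)%:R & (Num.truncn y)%:R <= y].
  move=> y1; have y0 : 0 <= y by apply: le_trans y1.
  have B0 : (0 < Num.truncn y)%N by rewrite truncn_gt0.
  have /andP[h1 h2] := truncn_itv y0; split=> //.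
  have : 1 <= (Num.truncn y)%:R :> R by rewrite ler1n.
  by move: h2; rewrite -natr1; lra.
have first (y : R) j : 1 <= y -> zeta2 ^+ j * y ^+ 2 * (zeta2 - inv_squares (Num.truncn y)) <= 2 * zeta2 ^+ j * y.
  move=> y1; have [B0 h1 h2] := hB y y1.
  have [_ /(_ B0) hz] := zeta2_gap (Num.truncn y).
  have y0 : 0 < y by apply: lt_le_trans y1.
  have hz2 : zeta2 - inv_squares (Num.truncn y) <= 2 / y.
    apply: le_trans hz _; rewrite -[2 / y]invrK lef_pV2 ?posrE ?invr_gt0 ?divr_gt0 ?ltr0n//.
    by rewrite invf_div.
  apply: le_trans (ler_wpM2l _ hz2) _; first by rewrite mulr_ge0 ?exprn_ge0 ?(le_trans _ z1)// ltW.
  move: (zeta2 ^+ j) => a; rewrite (_ : a * y ^+ 2 * (2 / y) = 2 * a * y)//.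
  by field; rewrite gt_eqF.
elim: k => [|k [C C0 IH]].
  (* 2 from the tail of zeta(2), and 1 from at most y fractional parts. *)
  exists 3 => // y y1; rewrite square_error_rec ?(le_trans _ y1)// expr0 mulr1.
  have [B0 h1 h2] := hB y y1; have := first y 0%N y1; rewrite !expr0 mulr1 !mul1r => h.
  have : \sum_(1 <= d < (Num.truncn y).+1) square_error 0 (y / d%:R) <= y.
    apply: le_trans h2; apply: (@le_trans _ _ (\sum_(1 <= d < (Num.truncn y).+1) (1 : R))).
      apply: ler_sum_nat => d _; rewrite /square_error expr0 mul1r /square_count /=.
      have /andP[_ hh] : (Num.truncn ((y / d%:R) ^+ 2))%:R <= (y / d%:R) ^+ 2 < (Num.truncn ((y / d%:R) ^+ 2)).+1%:R.
        by apply: truncn_itv; apply: sqr_ge0.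
      by move: hh; rewrite -natr1; lra.
    by rewrite sumr_const_nat subn1.
  lra.
exists (2 * zeta2 ^+ k.+1 + C) => [|y y1]; first by rewrite addr_ge0// mulr_ge0 ?exprn_ge0 ?(le_trans _ z1).
have y0 : 0 < y by apply: lt_le_trans y1.
have ly : 0 <= ln y by rewrite ln_ge0.
rewrite square_error_rec ?(ltW y0)//; have [B0 h1 h2] := hB y y1.
rewrite mulrDl mulrDl lerD//.
  apply: le_trans (first y k.+1 y1) _; rewrite ler_peMr ?exprn_ege1 ?lerDl//.
  by rewrite !mulr_ge0 ?exprn_ge0 ?(le_trans _ z1)// ltW.
apply: (@le_trans _ _ (\sum_(1 <= d < (Num.truncn y).+1) C * y * (1 + ln y) ^+ k * d%:R^-1)).
  apply: ler_sum_nat => d /andP[d0 dB].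
  have dy : d%:R <= y by apply: le_trans h2; rewrite ler_nat.
  have d1 : 1 <= d%:R :> R by rewrite ler1n.
  have d0' : 0 < d%:R :> R by rewrite ltr0n.
  have yd : 1 <= y / d%:R by rewrite ler_pdivlMr// mul1r.
  apply: le_trans (IH _ yd) _.
  rewrite [C * (y / _)]mulrA -[C * y / _ * _]mulrA [_^-1 * _]mulrC mulrA ler_wpM2r ?invr_ge0// ler_wpM2l ?mulr_ge0 ?(ltW y0)//.
  apply: lerXn2r; rewrite ?nnegrE ?addr_ge0 ?ln_ge0// lerD2l ler_ln ?posrE ?divr_gt0//.
  by rewrite ler_pdivrMr// ler_peMr// ltW.
rewrite -mulr_sumr exprSr mulrA ler_wpM2l ?mulr_ge0 ?exprn_ge0 ?addr_ge0 ?(ltW y0)//.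
apply: le_trans (harmonic_sum_le B0) _; rewrite lerD2l ler_ln ?posrE// ltr0n.
by [].
Qed.

(** All terms of [square_error_rec] are nonnegative, so some may be dropped: the base case keeps
    only the tail of zeta(2), the induction step only the errors at y/d for small d. *)
Lemma square_error_ge k : exists2 c : R, 0 < c &
  forall y, 1 <= y -> c * y * (ln y) ^+ k <= square_error k.+1 y.
Proof.
have z1 := zeta2_ge1; have z0 : 0 <= zeta2 by apply: le_trans z1.
have nn j (y : R) : 1 <= y -> 0 <= \sum_(1 <= d < (Num.truncn y).+1) square_error j (y / d%:R).
  by move=> y1; rewrite sumr_ge0// => d _; rewrite square_error_ge0// divr_ge0// (le_trans _ y1).
elim: k => [|k [c c0 IH]].
  exists 2^-1 => // y y1; have y0 : 0 < y by apply: lt_le_trans y1.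
  rewrite square_error_rec ?(ltW y0)// !expr0 mulr1 mul1r.
  apply: (@le_trans _ _ (y ^+ 2 * (zeta2 - inv_squares (Num.truncn y)))); last by rewrite lerDl nn.
  have [h _] := zeta2_gap (Num.truncn y); apply: le_trans (ler_wpM2l (exprn_ge0 2 (ltW y0)) h).
  have hb : (Num.truncn y).+1%:R <= 2 * y.
    by have /andP[hb _] := truncn_itv (ltW y0); rewrite -natr1; lra.
  rewrite ler_pdivlMr ?ltr0n// mulrC -ler_pdivlMr ?mulr_gt0 ?invr_gt0//.
  rewrite (_ : y ^+ 2 / (2^-1 * y) = 2 * y)//.
  by field; rewrite gt_eqF.
exists (c / (2 ^+ k * 2)) => [|y y1]; first by rewrite divr_gt0 ?mulr_gt0 ?exprn_gt0.
have y0 : 0 < y by apply: lt_le_trans y1.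
have ly : 0 <= ln y by rewrite ln_ge0.
rewrite square_error_rec ?(ltW y0)//.
apply: (@le_trans _ _ (\sum_(1 <= d < (Num.truncn y).+1) square_error k.+1 (y / d%:R))); last first.
  rewrite lerDr; have [h _] := zeta2_gap (Num.truncn y).
  by rewrite !mulr_ge0 ?exprn_ge0 ?(ltW y0)//; apply: le_trans h; rewrite invr_ge0.
(* For d <= w the quotient y/d is at least w, whose logarithm is half of ln y. This costs 2^k in the
   induction hypothesis, and the harmonic sum up to w costs another 2. *)
pose w := Num.sqrt y; have w0 : 0 < w by rewrite sqrtr_gt0.
have ww : w ^+ 2 = y by rewrite sqr_sqrtr ?(ltW y0).
have w1 : 1 <= w by rewrite -[leLHS]sqrtr1 ler_wsqrtr.
have wy : w <= y by rewrite -ww expr2 ler_peMr// ltW.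
have lw : ln y = 2 * ln w by rewrite -ww expr2 lnM ?posrE//; ring.
have tw : (Num.truncn w <= Num.truncn y)%N by apply: le_truncn.
rewrite (big_cat_nat (n := (Num.truncn w).+1))//=.
apply: (@le_trans _ _ (\sum_(1 <= d < (Num.truncn w).+1) square_error k.+1 (y / d%:R))); last first.
  by rewrite lerDl sumr_ge0// => d _; rewrite square_error_ge0// divr_ge0// ltW.
apply: (@le_trans _ _ (\sum_(1 <= d < (Num.truncn w).+1) c * y * (ln w) ^+ k * d%:R^-1)); last first.
  apply: ler_sum_nat => d /andP[d0 dB].
  have d1 : 0 < d%:R :> R by rewrite ltr0n.
  have dw : d%:R <= w by have /andP[hb _] := truncn_itv (ltW w0); apply: le_trans hb; rewrite ler_nat.
  have yd : w <= y / d%:R by rewrite ler_pdivlMr// -ww expr2 ler_pM2l.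
  apply: le_trans (IH _ (le_trans w1 yd)).
  rewrite -[leLHS]mulrA [_ * _^-1]mulrC !mulrA ler_wpM2l ?mulr_ge0 ?invr_ge0 ?(ltW y0) ?(ltW c0)//.
  by apply: lerXn2r; rewrite ?nnegrE ?ln_ge0// ?(le_trans w1)// ler_ln ?posrE// (lt_le_trans w0).
rewrite -mulr_sumr lw exprSr exprMn.
have lw0 : 0 <= ln w by rewrite ln_ge0.
have hs : ln w <= \sum_(1 <= d < (Num.truncn w).+1) d%:R^-1.
  apply: le_trans (harmonic_sum_ge _); rewrite ler_ln ?posrE ?ltr0n//.
  by have /andP[_ /ltW] := truncn_itv (ltW w0).
have -> : c / (2 ^+ k * 2) * y * (2 ^+ k * ln w ^+ k * (2 * ln w)) = c * y * ln w ^+ k * ln w.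
  by field; rewrite expf_neq0.
by rewrite ler_wpM2l// !mulr_ge0 ?exprn_ge0 ?(ltW c0) ?(ltW y0).
Qed.

End SquareDivisorError.

(** * Growth comparisons, and determination of the main terms of D *)

Section PolynomialGrowth.
Variable R : realType.
Implicit Types (P : {poly R}) (s : R).

Lemma poly_growth_le P n : (size P <= n.+1)%N ->
  exists2 C : R, 0 <= C & forall s, 1 <= s -> `|P.[s]| <= C * s ^+ n.
Proof.
move=> hP; exists (\sum_(i < n.+1) `|P`_i|) => [|s s1]; first by rewrite sumr_ge0.
rewrite (horner_coef_wide _ hP) mulr_suml; apply: (le_trans (ler_norm_sum _ _ _)).
apply: ler_sum => i _; rewrite normrM ler_wpM2l// normrX ger0_norm ?(le_trans _ s1)//.
by rewrite ler_weXn2l// -ltnS ltn_ord.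
Qed.

Lemma poly_growth_ge P : P != 0 ->
  exists2 c : R, 0 < c & \forall s \near +oo, c * s ^+ (size P).-1 <= `|P.[s]|.
Proof.
move=> P0; have sP : (size P).-1.+1 = size P by rewrite prednK// size_poly_gt0.
set n := (size P).-1 in sP *; set a := lead_coef P.
have a0 : 0 < `|a| by rewrite normr_gt0 lead_coef_eq0.
pose S := \sum_(i < n) `|P`_i|.
exists (`|a| / 2); first by rewrite divr_gt0.
near=> s.
have s1 : 1 <= s by near: s; exact: nbhs_pinfty_ge.
have s0 : 0 <= s by apply: le_trans s1.
have hs : 2 * S <= `|a| * s.
  rewrite mulrC -ler_pdivrMl// mulrC; near: s; apply: nbhs_pinfty_ge; exact: num_real.
rewrite horner_coef -sP big_ord_recr /= -[P`_n]/(lead_coef P) -/a addrC.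
have -> : a * s ^+ n + \sum_(i < n) P`_i * s ^+ i = a * s ^+ n - (- \sum_(i < n) P`_i * s ^+ i) by rewrite opprK.
apply: le_trans (lerB_dist _ _); rewrite normrN normrM normrX [`|s|]ger0_norm//.
case E : n => [|m].
  by rewrite big_ord0 normr0 subr0 expr0 !mulr1 ler_pdivrMr// ler_peMr// ?ler1n// ltW.
have : `|\sum_(i < n) P`_i * s ^+ i| <= S * s ^+ m.
  apply: (le_trans (ler_norm_sum _ _ _)); rewrite mulr_suml; apply: ler_sum => i _.
  rewrite normrM ler_wpM2l// normrX ger0_norm// ler_weXn2l//.
  by rewrite -ltnS -E.
rewrite E => hT.
have : S * s ^+ m <= `|a| / 2 * s ^+ m.+1.
  by rewrite exprS mulrA ler_wpM2r ?exprn_ge0//; move: hs; lra.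
move: hT; move: (`|\sum_(i < _) _|) (S * _) (s ^+ m.+1) => u w v; lra.
Unshelve. all: by end_near. Qed.

Lemma expR_beats (C d : R) (n : nat) : 0 < d -> \forall s \near +oo, C * s ^+ n <= expR (d * s).
Proof.
move=> d0; near=> s.
have s0 : 0 <= s by near: s; exact: nbhs_pinfty_ge.
have ds : 0 <= d * s by rewrite mulr_ge0// ltW.
have f0 : 0 < (n.+1)`!%:R :> R by rewrite ltr0n fact_gt0.
apply: le_trans (_ : (d * s) ^+ n.+1 / (n.+1)`!%:R <= _); last first.
  by apply: le_trans (expR_ge1Dxn n ds); rewrite lerDr.
rewrite ler_pdivlMr// exprMn [s ^+ n.+1]exprS mulrAC mulrA ler_wpM2r ?exprn_ge0//.
by rewrite -ler_pdivrMl ?exprn_gt0.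
Unshelve. all: by end_near. Qed.

Lemma powR_le_exprn (b : R) : exists n : nat, forall s, 1 <= s -> s `^ b <= s ^+ n.
Proof.
exists (Num.truncn `|b|).+1 => s s1; rewrite -powR_mulrn ?(le_trans _ s1)//.
apply: ler_powR => //; apply: le_trans (ler_norm _) _.
by have /andP[_ /ltW] := truncn_itv (normr_ge0 b).
Qed.

Lemma near_pinfty_False : ~ (\forall s \near (+oo : set_system R), False).
Proof. by move=> [M [_ h]]; apply: (h (M + 1)); rewrite ltrDl. Qed.

(** Put x = e^s and divide by e^(s/2). Since a < 1/2, the assumed error eventually drops below 1,
    which leaves |e^(s/2) W(s) - P2(s) - e(s)| <= 1. *)
Lemma compare_polynomials (k : nat) (a b K : R) (P1 P2 : {poly R}) : a < 2^-1 ->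
  (\forall x \near +oo, `|square_count R k.+2 (Num.truncn x)
      - (x * P1.[ln x] + x `^ 2^-1 * P2.[ln x])| <= K * (x `^ a * ln x `^ b)) ->
  P1 = (zeta2 R ^+ k.+2)%:P /\ size P2 = k.+2.
Proof.
move=> a2 hD.
have [C C0 hC] := square_error_le R k.+1.
have [c c0 hc] := square_error_ge R k.+1.
have [n hn] := powR_le_exprn b.
(* The elementary error after division by x^(1/2); [ebound] gives its exact order s^(k+1). *)
pose e (s : R) := square_error k.+2 (expR (s / 2)) / expR (s / 2).
pose W := (zeta2 R ^+ k.+2)%:P - P1.
have main : \forall s \near +oo, `|expR (s / 2) * W.[s] - P2.[s] - e s| <= 1.
  have hD' : \forall s \near +oo, `|square_count R k.+2 (Num.truncn (expR s))
      - (expR s * P1.[s] + expR s `^ 2^-1 * P2.[s])| <= K * (expR s `^ a * s `^ b).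
    have [M [Mr hM]] := hD; near=> s.
    have : M < expR s.
      apply: (@lt_trans _ _ s); first by near: s; exact: nbhs_pinfty_gt.
      by apply: lt_le_trans (expR_ge1Dx s); rewrite ltrDr.
    by move=> /hM; rewrite expRK.
  have d0 : 0 < 2^-1 - a by rewrite subr_gt0.
  have hE := @expR_beats `|K| (2^-1 - a) n d0.
  near=> s.
  have s1 : 1 <= s by near: s; exact: nbhs_pinfty_ge.
  have h1 : `|square_count R k.+2 (Num.truncn (expR s)) - (expR s * P1.[s] + expR s `^ 2^-1 * P2.[s])| <= K * (expR s `^ a * s `^ b) by near: s.
  have h2 : `|K| * s ^+ n <= expR ((2^-1 - a) * s) by near: s.
  set y := expR (s / 2); have y0 : 0 < y by rewrite expR_gt0.
  have yy : expR s = y ^+ 2 by rewrite expr2 -expRD -splitr.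
  have ya : expR s `^ a = expR (a * s) by rewrite /powR gt_eqF ?expR_gt0// expRK.
  have yh : expR s `^ 2^-1 = y by rewrite /powR gt_eqF ?expR_gt0// expRK mulrC.
  have -> : y * W.[s] - P2.[s] - e s = (square_count R k.+2 (Num.truncn (expR s)) - (expR s * P1.[s] + expR s `^ 2^-1 * P2.[s])) / y.
    rewrite yh /e -/y /square_error /W hornerD hornerN hornerC -yy yy.
    by field; rewrite gt_eqF.
  rewrite normrM [`|y^-1|]ger0_norm ?invr_ge0 ?(ltW y0)// ler_pdivrMr// mul1r.
  apply: (le_trans h1); rewrite ya.
  apply: (@le_trans _ _ (`|K| * (expR (a * s) * s ^+ n))).
    apply: (@le_trans _ _ (`|K| * (expR (a * s) * s `^ b))).
      by rewrite ler_wpM2r ?ler_norm// mulr_ge0 ?expR_ge0 ?powR_ge0.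
    by rewrite ler_wpM2l// ler_wpM2l ?expR_ge0// hn.
  rewrite mulrCA; apply: (le_trans (ler_wpM2l (expR_ge0 _) h2)).
  by rewrite -expRD -mulrDl addrC subrK mulrC.
have ebound : \forall s \near +oo, c / 2 ^+ k.+1 * s ^+ k.+1 <= e s <= C * 2 ^+ k.+1 * s ^+ k.+1.
  near=> s.
  have s2 : 2 <= s by near: s; exact: nbhs_pinfty_ge.
  have y1 : 1 <= expR (s / 2) by apply: le_trans (expR_ge1Dx _); rewrite lerDl; lra.
  have y0 : 0 < expR (s / 2) by rewrite expR_gt0.
  have := hc _ y1; have := hC _ y1; rewrite expRK => h1 h2.
  rewrite /e ler_pdivlMr// ler_pdivrMr//; apply/andP; split.
    by apply: le_trans h2; rewrite exprMn exprVn; move: (2 ^- k.+1) (s ^+ k.+1) (expR _) => u v w; lra.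
  apply: (le_trans h1); rewrite mulrAC ler_wpM2r ?(ltW y0)// -mulrA ler_wpM2l// -exprMn.
  by apply: lerXn2r; rewrite ?nnegrE; lra.
(* If W were nonzero, |W(s)| would eventually exceed a positive constant, and e^(s/2) |W(s)| would
   outgrow the polynomial bounds on P2 and e. *)
have W0 : W = 0.
  apply: contrapT => /eqP Wn0; apply: near_pinfty_False.
  have [w w0 hw] := poly_growth_ge Wn0.
  have [C2 C20 hC2] := poly_growth_le (leqnSn (size P2)).
  pose N := (size P2 + k.+1)%N.
  have hE := @expR_beats ((C2 + C * 2 ^+ k.+1 + 2) / w) 2^-1 N.
  near=> s.
  have s1 : 1 <= s by near: s; exact: nbhs_pinfty_ge.
  have s0 : 0 <= s by apply: le_trans s1.
  have h1 : `|expR (s / 2) * W.[s] - P2.[s] - e s| <= 1 by near: s.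
  have /andP[h2 h3] : c / 2 ^+ k.+1 * s ^+ k.+1 <= e s <= C * 2 ^+ k.+1 * s ^+ k.+1 by near: s.
  have h4 : w * s ^+ (size W).-1 <= `|W.[s]| by near: s.
  have h5 : (C2 + C * 2 ^+ k.+1 + 2) / w * s ^+ N <= expR (2^-1 * s) by near: s; apply: hE.
  have h6 := hC2 s s1.
  have sN i : (i <= N)%N -> s ^+ i <= s ^+ N by move=> iN; rewrite ler_weXn2l.
  have e0 : 0 <= e s by apply: le_trans h2; rewrite mulr_ge0 ?divr_ge0 ?exprn_ge0 ?(ltW c0).
  have h7 : expR (s / 2) * `|W.[s]| <= C2 * s ^+ N + C * 2 ^+ k.+1 * s ^+ N + s ^+ N.
    have -> : expR (s / 2) * `|W.[s]| = `|(expR (s / 2) * W.[s] - P2.[s] - e s) + (P2.[s] + e s)|.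
      by rewrite -[X in X * _]ger0_norm ?expR_ge0// -normrM; congr `|_|; ring.
    apply: (le_trans (ler_normD _ _)); rewrite addrC lerD//; last first.
      by apply: (le_trans h1); rewrite exprn_ege1.
    apply: (le_trans (ler_normD _ _)); rewrite lerD//.
      by apply: (le_trans h6); rewrite ler_wpM2l// sN// leq_addr.
    rewrite ger0_norm//; apply: (le_trans h3); rewrite ler_wpM2l ?mulr_ge0 ?exprn_ge0// sN// leq_addl.
    by [].
  have h8 : w <= `|W.[s]| by apply: le_trans h4; rewrite ler_peMr ?exprn_ege1// ltW.
  have h9 : (C2 + C * 2 ^+ k.+1 + 2) * s ^+ N <= expR (s / 2) * `|W.[s]|.
    apply: (@le_trans _ _ (expR (s / 2) * w)); last by rewrite ler_wpM2l ?expR_ge0.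
    by move: h5; rewrite mulrAC ler_pdivrMr// [2^-1 * s]mulrC.
  have sN1 : 1 <= s ^+ N by rewrite exprn_ege1.
  move: (le_trans h9 h7); rewrite !mulrDl; move: (s ^+ N) sN1 (C2 * _) (C * _ * _) => u u1 v z; lra.
have eP1 : P1 = (zeta2 R ^+ k.+2)%:P by apply/eqP; rewrite eq_sym -subr_eq0 -/W W0.
split=> //.
have main2 : \forall s \near +oo, `|P2.[s] + e s| <= 1.
  near=> s; have : `|expR (s / 2) * W.[s] - P2.[s] - e s| <= 1 by near: s.
  by rewrite W0 horner0 mulr0 sub0r -opprD normrN.
(* P2 + e is bounded while e has exact order s^(k+1), so the degree of P2 can be neither smaller nor
   larger than k + 1. *)
have [lt|ge] := ltnP (size P2) k.+2.
  exfalso; apply: near_pinfty_False.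
  have [C2 C20 hC2] := poly_growth_le (lt : (size P2 <= k.+1)%N).
  near=> s.
  have s1 : 1 <= s by near: s; exact: nbhs_pinfty_ge.
  have h1 : `|P2.[s] + e s| <= 1 by near: s.
  have /andP[h2 h3] : c / 2 ^+ k.+1 * s ^+ k.+1 <= e s <= C * 2 ^+ k.+1 * s ^+ k.+1 by near: s.
  have h4 := hC2 s s1.
  have c2 : 0 < c / 2 ^+ k.+1 by rewrite divr_gt0 ?exprn_gt0.
  have sk : 1 <= s ^+ k by rewrite exprn_ege1.
  have h5 : c / 2 ^+ k.+1 * s ^+ k.+1 <= (C2 + 1) * s ^+ k.
    apply: (le_trans h2); rewrite mulrDl mul1r.
    move: h1 h4 sk; rewrite !ler_norml => /andP[? ?] /andP[? ?] ?; lra.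
  have h6 : (C2 + 2) / (c / 2 ^+ k.+1) <= s by near: s; apply: nbhs_pinfty_ge; exact: num_real.
  move: h5 h6 c2; rewrite [s ^+ k.+1]exprS; move: (c / _) => d h5 h6 d0.
  move: h5; rewrite mulrA ler_pM2r ?(lt_le_trans _ sk)//.
  by move: h6; rewrite ler_pdivrMr// mulrC => h6 h7; lra.
apply/eqP; rewrite eqn_leq ge andbT leqNgt; apply/negP => gt.
apply: near_pinfty_False.
have P20 : P2 != 0 by rewrite -size_poly_gt0 (leq_trans _ ge).
have [w w0 hw] := poly_growth_ge P20.
near=> s.
have s1 : 1 <= s by near: s; exact: nbhs_pinfty_ge.
have s0 : 0 <= s by apply: le_trans s1.
have h1 : `|P2.[s] + e s| <= 1 by near: s.
have /andP[h2 h3] : c / 2 ^+ k.+1 * s ^+ k.+1 <= e s <= C * 2 ^+ k.+1 * s ^+ k.+1 by near: s.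
have h4 : w * s ^+ (size P2).-1 <= `|P2.[s]| by near: s.
have sk : 1 <= s ^+ k.+1 by rewrite exprn_ege1.
have h5 : w * s ^+ k.+2 <= (C * 2 ^+ k.+1 + 1) * s ^+ k.+1.
  apply: (@le_trans _ _ `|P2.[s]|).
    apply: le_trans h4; rewrite ler_wpM2l ?(ltW w0)// ler_weXn2l//.
    by rewrite -ltnS prednK// size_poly_gt0.
  have e0 : 0 <= e s by apply: le_trans h2; rewrite mulr_ge0 ?divr_ge0 ?exprn_ge0 ?(ltW c0).
  rewrite mulrDl mul1r -[P2.[s]](addrK (e s)); apply: (le_trans (ler_normB _ _)).
  by rewrite addrC lerD ?(ger0_norm e0)// (le_trans h1 sk).
have h6 : (C * 2 ^+ k.+1 + 2) / w <= s by near: s; apply: nbhs_pinfty_ge; exact: num_real.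
move: h5; rewrite [s ^+ k.+2]exprS mulrA ler_pM2r ?(lt_le_trans _ sk)//.
by move: h6; rewrite ler_pdivrMr// mulrC => h6 h7; lra.
Unshelve. all: by end_near. Qed.

End PolynomialGrowth.

(** * Convolution with a rapidly decaying function *)

Section LogGrowth.
Variable R : realType.

Lemma powRD_gt0 (x a b : R) : 0 < x -> x `^ (a + b) = x `^ a * x `^ b.
Proof. by move=> x0; apply: powRD; rewrite (gt_eqF x0) /= implybT. Qed.

Lemma exprn_le_expR (n : nat) (d : R) : 0 < d ->
  exists2 C : R, 0 < C & forall w, 0 <= w -> (1 + w) ^+ n <= C * expR (d * w).
Proof.
move=> d0; case: n => [|n].
  by exists 1 => // w w0; rewrite expr0 mul1r -[leLHS]expR0 ler_expR mulr_ge0// ltW.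
(* For e > 0, 1 + w <= (1 + 1/e)(1 + e w) <= (1 + 1/e) exp (e w); the power n + 1 turns exp (e w)
   into exp (d w). *)
pose e := d / n.+1%:R; have n0 : 0 < n.+1%:R :> R by rewrite ltr0n.
have e0 : 0 < e by rewrite divr_gt0.
exists ((1 + e^-1) ^+ n.+1) => [|w w0]; first by rewrite exprn_gt0// addr_gt0// invr_gt0.
have -> : expR (d * w) = expR (e * w) ^+ n.+1.
  by rewrite -expRM_natl /e mulrA mulrCA mulfV ?mulr1// gt_eqF.
rewrite -exprMn; apply: lerXn2r; rewrite ?nnegrE ?addr_ge0// ?mulr_ge0 ?addr_ge0 ?expR_ge0 ?invr_ge0 ?(ltW e0)//.
apply: (@le_trans _ _ ((1 + e^-1) * (1 + e * w))); last first.
  by rewrite ler_wpM2l ?expR_ge1Dx// addr_ge0// invr_ge0 ltW.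
rewrite mulrDl mul1r mulrDr mulr1 mulrA mulVf ?gt_eqF// mul1r.
have := mulr_ge0 (ltW e0) w0; have : 0 <= e^-1 by rewrite invr_ge0 ltW.
by move: (e * w) (e^-1) => a b; lra.
Qed.

Lemma poly_le_exprn (P : {poly R}) : exists2 C : R, 0 <= C &
  forall u, `|P.[u]| <= C * (1 + `|u|) ^+ size P.
Proof.
exists (\sum_(i < size P) `|P`_i|) => [|u]; first by rewrite sumr_ge0.
rewrite horner_coef mulr_suml; apply: (le_trans (ler_norm_sum _ _ _)).
apply: ler_sum => i _; rewrite normrM ler_wpM2l// normrX.
have u1 : 1 <= 1 + `|u| by rewrite lerDl.
apply: (@le_trans _ _ ((1 + `|u|) ^+ i)); first by apply: lerXn2r; rewrite ?nnegrE// lerDr.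
by rewrite ler_weXn2l// ltnW.
Qed.

(* Makes the error term at x / m, where ln x = ln (x/m) + ln m, uniform in m for
   either sign of b. *)
Lemma ln_powR_split (b : R) : exists n : nat, forall L M : R, 1 <= L -> 0 <= M ->
  L `^ b <= (L + M) `^ b * (1 + M) ^+ n.
Proof.
have [n hn] := powR_le_exprn (- b).
exists n => L M L1 M0; have L0 : 0 < L by apply: lt_le_trans L1.
have M1 : 1 <= 1 + M by rewrite lerDl.
have [b0|b0] := leP 0 b.
  apply: (@le_trans _ _ ((L + M) `^ b)).
    by apply: ge0_ler_powR; rewrite ?nnegrE ?addr_ge0 ?(ltW L0)// lerDl.
  by rewrite ler_peMr ?powR_ge0// exprn_ege1.
apply: (@le_trans _ _ ((L + M) `^ b * (1 + M) `^ (- b))); last by rewrite ler_wpM2l ?powR_ge0// hn.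
rewrite powRN ler_pdivlMr ?powR_gt0 ?(lt_le_trans _ M1)//.
rewrite -powRM ?(ltW L0) ?(le_trans _ M1)//.
have M10 : 0 < 1 + M by apply: lt_le_trans M1.
have LM0 : 0 < L + M by rewrite ltr_wpDr.
rewrite -[b]opprK powRN [leRHS]powRN lef_pV2 ?posrE ?powR_gt0 ?mulr_gt0//.
apply: ge0_ler_powR; rewrite ?nnegrE ?mulr_ge0 ?addr_ge0 ?(ltW L0)//; first by rewrite oppr_ge0 ltW.
by rewrite mulrDr mulr1 lerD2l ler_peMl.
Qed.

End LogGrowth.

Section DirichletAsymptotics.
Variables (R : realType) (k : nat) (f : nat -> R) (P2 : {poly R}) (alpha beta sigma W : R).
Let A := zeta2 R ^+ k.
Hypothesis sigma0 : 0 < sigma.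
Hypothesis sigma_alpha : sigma < alpha.
Hypothesis alpha_half : alpha < 2^-1.
Hypothesis fW : abs_bounded (fun m => f m.+1 * m.+1%:R `^ (- sigma)) W.
Hypothesis hD : exists K : R, \forall x \near +oo,
  `|square_count R k (Num.truncn x) - (A * x + x `^ 2^-1 * P2.[ln x])| <= K * (x `^ alpha * ln x `^ beta).

Definition main_part (y : R) : R := A * y + y `^ 2^-1 * P2.[ln y].

Definition error_part (y : R) : R := square_count R k (Num.truncn y) - main_part y.

Lemma sigma_half : 0 < 2^-1 - sigma.
Proof. by rewrite subr_gt0; apply: lt_trans alpha_half. Qed.

Lemma le_mul_powR (Y y : R) : 1 <= Y -> 0 < y -> y <= Y -> y <= Y * y `^ sigma.
Proof.
move=> Y1 y0 yY; have s1 : sigma <= 1.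
  by have := lt_trans sigma_alpha alpha_half; lra.
have [y1|y1] := leP y 1.
  apply: (@le_trans _ _ (y `^ sigma)); last by rewrite ler_peMl ?powR_ge0.
  by rewrite -[leLHS]powRr1 ?(ltW y0)//; apply: ger_powR => //; rewrite y0.
apply: (le_trans yY); rewrite ler_peMr ?(le_trans _ Y1)//.
by rewrite -[leLHS](powRr0 y); apply: ler_powR; rewrite ltW.
Qed.

(** Covers the m with x/m <= Y, where [hD] gives nothing. As m is unbounded, y may tend to 0; there
    y^(1/2 - sigma) absorbs the powers of |ln y|. *)
Lemma error_part_small (Y : R) : 1 <= Y -> exists2 C : R, 0 <= C &
  forall y, 0 < y -> y <= Y -> `|error_part y| <= C * y `^ sigma.
Proof.
move=> Y1; have A0 : 0 <= A by rewrite exprn_ge0// (le_trans _ (zeta2_ge1 R)).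
have d0 := sigma_half; set d := 2^-1 - sigma in d0.
have [C1 C10 h1] := poly_le_exprn P2.
have [C2 C20 h2] := exprn_le_expR (size P2) d0.
have U0 : 0 <= ln Y by rewrite ln_ge0.
pose C3 := C1 * (expR (d * ln Y) * (1 + ln Y) ^+ size P2 + C2).
have C30 : 0 <= C3 by rewrite mulr_ge0// addr_ge0 ?mulr_ge0 ?expR_ge0 ?exprn_ge0 ?addr_ge0 ?(ltW C20).
have Yge0 : 0 <= Y by apply: le_trans Y1.
exists (A * Y + A * Y + C3) => [|y y0 yY]; first by rewrite addr_ge0 ?addr_ge0 ?(mulr_ge0 A0 Yge0).
have hy := le_mul_powR Y1 y0 yY.
rewrite /error_part /main_part opprD addrA; apply: (le_trans (ler_normB _ _)).
rewrite [leRHS]mulrDl lerD//.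
  apply: (le_trans (ler_normB _ _)); rewrite mulrDl lerD//.
    have sc0 : 0 <= square_count R k (Num.truncn y).
      elim: (k) (Num.truncn y) => [|i IH] X; first by rewrite /square_count /=.
      by rewrite /square_count iterS sumr_ge0// => e _; exact: IH.
    rewrite ger0_norm//; apply: (le_trans (square_count_le _ _ _)); rewrite -mulrA ler_wpM2l//.
    by apply: le_trans hy; have /andP[] := truncn_itv (ltW y0).
  by rewrite ger0_norm ?mulr_ge0 ?(ltW y0)// -mulrA ler_wpM2l.
have -> : y `^ 2^-1 = expR (d * ln y) * y `^ sigma.
  by rewrite /powR gt_eqF// -expRD -mulrDl subrK.
rewrite !normrM [`|expR _|]ger0_norm ?expR_ge0// [`|_ `^ _|]ger0_norm ?powR_ge0//.
rewrite mulrAC ler_wpM2r ?powR_ge0//.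
apply: (le_trans (ler_wpM2l (expR_ge0 _) (h1 _))); rewrite mulrCA /C3 ler_wpM2l//.
have [l0|l0] := leP 0 (ln y).
  have lY : ln y <= ln Y by rewrite ler_ln ?posrE// (lt_le_trans y0).
  apply: (@le_trans _ _ (expR (d * ln Y) * (1 + ln Y) ^+ size P2)); last by rewrite lerDl ltW.
  rewrite ger0_norm// ler_pM ?expR_ge0 ?exprn_ge0 ?addr_ge0//.
    by rewrite ler_expR ler_wpM2l// ltW.
  by apply: lerXn2r; rewrite ?nnegrE ?addr_ge0// lerD2l.
apply: (@le_trans _ _ C2); last by rewrite lerDr mulr_ge0 ?expR_ge0 ?exprn_ge0 ?addr_ge0.
rewrite ltr0_norm//; have := h2 (- ln y); rewrite oppr_ge0 (ltW l0) => /(_ isT) h.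
apply: (le_trans (ler_wpM2l (expR_ge0 _) h)).
by rewrite mulrCA -expRD mulrN subrr expR0 mulr1.
Qed.

Lemma error_part_uniform : exists Y K C : R, [/\ 1 < Y, 0 <= K, 0 <= C &
  forall x (m : nat), Y <= x -> (0 < m)%N ->
   `|error_part (x / m%:R)| <= (K * (x `^ alpha * ln x `^ beta) + C * x `^ sigma) * m%:R `^ (- sigma)].
Proof.
have [K [M0 [_ hM]]] := hD.
(* Above Y the asymptotics [hM] apply and the logarithm is at least 1, as [ln_powR_split]
   requires. *)
pose Y := Num.max (Num.max M0 0) (expR 1) + 1.
have YM : M0 < Y by rewrite /Y ltr_pwDr// !le_max lexx.
have Ye : expR 1 <= Y by rewrite /Y ler_wpDr// le_max lexx orbT.
have Y1 : 1 < Y by apply: lt_le_trans Ye; rewrite -[ltLHS]expR0 ltr_expR.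
have Y0 : 0 < Y by apply: lt_trans Y1.
have [C C0 hC] := error_part_small (ltW Y1).
have [n hn] := ln_powR_split beta.
have d0 : 0 < alpha - sigma by rewrite subr_gt0.
have [C4 C40 h4] := exprn_le_expR n d0.
exists Y, (`|K| * C4), C; split; rewrite ?mulr_ge0 ?(ltW C40)// => x m Yx m0.
have x0 : 0 < x by apply: lt_le_trans Yx.
have m0' : 0 < m%:R :> R by rewrite ltr0n.
have m1 : 1 <= m%:R :> R by rewrite ler1n.
have xm0 : 0 < x / m%:R by rewrite divr_gt0.
have T1 : 0 <= `|K| * C4 * (x `^ alpha * ln x `^ beta) by rewrite !mulr_ge0 ?powR_ge0 ?(ltW C40).
have T2 : 0 <= C * x `^ sigma by rewrite mulr_ge0 ?powR_ge0.
have divp s : (x / m%:R) `^ s = x `^ s * m%:R `^ (- s).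
  by rewrite powRM ?invr_ge0 ?(ltW x0) ?(ltW m0')// -powR_inv1 ?(ltW m0')// -powRrM mulN1r.
have [xmY|xmY] := leP (x / m%:R) Y.
  apply: (le_trans (hC _ xm0 xmY)); rewrite divp mulrA ler_wpM2r ?powR_ge0//.
  by rewrite lerDr.
have hL : 1 <= ln (x / m%:R).
  by rewrite -[leLHS]expRK ler_ln ?posrE ?expR_gt0//; apply: ltW; apply: le_lt_trans xmY.
have lM : 0 <= ln m%:R :> R by rewrite ln_ge0.
have lx : ln x = ln (x / m%:R) + ln m%:R by rewrite ln_div ?posrE// subrK.
have h3 := hn _ _ hL lM; rewrite -lx in h3.
apply: le_trans (hM _ (lt_trans YM xmY)) _.
apply: (@le_trans _ _ (`|K| * ((x / m%:R) `^ alpha * ln (x / m%:R) `^ beta))).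
  by rewrite ler_wpM2r ?ler_norm// mulr_ge0 ?powR_ge0.
apply: (@le_trans _ _ (`|K| * C4 * (x `^ alpha * ln x `^ beta) * m%:R `^ (- sigma))); last first.
  by rewrite ler_wpM2r ?powR_ge0// lerDl.
rewrite -!mulrA ler_wpM2l// divp.
(* The loss (1 + ln m)^n is paid for with m^(alpha - sigma), which leaves m^(-sigma). *)
apply: (@le_trans _ _ (x `^ alpha * m%:R `^ (- alpha) * (ln x `^ beta * (C4 * m%:R `^ (alpha - sigma))))).
  rewrite ler_wpM2l ?mulr_ge0 ?powR_ge0//; apply: (le_trans h3); rewrite ler_wpM2l ?powR_ge0//.
  by apply: (le_trans (h4 _ lM)); rewrite /powR gt_eqF.
have -> : m%:R `^ (- sigma) = m%:R `^ (- alpha) * m%:R `^ (alpha - sigma) :> R.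
  by rewrite -powRD_gt0// addrA addNr add0r.
by rewrite le_eqVlt; apply/orP; left; apply/eqP; ring.
Qed.

Lemma log_weighted_bounded (j : nat) :
  exists B, abs_bounded (fun m => f m.+1 * m.+1%:R `^ (- 2^-1) * (- ln m.+1%:R) ^+ j) B.
Proof.
have [C C0 h] := exprn_le_expR j sigma_half.
exists (`|C| * W); apply: abs_bounded_le (abs_bounded_scale C fW) => m.
have m1 : 1 <= m.+1%:R :> R by rewrite ler1n.
have m0 : 0 < m.+1%:R :> R by rewrite ltr0n.
have l0 : 0 <= ln m.+1%:R :> R by rewrite ln_ge0.
rewrite !normrM normrX normrN [`|ln _|]ger0_norm// mulrCA -mulrA ler_wpM2l//.
rewrite !(ger0_norm (powR_ge0 _ _)) (ger0_norm (ltW C0)).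
apply: (@le_trans _ _ (m.+1%:R `^ (- 2^-1) * (C * m.+1%:R `^ (2^-1 - sigma)))).
  rewrite ler_wpM2l ?powR_ge0//; apply: le_trans (_ : (1 + ln m.+1%:R) ^+ j <= _).
    by apply: lerXn2r; rewrite ?nnegrE ?addr_ge0// lerDr.
  by apply: (le_trans (h _ l0)); rewrite /powR gt_eqF.
by rewrite mulrCA ler_wpM2l ?(ltW C0)// -powRD_gt0// addrA addNr add0r.
Qed.

Lemma inverse_weighted_bounded : exists B, abs_bounded (fun m => f m.+1 * m.+1%:R `^ (- 1)) B.
Proof.
exists W; apply: abs_bounded_le fW => m; rewrite !normrM ler_wpM2l//.
rewrite !(ger0_norm (powR_ge0 _ _)); apply: ler_powR; first by rewrite ler1n.
rewrite lerN2; have := sigma_half; have : (2^-1 : R) <= 1 by rewrite invf_le1// ler1n.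
by move=> h1 h2; apply: ltW; apply: lt_le_trans h1; rewrite -subr_gt0.
Qed.

(** The series for the j-th derivative at s = 1/2 of the Dirichlet series of f. *)
Definition log_moment (j : nat) : R :=
  limn (series (fun m => f m.+1 * m.+1%:R `^ (- 2^-1) * (- ln m.+1%:R) ^+ j)).

Definition inverse_moment : R := limn (series (fun m => f m.+1 * m.+1%:R `^ (- 1))).

(* Taylor's formula for P2 (ln x - ln m), summed against f(m) m^(-1/2). *)
Definition log_poly : {poly R} := \sum_(j < size P2) log_moment j *: P2^`N(j).

Lemma main_part_series (x : R) : 0 < x ->
  series (fun m => f m.+1 * main_part (x / m.+1%:R)) @ \oo -->
  A * inverse_moment * x + x `^ 2^-1 * log_poly.[ln x].
Proof.
move=> x0.
have c1 : series (fun m => f m.+1 * m.+1%:R `^ (- 1)) @ \oo --> inverse_moment.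
  by have [B hB] := inverse_weighted_bounded; apply: abs_bounded_cvg hB.
have c2 j : series (fun m => f m.+1 * m.+1%:R `^ (- 2^-1) * (- ln m.+1%:R) ^+ j) @ \oo --> log_moment j.
  by have [B hB] := log_weighted_bounded j; apply: abs_bounded_cvg hB.
have c3 : (fun N => \sum_(j < size P2) series (fun m => f m.+1 * m.+1%:R `^ (- 2^-1) * (- ln m.+1%:R) ^+ j) N * P2^`N(j).[ln x])
   @ \oo --> \sum_(j < size P2) log_moment j * P2^`N(j).[ln x].
  by apply: cvg_big => [|j _]; [exact: add_continuous|apply: cvgMl; exact: c2].
have c4 : (fun N => A * x * series (fun m => f m.+1 * m.+1%:R `^ (- 1)) N + x `^ 2^-1 *
    \sum_(j < size P2) series (fun m => f m.+1 * m.+1%:R `^ (- 2^-1) * (- ln m.+1%:R) ^+ j) N * P2^`N(j).[ln x])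
   @ \oo --> A * x * inverse_moment + x `^ 2^-1 * \sum_(j < size P2) log_moment j * P2^`N(j).[ln x].
  by apply: cvgD; apply: cvgMr; [exact: c1|exact: c3].
have -> : A * inverse_moment * x + x `^ 2^-1 * log_poly.[ln x] =
   A * x * inverse_moment + x `^ 2^-1 * \sum_(j < size P2) log_moment j * P2^`N(j).[ln x].
  rewrite [A * _ * x]mulrAC; congr (_ + _ * _).
  by rewrite /log_poly horner_sum; apply: eq_bigr => j _; rewrite hornerZ.
apply: cvg_trans c4; apply: near_eq_cvg; near=> N.
rewrite /series /= mulr_sumr mulr_sumr.
under [X in _ + X]eq_bigr do rewrite mulr_suml mulr_sumr.
rewrite exchange_big /= -big_split /=; apply: eq_bigr => m _.
have m0 : 0 < m.+1%:R :> R by rewrite ltr0n.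
rewrite /main_part ln_div ?posrE// (nderiv_taylor _ (mulrC _ _)).
have -> : (x / m.+1%:R) `^ 2^-1 = x `^ 2^-1 * m.+1%:R `^ (- 2^-1).
  by rewrite powRM ?invr_ge0 ?(ltW x0) ?(ltW m0)// -(powR_inv1 (ltW m0)) -powRrM mulN1r.
rewrite (powR_inv1 (ltW m0)) mulrDr; congr (_ + _); first by ring.
rewrite !mulr_sumr; apply: eq_bigr => j _.
by move: (_ `^ _) (_ `^ _) (_ ^+ j) (P2^`N(j).[_]) => a b c d; ring.
Unshelve. all: by end_near. Qed.

(** Since D vanishes below 1, the sum over m <= x may be written over all m. Subtracting
    [main_part_series] leaves the sum of f(m) times the error at x/m, bounded termwise by
    [error_part_uniform]. *)
Lemma dirichlet_asymptotic : exists Y K C : R, [/\ 1 < Y, 0 <= K, 0 <= C &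
  forall x, Y <= x ->
  `|dirichlet f (square_count R k) (Num.truncn x)
    - (A * inverse_moment * x + x `^ 2^-1 * log_poly.[ln x])|
   <= K * (x `^ alpha * ln x `^ beta) + C * x `^ sigma].
Proof.
have [Y [K [C [Y1 K0 C0 h]]]] := error_part_uniform.
have W0 := abs_bounded_ge0 fW.
exists Y, (K * W), (C * W); split; rewrite ?mulr_ge0// => x Yx.
have x0 : 0 < x by apply: lt_le_trans Yx; apply: lt_trans Y1.
set X := Num.truncn x; set T := A * _ * x + _.
have c : (fun N => `|dirichlet f (square_count R k) X - series (fun m => f m.+1 * main_part (x / m.+1%:R)) N|)
   @ \oo --> `|dirichlet f (square_count R k) X - T|.
  by apply: cvg_norm; apply: cvgB; [exact: cvg_cst|exact: main_part_series].
rewrite -(cvg_lim _ c)//; apply: limr_le; first by apply/cvgP: c.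
near=> N; have XN : (X <= N)%N by near: N; exists X.
have -> : dirichlet f (square_count R k) X = \sum_(0 <= m < N) f m.+1 * square_count R k (Num.truncn (x / m.+1%:R)).
  rewrite /dirichlet big_add1 /= [RHS](big_cat_nat (n := X))//= [X in _ = _ + X]big1_seq ?addr0; last first.
    move=> m /andP[_]; rewrite mem_index_iota => /andP[Xm _].
    by rewrite truncn_div ?(ltW x0)// divn_small ?square_count0 ?mulr0.
  by apply: eq_bigr => m _; rewrite truncn_div// ltW.
rewrite /series /= -sumrB; apply: (le_trans (ler_norm_sum _ _ _)).
set G := K * (x `^ alpha * ln x `^ beta) + C * x `^ sigma.
have G0 : 0 <= G by rewrite addr_ge0 ?mulr_ge0 ?powR_ge0.
have -> : K * W * (x `^ alpha * ln x `^ beta) + C * W * x `^ sigma = G * W by rewrite /G; ring.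
apply: (@le_trans _ _ (\sum_(0 <= m < N) G * `|f m.+1 * m.+1%:R `^ (- sigma)|)); last first.
  by rewrite -mulr_sumr ler_wpM2l.
apply: ler_sum => m _; rewrite -mulrBr !normrM mulrCA ler_wpM2l//.
by rewrite [`|_ `^ _|]ger0_norm ?powR_ge0//; apply: h.
Unshelve. all: by end_near. Qed.

(** Derivatives of order j > 0 have lower degree, so the coefficient in top position is that of [P2]
    times [log_moment 0]. *)
Lemma size_log_poly : log_moment 0 != 0 -> size log_poly = size P2.
Proof.
move=> b0; have coefE i : log_poly`_i = \sum_(j < size P2) log_moment j * (P2`_(j + i) *+ 'C(j + i, j)).
  by rewrite /log_poly coef_sum; apply: eq_bigr => j _; rewrite coefZ coef_nderivn.
apply/eqP; rewrite eqn_leq; apply/andP; split.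
  apply/leq_sizeP => i hi; rewrite coefE big1// => j _.
  by rewrite nth_default ?mul0rn ?mulr0// (leq_trans hi)// leq_addl.
case E : (size P2) => [|n]//; rewrite ltnNge; apply/negP => /leq_sizeP /(_ n (leqnn n)).
rewrite coefE E big_ord_recl big1 ?addr0 => [|i _]; last first.
  by rewrite nth_default ?mul0rn ?mulr0// E lift0 addSn ltnS leq_addl.
rewrite -[nat_of_ord ord0]/0%N bin0 mulr1n add0n => /eqP; rewrite mulf_eq0 (negbTE b0) /=.
have -> : P2`_n = lead_coef P2 by rewrite lead_coefE E.
by rewrite lead_coef_eq0 => /eqP p0; rewrite p0 size_poly0 in E.
Qed.

End DirichletAsymptotics.

(** * The mean value of a(n)^r *)

Section MeanValue.
Variable R : realType.

Lemma near_ln (P : R -> Prop) : (\forall s \near +oo, P s) -> \forall x \near +oo, P (ln x).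
Proof.
move=> [M [_ hM]]; near=> x; apply: hM; rewrite -[ltLHS]expRK ltr_ln ?posrE ?expR_gt0//.
Unshelve. all: by end_near. Qed.

Lemma near_natr (P : R -> Prop) : (\forall x \near +oo, P x) -> \forall X \near \oo, P X%:R.
Proof.
move=> [M [_ hM]]; exists (Num.truncn `|M|).+1 => // X /= hX; apply: hM.
apply: le_lt_trans (ler_norm M) _; have /andP[_ h] := truncn_itv (normr_ge0 M).
by apply: (lt_le_trans h); rewrite ler_nat.
Qed.

(** x^(alpha - sigma) outgrows every power of ln x, which also covers negative beta. *)
Lemma powR_absorb (alpha beta sigma : R) : sigma < alpha ->
  \forall x \near +oo, x `^ sigma <= x `^ alpha * ln x `^ beta.
Proof.
move=> sa; have [n hn] := powR_le_exprn (- beta).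
have d0 : 0 < alpha - sigma by rewrite subr_gt0.
have h := near_ln (@expR_beats R 1 (alpha - sigma) n d0).
near=> x.
have x0 : 0 < x by near: x; exact: nbhs_pinfty_gt.
have lx : 1 <= ln x by near: x; apply: (@near_ln (fun s => 1 <= s)); exact: nbhs_pinfty_ge.
have l0 : 0 < ln x by apply: lt_le_trans lx.
have hx : 1 * ln x ^+ n <= expR ((alpha - sigma) * ln x) by near: x.
rewrite mul1r in hx; have := le_trans (hn _ lx) hx.
rewrite powRN -ler_pV2 ?inE ?unitfE ?gt_eqF ?expR_gt0 ?invr_gt0 ?powR_gt0//= invrK -expRN => hb.
rewrite -[sigma](subrKC alpha) addrC powRD_gt0// mulrC ler_wpM2l ?powR_ge0//.
by apply: le_trans hb; rewrite /powR gt_eqF// ler_expR -mulNr opprB.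
Unshelve. all: by end_near. Qed.

(** A formula of this shape determines its linear coefficient as a limit, so that two expressions
    for the coefficient can be compared. *)
Lemma asymptotic_mean (F : nat -> R) (c alpha beta sigma Y K C : R) (Q : {poly R}) :
  alpha <= 2^-1 -> sigma <= 2^-1 -> 0 <= K -> 0 <= C ->
  (forall x, Y <= x -> `|F (Num.truncn x) - (c * x + x `^ 2^-1 * Q.[ln x])| <=
     K * (x `^ alpha * ln x `^ beta) + C * x `^ sigma) ->
  (fun X => F X / X%:R) @ \oo --> c.
Proof.
move=> a2 s2 K0 C0 hF.
have [D D0 hD] := poly_growth_le (leqnSn (size Q)).
have [n hn] := powR_le_exprn beta.
apply/cvgrPdist_le => e e0.
have h2 : 0 < 2^-1 :> R by rewrite invr_gt0.
have hE := near_ln (@expR_beats R (e^-1 * (D + K + C)) 2^-1 (size Q + n) h2).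
suff /near_natr : \forall x \near +oo, `|F (Num.truncn x) - c * x| <= e * x.
  move=> h; near=> X.
  have X0 : 0 < X%:R :> R by rewrite ltr0n; near: X; exact: nbhs_infty_gt.
  have -> : c - F X / X%:R = - ((F X - c * X%:R) / X%:R) by field; rewrite gt_eqF.
  rewrite normrN normrM [`|_^-1|]ger0_norm ?invr_ge0 ?(ltW X0)// ler_pdivrMr//.
  have : `|F (Num.truncn (X%:R : R)) - c * X%:R| <= e * X%:R by near: X.
  by rewrite natrK.
near=> x.
have x1 : 1 <= x by near: x; exact: nbhs_pinfty_ge.
have x0 : 0 < x by apply: lt_le_trans x1.
have s1 : 1 <= ln x by near: x; apply: (@near_ln (fun s => 1 <= s)); exact: nbhs_pinfty_ge.
have hx : Y <= x by near: x; apply: nbhs_pinfty_ge; exact: num_real.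
have h1 : e^-1 * (D + K + C) * ln x ^+ (size Q + n) <= expR (2^-1 * ln x) by near: x.
have := hF _ hx; set s := ln x in s1 h1 *.
have hy : expR (2^-1 * s) = x `^ 2^-1 by rewrite /powR gt_eqF.
set y := x `^ 2^-1 in hy *.
have y0 : 0 < y by rewrite powR_gt0.
have xy : x = y * y by rewrite -powRD_gt0// (_ : 2^-1 + 2^-1 = 1) ?powRr1 ?(ltW x0)//; lra.
set N := (size Q + n)%N in h1.
have sN1 : 1 <= s ^+ N by rewrite exprn_ege1.
have pa : x `^ alpha * s `^ beta <= y * s ^+ N.
  apply: ler_pM; rewrite ?powR_ge0//; first by apply: ler_powR.
  by apply: (le_trans (hn _ s1)); rewrite ler_weXn2l// leq_addl.
have ps : x `^ sigma <= y * s ^+ N.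
  by apply: (@le_trans _ _ y); [apply: ler_powR | rewrite ler_peMr ?(ltW y0)].
have pq : `|y * Q.[s]| <= D * (y * s ^+ N).
  rewrite normrM ger0_norm ?(ltW y0)// mulrCA ler_wpM2l ?(ltW y0)//.
  by apply: (le_trans (hD _ s1)); rewrite ler_wpM2l// ler_weXn2l// leq_addr.
have pa' := ler_wpM2l K0 pa; have ps' := ler_wpM2l C0 ps.
have pe : (D + K + C) * (y * s ^+ N) <= e * x.
  move: h1; rewrite hy -mulrA ler_pdivrMl// => h1.
  by rewrite mulrCA xy [e * _]mulrCA ler_wpM2l ?(ltW y0).
move: pa' ps' pq pe; rewrite !mulrDl !ler_norml.
move: (y * Q.[s]) (K * _) (C * _) (D * _) (e * x) => q a b d z.
move: (K * _) (C * _) => a' b' ? ? /andP[? ?] ? /andP[? ?].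
by apply/andP; split; lra.
Unshelve. all: by end_near. Qed.

(** With g the quotient of a^r by zeta(s), the mean is the sum of g(m) floor(X/m) / X, dominated by
    |g(m)|/m and convergent termwise to g(m)/m. *)
Lemma abelian_mean (r : nat) :
  (fun X => (\sum_(1 <= n < X.+1) num_abelian n ^ r)%N%:R / X%:R) @ \oo
     --> limn (series (fun n => quotient_term r 0 (1 : R) n.+1)).
Proof.
have c1 v : (0 < v < 2)%N -> quotient_coef R r 0 v = 0.
  by case: v => [|[|v]]// _; have [] := @quotient_coef012 R r 0.
have [B hB] : exists B, abs_bounded (fun n => quotient_term r 0 (1 : R) n.+1) B.
  by apply: (quotient_term_bounded c1); rewrite ?mulr1 ?ltr1n.
pose u (X m : nat) : R := multf (quotient_coef R r 0) m.+1 * ((X %/ m.+1)%:R / X%:R).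
have hu X m : `|u X m| <= `|quotient_term r 0 (1 : R) m.+1|.
  rewrite /u /quotient_term normrM [leRHS]normrM ler_wpM2l// powR_inv1//.
  rewrite !ger0_norm ?divr_ge0 ?invr_ge0//; have [->|X0] := posnP X.
    by rewrite invr0 mulr0 invr_ge0.
  by rewrite ler_pdivrMr ?ltr0n// mulrC ler_pdivlMr ?ltr0n// -natrM ler_nat leq_divM.
have hw : abs_bounded (fun m => `|quotient_term r 0 (1 : R) m.+1|) B.
  by apply: abs_bounded_le hB => m; rewrite normr_id.
have cu m : (fun X => u X m) @ \oo --> quotient_term r 0 (1 : R) m.+1.
  rewrite /u /quotient_term; apply: cvgM; first exact: cvg_cst.
  rewrite powR_inv1//; apply/cvgrPdist_le => e e0; near=> X.
  have X0 : 0 < X%:R :> R by rewrite ltr0n; near: X; exact: nbhs_infty_gt.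
  have m0 : 0 < m.+1%:R :> R by rewrite ltr0n.
  have eX : e^-1 <= X%:R by near: X; apply: nbhs_infty_ger.
  have -> : m.+1%:R^-1 - (X %/ m.+1)%:R / X%:R = (X%:R - (X %/ m.+1)%:R * m.+1%:R) / (m.+1%:R * X%:R) :> R.
    by field; rewrite !gt_eqF.
  have -> : X%:R - (X %/ m.+1)%:R * m.+1%:R = (X %% m.+1)%:R :> R.
    by rewrite [X in X%:R - _](divn_eq X m.+1) natrD natrM addrC addKr.
  rewrite ger0_norm ?divr_ge0 ?mulr_ge0// ler_pdivrMr ?mulr_gt0//.
  apply: (@le_trans _ _ m.+1%:R); first by rewrite ler_nat ltnW// ltn_mod.
  by rewrite mulrCA ler_peMr// mulrC -ler_pdivrMr// div1r.
have [_] := tannery hu hw cu.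
rewrite (_ : (fun X => \sum_(0 <= m < X) u X m) = (fun X => (\sum_(1 <= n < X.+1) num_abelian n ^ r)%N%:R / X%:R))//.
apply/funext => X; rewrite abelian_dirichlet1 big_add1 /= mulr_suml.
by apply: eq_bigr => m _; rewrite /u mulrA.
Unshelve. all: by end_near. Qed.

Lemma remainder_square_count (k : nat) (alpha beta : R) : alpha < 2^-1 ->
  vinogradov (fun x => Normc.normc (remainder (1%N :: nseq k.+2 2%N) x))
     (fun x => x `^ alpha * (ln x) `^ beta) ->
  exists2 P : {poly R}, size P = k.+2 & exists K, \forall x \near +oo,
    `|square_count R k.+2 (Num.truncn x)
        - (zeta2 R ^+ k.+2 * x + x `^ 2^-1 * P.[ln x])| <= K * (x `^ alpha * ln x `^ beta).
Proof.
move=> a2 [K hK]; have [P1 [P2 hP]] := @remainder_form R k.+2 isT.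
have js : all (leq 1) (1%N :: nseq k.+2 2%N) by rewrite /= all_nseq orbT.
have h : \forall x \near +oo, `|square_count R k.+2 (Num.truncn x)
      - (x * P1.[ln x] + x `^ 2^-1 * P2.[ln x])| <= K * (x `^ alpha * ln x `^ beta).
  near=> x; have x0 : 0 < x by near: x; exact: nbhs_pinfty_gt.
  have := hP x x0; rewrite (gen_divisor_summatory _ _ js) iter_dilationE => /le_trans; apply.
  by apply: le_trans (ler_norm _) _; near: x.
have [e1 e2] := compare_polynomials a2 h; exists P2 => //; exists K.
apply: filterS h => x; rewrite e1 hornerC mulrC; exact.
Unshelve. all: by end_near. Qed.

End MeanValue.

Unset Implicit Arguments.

Theorem theorem1 (R : realType) (r : nat) (alpha beta : R)
  (hr : (2 <= r)%N) (halpha : 3^-1 < alpha < 2^-1)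
  (hDelta : vinogradov
     (fun x => Normc.normc (remainder (1%N :: nseq (2 ^ r - 1)%N 2%N) x))
     (fun x => x `^ alpha * (ln x) `^ beta)) :
  (forall p : nat, prime p -> cvgn (euler_factor_psum R r p)) /\
  cvgn (euler_pprod R r) /\
  exists Q : {poly R},
    size Q = (2 ^ r - 2)%N.+1 /\
    vinogradov
      (fun x => (\sum_(1 <= n < (Num.truncn x).+1) num_abelian n ^ r)%N%:R
                - (euler_const R r * x + x `^ 2^-1 * Q.[ln x]))
      (fun x => x `^ alpha * (ln x) `^ beta).
Proof.
have /andP[a3 a2] := halpha.
split; first by move=> p pp; apply/cvgP: (@euler_factor_cvg R r p pp).
split; first by apply/cvgP: (@euler_const_cvg R r).
have r4 : (2 ^ 2 <= 2 ^ r)%N by rewrite leq_exp2l.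
have kE : (2 ^ r - 1)%N = (2 ^ r - 3).+2 by move: r4; move: (2 ^ r)%N => N; lia.
rewrite kE in hDelta; have [P sP hP] := remainder_square_count a2 hDelta.
have rE : (2 ^ r - 2)%N.+1 = (2 ^ r - 3).+2 by move: r4; move: (2 ^ r)%N => N; lia.
rewrite rE -{}sP; set k := (2 ^ r - 3).+2 in kE hP.
have c0 v : (0 < v < 3)%N -> quotient_coef R r k v = 0.
  have [_ c1 c2] := @quotient_coef012 R r k.
  case: v => [|[|[|v]]]// _; rewrite c2 -kE natrB ?expn_gt0// natrX.
  by rewrite subrr.
(* Above 1/3 for absolute convergence of sum f(m) m^(-sigma), below alpha so that x^sigma is
   absorbed in the error. *)
pose sigma := (3^-1 + alpha) / 2.
have s3 : 1 < 3%:R * sigma by rewrite /sigma; lra.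
have s0 : 0 < sigma by rewrite /sigma; lra.
have sa : sigma < alpha by rewrite /sigma; lra.
have [W hW] := quotient_term_bounded c0 s0 s3.
set f := multf (quotient_coef R r k).
have [Y [K [C [Y1 K0 C0 h]]]] := dirichlet_asymptotic s0 sa a2 hW hP.
(* The value at s = 1/2 of the Dirichlet series of f, a positive Euler product; it keeps [log_poly]
   from dropping in degree. *)
have m0 : log_moment f 0 != 0.
  rewrite gt_eqF//; have h0 : 0 < 2^-1 :> R by lra.
  have h3 : 1 < 3%:R * 2^-1 :> R by lra.
  have := quotient_sum_gt0 c0 h0 h3; rewrite /log_moment.
  rewrite (_ : (fun n => quotient_term r k 2^-1 n.+1)
    = (fun m => f m.+1 * m.+1%:R `^ (- 2^-1) * (- ln m.+1%:R) ^+ 0))//.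
  by apply/funext => m; rewrite expr0 mulr1.
have hF (x : R) : dirichlet f (square_count R k) (Num.truncn x) =
    (\sum_(1 <= n < (Num.truncn x).+1) num_abelian n ^ r)%N%:R :> R.
  rewrite (@abelian_dirichlet R r k); apply: eq_bigr => m _; by rewrite iter_dilationE.
exists (log_poly f P); split; first by rewrite size_log_poly.
(* Both sides are the mean value of a(n)^r. *)
have eC : zeta2 R ^+ k * inverse_moment f = euler_const R r.
  rewrite /euler_const (cvg_lim _ (@euler_const_cvg R r))//.
  have := @abelian_mean R r; apply: cvg_unique => //.
  apply: (@asymptotic_mean R _ _ alpha beta sigma Y K C (log_poly f P)) => //.
  - exact: ltW.
  - exact: ltW (lt_trans sa a2).
  - by move=> x /h; rewrite hF.
exists (K + C); near=> x.
have hx : x `^ sigma <= x `^ alpha * ln x `^ beta by near: x; apply: powR_absorb.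
have xY : Y <= x by near: x; apply: nbhs_pinfty_ge; exact: num_real.
have := h _ xY; rewrite hF eC => /le_trans; apply.
by rewrite mulrDl lerD2l ler_wpM2l.
Unshelve. all: by end_near. Qed.
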